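(* Let $D$ be a bounded quasi-circular domain in $\mathbf{C}^n$ with weight $m=(m_1,\dots,m_n)$, containing the origin, and let $f=(f_1,\dots,f_n)$ be an automorphism (biholomorphic self-map) of $D$ with $f(0)=0$. Then $f$ is a polynomial mapping of degree less than or equal to the quasi-resonance order $\nu$. More precisely, for each $1\le i\le n$, the degree of $f_i$ is less than or equal to the $i$-th quasi-resonance order $\nu_i$.
   Context: A domain $D\subset\mathbf{C}^n$ (connected open set) is quasi-circular with weight $m=(m_1,\dots,m_n)$, where the $m_i$ are positive integers, if $D$ is invariant under $(z_1,\dots,z_n)\mapsto(e^{im_1\theta}z_1,\dots,e^{im_n\theta}z_n)$ for every $\theta\in\mathbf{R}$. Convention (without loss of generality): $m_1\le m_2\le\cdots\le m_n$ and $\gcd(m_1,\dots,m_n)=1$. For a multi-index $\alpha=(\alpha_1,\dots,\alpha_n)$ of nonnegative integers, put $|\alpha|=\alpha_1+\cdots+\alpha_n$, $z^\alpha=z_1^{\alpha_1}\cdots z_n^{\alpha_n}$, $m\cdot\alpha=m_1\alpha_1+\cdots+m_n\alpha_n$. For $1\le i\le n$, the $i$-th resonance set is $E_i=\{\alpha: m\cdot\alpha=m_i\}$, and the $i$-th resonance order is $\mu_i=\max\{|\alpha|:\alpha\in E_i\}$. Let $\langle\cdot,\cdot\rangle_D$ be the $L^2$ inner product on $D$ (with respect to Lebesgue measure, linear in the first entry) and $H^2(D)$ the space of holomorphic functions in $L^2(D)$. For each multi-index $\alpha$, let $p_\alpha\in H^2(D)$ be the unique element with $\langle h,p_\alpha\rangle_D=\frac{\partial^\alpha}{\partial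 z^\alpha}h(0)$ for all $h\in H^2(D)$. It is a polynomial that is $m$-homogeneous of order $m\cdot\alpha$, so it can be written $p_\alpha=\sum_{m\cdot\beta=m\cdot\alpha}b^\alpha_\beta z^\beta$. Let $d(\alpha)$ be the minimum of $|\beta|$ over those $\beta$ that actually occur in this expression (i.e. $b^\alpha_\beta\ne0$). Let $\Gamma$ be the set of all multi-indices. For each $k\in\mathbf{N}$ set $P_k=\{\alpha\in\Gamma: d(\alpha)>k\}$ and $Q_k=\Gamma\setminus P_k$. The $i$-th quasi-resonance order is $\nu_i=\max\{|\alpha|:\alpha\in Q_{\mu_i}\}$, and the quasi-resonance order is $\nu=\max_{1\le i\le n}\nu_i$. *)

(* Defs.v *)
From HB Require Import structures.
From mathcomp Require Import all_boot all_order all_algebra.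
(* mpoly also declares a structure Measure and notations that clash with those
   of MathComp-Analysis: import it first and without its notations. *)
From mathcomp.multinomials Require Import -(notations) mpoly.
From mathcomp Require Import all_classical all_reals all_analysis.
From mathcomp Require Import complex.
Set Implicit Arguments.
Unset Strict Implicit.
Unset Printing Implicit Defensive.
Import Order.TTheory GRing.Theory Num.Theory numFieldNormedType.Exports.
Local Open Scope classical_set_scope.
Local Open Scope ring_scope.

(* Packaging R[i] as a numClosedFieldType gives it the C-normed structure that
   MathComp-Analysis puts on any such field; the bare type R[i] carries an
   R-module structure instead. Over (Cx R), [differentiable] is complex
   (Frechet) differentiability and ['D_v] is the complex derivative. *)
Definition Cx (R : realType) : numClosedFieldType := R[i].

Notation Cn R n := ('rV[Cx R]_n).

Section product_power.
Context d (T : measurableType d) (R : realType).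
Variable mu : {sigma_finite_measure set T -> \bar R}.

Definition tcons n (x : T * n.-tuple T) : n.+1.-tuple T := [tuple of x.1 :: x.2].

Lemma measurable_tcons n : measurable_fun [set: T * n.-tuple T] (@tcons n).
Proof.
apply: (@measurable_cons _ _ (T * n.-tuple T)%type T fst n snd).
  exact: measurable_fst.
exact: measurable_snd.
Qed.

Section step.
Variables (n : nat) (nu : {sigma_finite_measure set (n.-tuple T) -> \bar R}).

Definition cons_measure : set (n.+1.-tuple T) -> \bar R :=
  pushforward (mu \x nu)%E (@tcons n).

Let cons_measure0 : cons_measure set0 = 0%E.
Proof. by rewrite /cons_measure /pushforward preimage_set0 measure0. Qed.

Let cons_measure_ge0 A : (0 <= cons_measure A)%E.
Proof. by rewrite /cons_measure /pushforward measure_ge0. Qed.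

Let cons_measure_sigma_additive : semi_sigma_additive cons_measure.
Proof.
move=> F mF tF mUF; rewrite /cons_measure /pushforward preimage_bigcup.
have mtcons A : measurable A -> measurable (@tcons n @^-1` A).
  by move=> mA; rewrite -[X in measurable X]setTI; exact: measurable_tcons.
apply: measure_semi_sigma_additive.
- by move=> k; exact: mtcons.
- apply/trivIsetP => /= i j _ _ ij; rewrite -preimage_setI.
  by move/trivIsetP : tF => /(_ _ _ _ _ ij) ->//; rewrite preimage_set0.
- by rewrite -preimage_bigcup; exact: mtcons.
Qed.

HB.instance Definition _ := isMeasure.Build _ _ _ cons_measure
  cons_measure0 cons_measure_ge0 cons_measure_sigma_additive.

Let cons_measure_sigma_finite : sigma_finite setT cons_measure.
Proof.
have /sigma_finiteP[F [TF ndF Foo]] := sigma_finiteT mu.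
have /sigma_finiteP[G [TG ndG Goo]] := sigma_finiteT nu.
pose g (t : n.+1.-tuple T) : T * n.-tuple T := (thead t, [tuple of behead t]).
have mg : measurable_fun [set: n.+1.-tuple T] g.
  by apply: measurable_fun_pair; [exact: measurable_tnth|
                                  exact: measurable_behead].
have gK : g \o @tcons n = id.
  apply/funext => -[x t]; rewrite /g /tcons /= theadE; congr pair.
  exact/val_inj.
exists (fun k => g @^-1` (F k `*` G k)).
  rewrite -preimage_bigcup (_ : \bigcup_i _ = setT) ?preimage_setT//.
  rewrite -setXTT TF TG predeqE => -[x y]; split.
    by move=> [k _ []/= ? ?]; split; exists k.
  move=> [/= [k _ Fkx] [l _ Gly]]; exists (maxn k l) => //; split.
  - by move: x Fkx; exact/subsetPset/ndF/leq_maxl.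
  - by move: y Gly; exact/subsetPset/ndG/leq_maxr.
move=> k; have [mF Foo'] := Foo k; have [mG Goo'] := Goo k; split.
  by rewrite -[X in measurable X]setTI; apply: mg => //; exact: measurableX.
rewrite /cons_measure /pushforward -comp_preimage gK preimage_id.
by rewrite product_measure1E// lte_mul_pinfty// ge0_fin_numE.
Qed.

HB.instance Definition _ := Measure_isSigmaFinite.Build _ _ _ cons_measure
  cons_measure_sigma_finite.

End step.

(* The n-fold product measure. *)
Fixpoint product_power n : {sigma_finite_measure set (n.-tuple T) -> \bar R} :=
  if n is k.+1 then cons_measure (product_power k) else \d_[tuple].

End product_power.

Section complex_space.
Context (R : realType) (n : nat).
Implicit Types (D : set (Cn R n)) (z : Cn R n).

Local Notation space := ((n + n).-tuple (measurableTypeR R))%type.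

(* The identification of R^2n with C^n, (x, y) being sent to x + iy. *)
Definition vec_of_tuple (t : space) : Cn R n :=
  \row_(i < n) ((tnth t (lshift n i) +i* tnth t (rshift n i))%C : Cx R).

Definition lebesgue_Cn : {sigma_finite_measure set space -> \bar R} :=
  product_power lebesgue_measure (n + n).

Definition cintegral D (g : Cn R n -> Cx R) : Cx R :=
  ((\int[lebesgue_Cn]_(t in vec_of_tuple @^-1` D) complex.Re (g (vec_of_tuple t)))
   +i*
   (\int[lebesgue_Cn]_(t in vec_of_tuple @^-1` D) complex.Im (g (vec_of_tuple t))))%C.

Definition L2_inner D (h g : Cn R n -> Cx R) : Cx R :=
  cintegral D (fun z => h z * (g z)^*).

Definition L2 D : set (Cn R n -> Cx R) := [set h : Cn R n -> Cx R |
  [/\ measurable_fun (vec_of_tuple @^-1` D)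
        (fun t => complex.Re (h (vec_of_tuple t))),
      measurable_fun (vec_of_tuple @^-1` D)
        (fun t => complex.Im (h (vec_of_tuple t))) &
      (\int[lebesgue_Cn]_(t in vec_of_tuple @^-1` D)
         (complex.Re `|h (vec_of_tuple t)| ^+ 2)%:E < +oo)%E]].

Definition holomorphic (V : normedModType (Cx R)) D (h : Cn R n -> V) :=
  forall z, D z -> differentiable h z.

Definition H2 D : set (Cn R n -> Cx R) :=
  [set h : Cn R n -> Cx R | holomorphic D h /\ L2 D h].

Definition automorphism D (f : Cn R n -> Cn R n) :=
  [/\ holomorphic D f, f @` D `<=` D &
      exists g : Cn R n -> Cn R n,
        [/\ holomorphic D g, g @` D `<=` D,
            forall z, D z -> g (f z) = z & forall z, D z -> f (g z) = z]].

Definition weighted_rotation (m : 'I_n -> nat) (theta : R) z : Cn R n :=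
  \row_(i < n)
    (((cos ((m i)%:R * theta) +i* sin ((m i)%:R * theta))%C : Cx R) * z 0 i).

Definition domain D := open D /\ connected D.

Definition normalized_weight (m : 'I_n -> nat) :=
  [/\ forall i, (0 < m i)%N,
      forall i j : 'I_n, (i <= j)%N -> (m i <= m j)%N &
      (\big[gcdn/0]_(i < n) m i)%N = 1%N].

Definition quasi_circular (m : 'I_n -> nat) D :=
  forall theta z, D z -> D (weighted_rotation m theta z).

Definition partial (i : 'I_n) (h : Cn R n -> Cx R) : Cn R n -> Cx R :=
  fun z => 'D_(delta_mx 0 i) h z.

Definition multi_partial (alpha : multinom n) (h : Cn R n -> Cx R) :
    Cn R n -> Cx R :=
  foldr (fun i g => iter (alpha i) (partial i) g) h (enum 'I_n).

Definition peval (q : mpoly n (Cx R)) z : Cx R := meval (fun i => z 0 i) q.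

(* msize is one more than the total degree (and msize 0 = 0). *)
Definition pdegree (q : mpoly n (Cx R)) : nat := (msize q).-1.

End complex_space.

(* The default value 0 is used when A has no greatest, resp. least, element. *)
Definition set_max (A : set nat) : nat :=
  xget 0%N [set k | A k /\ forall j, A j -> (j <= k)%N].

Definition set_min (A : set nat) : nat :=
  xget 0%N [set k | A k /\ forall j, A j -> (k <= j)%N].

Section resonance.
Context (R : realType) (n : nat) (m : 'I_n -> nat).

Definition mdot (alpha : multinom n) : nat := (\sum_(i < n) m i * alpha i)%N.

Definition resonance_set (i : 'I_n) : set (multinom n) :=
  [set alpha | mdot alpha = m i].

Definition resonance_order (i : 'I_n) : nat :=
  set_max [set mdeg alpha | alpha in resonance_set i].

Variable D : set (Cn R n).

(* Elements of H^2(D) are represented by total functions, so uniqueness holds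
   up to values outside D. *)
Definition represents_derivative (alpha : multinom n) (p : Cn R n -> Cx R) :=
  H2 D p /\ forall h, H2 D h -> L2_inner D h p = multi_partial alpha h 0.

Definition kernel_fun (alpha : multinom n) : Cn R n -> Cx R :=
  xget (fun=> 0) [set p | represents_derivative alpha p].

Definition kernel_poly (alpha : multinom n) : mpoly n (Cx R) :=
  xget 0 [set q : mpoly n (Cx R) |
    (forall beta, mcoeff beta q != 0 -> mdot beta = mdot alpha) /\
    (forall z, D z -> kernel_fun alpha z = peval q z)].

Definition kernel_min_degree (alpha : multinom n) : nat :=
  set_min [set mdeg beta | beta in
             [set beta | mcoeff beta (kernel_poly alpha) != 0]].

Definition Pset (k : nat) : set (multinom n) :=
  [set alpha | (k < kernel_min_degree alpha)%N].

Definition Qset (k : nat) : set (multinom n) := ~` Pset k.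

Definition ith_quasi_resonance_order (i : 'I_n) : nat :=
  set_max [set mdeg alpha | alpha in Qset (resonance_order i)].

Definition quasi_resonance_order : nat :=
  (\max_(i < n) ith_quasi_resonance_order i)%N.

End resonance.

(* Main.v *)
(* Write H^2 for the square integrable holomorphic functions on D and M_k for
   those vanishing to order k at 0. Two facts drive the proof.
   (1) For an automorphism f fixing 0 with Jacobian determinant u, the map
   h |-> u (h o f) is unitary on H^2 and preserves M_k, hence also the
   orthogonal complement of M_k.
   (2) If q is m-homogeneous of weight K, then h is orthogonal to q as soon as
   all its Taylor coefficients of weight K vanish: averaging h against the
   N-th roots of unity in the circle action does not change <h, q>, and the
   averages are bounded in L^2 and tend to 0 pointwise (Vitali).
   By (2), 1 is orthogonal to M_1, so by (1) u - u(0) lies both in M_1 and in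
   its complement, and u is constant; likewise z_i is orthogonal to M_k for
   k = mu_i + 1, hence so is f_i. If d(alpha) > mu_i then p_alpha lies in M_k,
   so the alpha-th derivative of f_i at 0, which is <f_i, p_alpha>, vanishes.
   The identity theorem then makes f_i equal to a Taylor polynomial.

   Unitarity needs the change of variables formula, derived here from Haar
   uniqueness (linear maps scale Lebesgue measure by |det|^2, via LUP) and a
   partition of D into dyadic cubes on which f is almost affine; applying the
   resulting inequality to f and to its inverse gives equality. Cauchy's theory
   is reduced to Goursat's lemma on squares. *)
Require Import Defs.
From HB Require Import structures.
From mathcomp Require Import all_boot all_order all_algebra.
From mathcomp.multinomials Require Import -(notations) mpoly.
From mathcomp Require Import all_classical all_reals all_analysis.
From mathcomp Require Import perm measurable_realfun complex ring lra zify.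
Set Implicit Arguments.
Unset Strict Implicit.
Unset Printing Implicit Defensive.
Import Order.TTheory GRing.Theory Num.Theory numFieldNormedType.Exports.
Local Open Scope classical_set_scope.
Local Open Scope ring_scope.

(** * One complex variable *)

(** Roots of unity replace the integral over the circle so that an average is a finite sum, which
    kills a polynomial without terms of weight K exactly once N exceeds its weights plus K. An L^2
    bound and pointwise convergence give <h_N, q> -> 0 by truncation: min(|h_N|, A) is dominated by
    the constant A, integrable because D is bounded, and the excess over A costs at most |h_N|^2 /
    A. Fact (2) also produces p_alpha: <h, q> depends only on the Taylor coefficients of h of weight
    K, finitely many since the weights are positive, so the representing polynomial solves a linear
    system whose matrix is the Gram matrix of the monomials of that weight. That nu_i is a true
    maximum, not the default value of [set_max], also comes from positive weights: d(alpha) <= k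
    gives |alpha| <= m.alpha <= k max m_j. The estimates of measures are one-sided. A lower bound
    for the scaling factor of a matrix, and an inequality between integrals for a biholomorphic map,
    become equalities once applied to the inverse as well. *)

Section complex_modulus.
Context {R : realType}.
Implicit Types (z w : Cx R) (x y : R).

Definition cmod z : R := ComplexField.Normc.normc z.

Definition CC x y : Cx R := (x +i* y)%C.
Definition rC x : Cx R := (x%:C)%C.
Definition Ic : Cx R := ('i)%C.

Lemma cmodE z : `|z| = rC (cmod z). Proof. by []. Qed.

Lemma cmod0 : cmod 0 = 0. Proof. exact: ComplexField.Normc.normc0. Qed.

Lemma cmod1 : cmod 1 = 1. Proof. exact: ComplexField.Normc.normc1. Qed.

Lemma cmodM z w : cmod (z * w) = cmod z * cmod w.
Proof. exact: ComplexField.Normc.normcM. Qed.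

Lemma cmodV z : cmod z^-1 = (cmod z)^-1.
Proof. exact: ComplexField.Normc.normcV. Qed.

Lemma cmodX z k : cmod (z ^+ k) = cmod z ^+ k.
Proof. by elim: k => [|k IH]; rewrite ?cmod1// !exprS cmodM IH. Qed.

Lemma cmodD z w : cmod (z + w) <= cmod z + cmod w.
Proof.
have := ler_normD z w; rewrite !cmodE /rC -(rmorphD (real_complex R)).
by rewrite lecR.
Qed.

Lemma cmodN z : cmod (- z) = cmod z.
Proof. by apply: complexI; rewrite -[LHS]cmodE normrN. Qed.

Lemma cmodB z w : cmod (z - w) <= cmod z + cmod w.
Proof. by rewrite -(cmodN w); exact: cmodD. Qed.

Lemma cmod_sub z w : cmod z - cmod w <= cmod (z - w).
Proof. by rewrite lerBlDr -{1}(subrK w z); exact: cmodD. Qed.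

Lemma cmod_distC z w : cmod (z - w) = cmod (w - z).
Proof. by rewrite -cmodN opprB. Qed.

Lemma cmod_ge0 z : 0 <= cmod z.
Proof. by case: z => a b; exact: sqrtr_ge0. Qed.
Hint Resolve cmod_ge0 : core.

Lemma cmod_eq0 z : (cmod z == 0) = (z == 0).
Proof.
apply/eqP/eqP => [/ComplexField.Normc.eq0_normc//|->]; exact: cmod0.
Qed.

Lemma cmod_gt0 z : (0 < cmod z) = (z != 0).
Proof. by rewrite lt_neqAle cmod_ge0 andbT eq_sym cmod_eq0. Qed.

Lemma cmod_rC x : cmod (rC x) = `|x|.
Proof. by rewrite /cmod /rC /= expr0n addr0 sqrtr_sqr. Qed.

Lemma cmod_nat k : cmod k%:R = k%:R.
Proof. by apply: complexI; rewrite -[LHS]cmodE rmorph_nat normr_nat. Qed.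

Lemma cmod_Ic : cmod Ic = 1.
Proof. by rewrite /cmod /Ic /= expr0n add0r expr1n sqrtr1. Qed.

Lemma sqr_cmod z : cmod z ^+ 2 = complex.Re z ^+ 2 + complex.Im z ^+ 2.
Proof. by case: z => a b; rewrite /cmod sqr_sqrtr// addr_ge0 ?sqr_ge0. Qed.

Lemma ler_Re_cmod z : `|complex.Re z| <= cmod z.
Proof.
rewrite -(@ler_pXn2r _ 2) ?nnegrE// sqr_cmod real_normK ?num_real//.
by rewrite lerDl sqr_ge0.
Qed.

Lemma ler_Im_cmod z : `|complex.Im z| <= cmod z.
Proof.
rewrite -(@ler_pXn2r _ 2) ?nnegrE// sqr_cmod real_normK ?num_real//.
by rewrite lerDr sqr_ge0.
Qed.

Lemma cReD z w : complex.Re (z + w) = complex.Re z + complex.Re w.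
Proof. by case: z; case: w. Qed.

Lemma cImD z w : complex.Im (z + w) = complex.Im z + complex.Im w.
Proof. by case: z; case: w. Qed.

Lemma cReN z : complex.Re (- z) = - complex.Re z. Proof. by case: z. Qed.

Lemma cImN z : complex.Im (- z) = - complex.Im z. Proof. by case: z. Qed.

Lemma cReM z w : complex.Re (z * w) =
  complex.Re z * complex.Re w - complex.Im z * complex.Im w.
Proof. by case: z; case: w. Qed.

Lemma cImM z w : complex.Im (z * w) =
  complex.Re z * complex.Im w + complex.Im z * complex.Re w.
Proof. by case: z; case: w. Qed.

Lemma eqCx z w : complex.Re z = complex.Re w -> complex.Im z = complex.Im w ->
  z = w.
Proof. by case: z => a b; case: w => c d /= -> ->. Qed.

Lemma CxE z : z = rC (complex.Re z) + Ic * rC (complex.Im z).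
Proof. exact: complexE. Qed.

Lemma CCE x y : CC x y = rC x + Ic * rC y. Proof. exact: (CxE (CC x y)). Qed.

Lemma cmod_le_ReIm z : cmod z <= `|complex.Re z| + `|complex.Im z|.
Proof.
rewrite [in leLHS](CxE z); apply: le_trans (cmodD _ _) _.
by rewrite cmodM cmod_Ic mul1r !cmod_rC.
Qed.

Lemma rCD x y : rC (x + y) = rC x + rC y.
Proof. exact: (rmorphD (real_complex R)). Qed.
Lemma rCB x y : rC (x - y) = rC x - rC y.
Proof. exact: (rmorphB (real_complex R)). Qed.
Lemma rCM x y : rC (x * y) = rC x * rC y.
Proof. exact: (rmorphM (real_complex R)). Qed.
Lemma rC0 : rC 0 = 0. Proof. by []. Qed.
Lemma rCX x k : rC (x ^+ k) = rC x ^+ k.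
Proof. exact: (rmorphXn (real_complex R)). Qed.
Lemma rCV x : rC x^-1 = (rC x)^-1.
Proof. exact: (fmorphV (real_complex R)). Qed.
Lemma Ic2 : Ic * Ic = -1. Proof. by rewrite -expr2; exact: sqr_i. Qed.

Lemma cmod_sum (I : Type) (r : seq I) (P : pred I) (F : I -> Cx R) :
  cmod (\sum_(i <- r | P i) F i) <= \sum_(i <- r | P i) cmod (F i).
Proof.
elim/big_ind2 : _ => //; first by rewrite cmod0.
by move=> z x w y zx wy; apply: le_trans (cmodD _ _) _; exact: lerD.
Qed.

End complex_modulus.
#[global] Hint Extern 0 (is_true (_ <= cmod _)) => solve [apply: cmod_ge0] : core.

Lemma ler_succ_div (R : realFieldType) (c e : R) : 0 <= c -> 0 <= e ->
  c * (e / (c + 1)) <= e.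
Proof.
move=> c0 e0; rewrite mulrA ler_pdivrMr ?ltr_wpDl// mulrC.
by rewrite ler_wpM2l// lerDl.
Qed.

(** * Derivatives and integrals of complex-valued functions of a real variable *)

Section real_variable.
Context {R : realType}.
Implicit Types (g G : R -> Cx R).

(** The derivative of a path in the complex plane, written without a quotient: [s = 0] needs no
    exception, and sums, products and compositions reduce to estimates. *)
Definition cder G t (d : Cx R) := forall e : R, 0 < e -> exists2 r : R, 0 < r &
  forall s : R, `|s| < r -> cmod (G (t + s) - G t - d * rC s) <= e * `|s|.

Definition ccts g := forall t, forall e : R, 0 < e -> exists2 r : R, 0 < r &
  forall s : R, `|s| < r -> cmod (g (t + s) - g t) <= e.

Lemma is_derive_epsP (f : R -> R) t d :
  (forall e : R, 0 < e -> exists2 r : R, 0 < r &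
    forall s : R, `|s| < r -> `|f (t + s) - f t - d * s| <= e * `|s|) <->
  is_derive t (1 : R) f d.
Proof.
split=> [fd|fd].
  have fq : h^-1 *: (f (h *: (1:R) + t) - f t) @[h --> 0^'] --> d.
    apply/cvgrPdist_le => e e0; have [r r0 fr] := fd e e0.
    apply/nbhs_ballP; exists r => //= s; rewrite /ball/= ?sub0r ?normrN => sr s0.
    rewrite distrC -(@ler_pM2r _ `|s|) ?normr_gt0//.
    have -> : s *: (1 : R) + t = t + s by rewrite addrC /GRing.scale/= mulr1.
    rewrite -normrM mulrBl /GRing.scale/= mulrAC mulVf// mul1r.
    exact: fr.
  by apply: DeriveDef; [exact: cvgP fq|exact: cvg_lim fq].
move=> e e0; have /derivableP := @ex_derive _ _ _ _ _ _ _ fd.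
rewrite (@derive_val _ _ _ _ _ _ _ fd) => _.
have := @ex_derive _ _ _ _ _ _ _ fd; rewrite /derivable => /cvg_ex[/= l fl].
have dl : d = l by rewrite -(@derive_val _ _ _ _ _ _ _ fd); exact: cvg_lim fl.
move: fl; rewrite -dl => /cvgrPdist_le/(_ e e0)/nbhs_ballP[r/= r0 fr].
exists r => // s sr; have [->|s0] := eqVneq s 0.
  by rewrite addr0 subrr mulr0 subr0 normr0 mulr0.
have := fr s; rewrite /ball/= ?sub0r ?normrN => /(_ sr s0).
rewrite distrC -(@ler_pM2r _ `|s|) ?normr_gt0//.
have -> : s *: (1 : R) + t = t + s by rewrite addrC /GRing.scale/= mulr1.
by rewrite -normrM mulrBl /GRing.scale/= mulrAC mulVf// mul1r.
Qed.

Lemma cder_Re G t d : cder G t d ->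
  is_derive t (1 : R) (fun s => complex.Re (G s)) (complex.Re d).
Proof.
move=> Gd; apply/is_derive_epsP => e e0; have [r r0 Gr] := Gd e e0.
exists r => // s sr; apply: le_trans (Gr s sr); apply: le_trans (ler_Re_cmod _).
by rewrite !(cReD, cReN, cReM)/= mulr0 subr0.
Qed.

Lemma cder_Im G t d : cder G t d ->
  is_derive t (1 : R) (fun s => complex.Im (G s)) (complex.Im d).
Proof.
move=> Gd; apply/is_derive_epsP => e e0; have [r r0 Gr] := Gd e e0.
exists r => // s sr; apply: le_trans (Gr s sr); apply: le_trans (ler_Im_cmod _).
by rewrite !(cImD, cImN, cImM)/= mulr0 add0r.
Qed.

Lemma MVT_bound (f df : R -> R) (a b M : R) : a <= b ->
  (forall t, a <= t <= b -> is_derive t (1 : R) f (df t)) ->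
  (forall t, a <= t <= b -> `|df t| <= M) -> `|f b - f a| <= M * (b - a).
Proof.
move=> ab fd dM; have [|| c cab ->] := @MVT_segment _ f df a b ab.
- by move=> x; rewrite in_itv/= => /andP[ax xb]; apply: fd; rewrite !ltW.
- apply: derivable_within_continuous => x; rewrite in_itv/= => xab.
  by have := fd x xab => -[].
- rewrite normrM (ger0_norm (_ : 0 <= b - a)) ?subr_ge0//.
  by rewrite ler_wpM2r ?subr_ge0// dM//; rewrite in_itv/= in cab.
Qed.

(** The mean value theorem is available for real functions only; applying it to the real and the
    imaginary part costs the factor 2, which reappears in every Cauchy estimate below. *)
Lemma cder_bound G (g : R -> Cx R) (a b M : R) : a <= b ->
  (forall t, a <= t <= b -> cder G t (g t)) ->
  (forall t, a <= t <= b -> cmod (g t) <= M) ->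
  cmod (G b - G a) <= 2 * M * (b - a).
Proof.
move=> ab Gd gM; apply: le_trans (cmod_le_ReIm _) _.
rewrite !(cReD, cReN, cImD, cImN) -mulrA [leRHS]mulrDl mul1r.
apply: lerD.
  apply: (MVT_bound ab (fun t h => cder_Re (Gd t h))) => t h.
  by apply: le_trans (gM t h); exact: ler_Re_cmod.
apply: (MVT_bound ab (fun t h => cder_Im (Gd t h))) => t h.
by apply: le_trans (gM t h); exact: ler_Im_cmod.
Qed.

Lemma cderD G H t c d : cder G t c -> cder H t d ->
  cder (fun s => G s + H s) t (c + d).
Proof.
move=> Gc Hd e e0; have e20 : 0 < e / 2 by rewrite divr_gt0.
have [r r0 Gr] := Gc _ e20; have [q q0 Hq] := Hd _ e20.
exists (Num.min r q); first by rewrite lt_min r0.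
move=> s; rewrite lt_min => /andP[/Gr Gs /Hq Hs].
have -> : G (t + s) + H (t + s) - (G t + H t) - (c + d) * rC s =
  (G (t + s) - G t - c * rC s) + (H (t + s) - H t - d * rC s) by ring.
by apply: le_trans (cmodD _ _) _; apply: le_trans (lerD Gs Hs) _; rewrite -1?mulrDl -splitr.
Qed.

Lemma cderZ G t c k : cder G t c -> cder (fun s => k * G s) t (k * c).
Proof.
move=> Gc e e0; have K0 : 0 < cmod k + 1 by rewrite ltr_wpDl// ?cmod_ge0.
have [r r0 Gr] := Gc _ (divr_gt0 e0 K0); exists r => // s /Gr Gs.
have -> : k * G (t + s) - k * G t - k * c * rC s =
  k * (G (t + s) - G t - c * rC s) by ring.
rewrite cmodM; apply: le_trans (ler_wpM2l (cmod_ge0 _) Gs) _.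
by rewrite mulrA ler_wpM2r// ler_succ_div// ltW.
Qed.

Lemma cder_cst k t : cder (fun _ => k) t 0.
Proof.
move=> e e0; exists 1 => // s _.
by rewrite subrr mul0r subr0 cmod0 mulr_ge0// ltW.
Qed.

Lemma cder_ext G H t d : (forall s, G s = H s) -> cder G t d -> cder H t d.
Proof. by move=> /funext ->. Qed.

Lemma cder_rC t : cder rC t 1.
Proof.
move=> e e0; exists 1 => // s _.
have -> : rC (t + s) - rC t - 1 * rC s = 0 by rewrite rCD; ring.
by rewrite cmod0 mulr_ge0// ltW.
Qed.

Lemma continuous_eps (f : R -> R) : (forall t, forall e : R, 0 < e ->
    exists2 r : R, 0 < r & forall s : R, `|s| < r -> `|f (t + s) - f t| <= e) ->
  continuous f.
Proof.
move=> fc t; apply/cvgrPdist_le => e e0; have [r r0 fr] := fc t e e0.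
apply/nbhs_ballP; exists r => //= s; rewrite /ball_/= => ts.
by rewrite distrC -{1}(subrKC t s) fr// distrC.
Qed.

(** The antiderivative is the integral from [- K], which explains the bounded interval; [K] is later
    taken larger than the bounds at hand. *)
Lemma antiderivative_exists (f : R -> R) (K : R) : continuous f ->
  exists F : R -> R, forall t, - K < t < K -> is_derive t (1 : R) F (f t).
Proof.
move=> fc.
exists (fun x => \int[lebesgue_measure]_(t in `[- K, x]) (f t))%R.
move=> t /andP[Kt tK].
have [|||d1 d2] := @continuous_FTC1_closed _ f (- K) t K tK.
- apply: continuous_compact_integrable; first exact: segment_compact.
  exact: continuous_subspaceT.
- exact: Kt.
- exact: fc.
- by apply: DeriveDef; [exact: d1|rewrite -d2 derive1E].
Qed.

Lemma cder_ReIm (F H : R -> R) t (c d : R) :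
  is_derive t (1 : R) F c -> is_derive t (1 : R) H d ->
  cder (fun s => CC (F s) (H s)) t (CC c d).
Proof.
move=> /is_derive_epsP Fc /is_derive_epsP Hd e e0.
have e20 : 0 < e / 2 by rewrite divr_gt0.
have [r r0 Fr] := Fc _ e20; have [q q0 Hq] := Hd _ e20.
exists (Num.min r q); first by rewrite lt_min r0.
move=> s; rewrite lt_min => /andP[/Fr Fs /Hq Hs].
apply: le_trans (cmod_le_ReIm _) _.
rewrite !(cReD, cReN, cReM, cImD, cImN, cImM)/= !mulr0 subr0 add0r.
by apply: le_trans (lerD Fs Hs) _; rewrite -mulrDl -splitr.
Qed.

Lemma primitive_exists g (K : R) : ccts g ->
  exists G, forall t, - K < t < K -> cder G t (g t).
Proof.
move=> gc.
have [|F Fd] := @antiderivative_exists (fun t => complex.Re (g t)) K.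
  apply: continuous_eps => t e e0; have [r r0 gr] := gc t e e0.
  exists r => // s /gr; apply: le_trans; apply: le_trans (ler_Re_cmod _).
  by rewrite cReD cReN.
have [|H Hd] := @antiderivative_exists (fun t => complex.Im (g t)) K.
  apply: continuous_eps => t e e0; have [r r0 gr] := gc t e e0.
  exists r => // s /gr; apply: le_trans; apply: le_trans (ler_Im_cmod _).
  by rewrite cImD cImN.
exists (fun t => CC (F t) (H t)) => t tK.
have -> : g t = CC (complex.Re (g t)) (complex.Im (g t)) by apply: eqCx.
exact: cder_ReIm (Fd t tK) (Hd t tK).
Qed.

(* The integral of a continuous function, as the increment of a primitive
   defined around both bounds: the bounds may come in any order. *)
Definition cint g (a b : R) : Cx R := xget 0
  [set v | exists K G, [/\ `|a| < K, `|b| < K,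
    forall t, - K < t < K -> cder G t (g t) & v = G b - G a]].

(** The difference of the two primitives has derivative 0, so [cder_bound] applies with bound 0.
    This makes [cint] independent of the primitive. *)
Lemma cder_incr_uniq G H g (a b : R) : a <= b ->
  (forall t, a <= t <= b -> cder G t (g t)) ->
  (forall t, a <= t <= b -> cder H t (g t)) -> G b - G a = H b - H a.
Proof.
move=> ab Gg Hg.
pose H' s := G s + (-1) * H s.
have : cmod (H' b - H' a) <= 2 * 0 * (b - a).
  apply: (@cder_bound H' (fun s => g s + (-1) * g s)) => // t h.
    by apply: cderD (Gg t h) _; apply: cderZ (Hg t h).
  by rewrite mulN1r subrr cmod0.
rewrite mulr0 mul0r => h.
have : cmod (H' b - H' a) == 0 by rewrite eq_le cmod_ge0 andbT.
rewrite cmod_eq0 => /eqP; rewrite /H' => E.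
by apply/eqP; rewrite -subr_eq0 -E; apply/eqP; ring.
Qed.

Lemma cintE g (a b : R) : ccts g -> forall K G, `|a| < K -> `|b| < K ->
  (forall t, - K < t < K -> cder G t (g t)) -> cint g a b = G b - G a.
Proof.
move=> gc K G aK bK Gg; rewrite /cint; case: xgetP => [_ -> [L [H [aL bL Hg ->]]]|].
  wlog ab : a b aK bK aL bL / a <= b.
    move=> W; have [ab|/ltW ba] := leP a b; first exact: W.
    by apply: oppr_inj; rewrite !opprB; exact: W.
  apply: (@cder_incr_uniq _ _ g) => // t /andP[at_ tb].
    by apply: Hg; move: aL bL; rewrite !ltr_norml => /andP[? ?] /andP[? ?]; lra.
  by apply: Gg; move: aK bK; rewrite !ltr_norml => /andP[? ?] /andP[? ?]; lra.
by move=> /(_ (G b - G a)) []; exists K, G; split.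
Qed.

Lemma cint_primitive g (K : R) : ccts g -> exists G,
  (forall t, - K < t < K -> cder G t (g t)) /\
  (forall a b, `|a| < K -> `|b| < K -> cint g a b = G b - G a).
Proof.
move=> gc; have [G Gg] := primitive_exists K gc; exists G; split=> // a b aK bK.
exact: cintE Gg.
Qed.

Let bound (a b : R) : exists2 K : R, `|a| < K & `|b| < K.
Proof.
exists (`|a| + `|b| + 1).
  by have := normr_ge0 b; lra.
by have := normr_ge0 a; lra.
Qed.

Lemma cint_FTC g G (a b : R) : ccts g -> a <= b ->
  (forall t, a <= t <= b -> cder G t (g t)) -> cint g a b = G b - G a.
Proof.
move=> gc ab Gg; have [K aK bK] := bound a b.
have [H [Hg ->//]] := cint_primitive K gc.
apply: (@cder_incr_uniq _ _ g) => // t /andP[at_ tb].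
by apply: Hg; move: aK bK; rewrite !ltr_norml => /andP[? ?] /andP[? ?]; lra.
Qed.

Lemma cint_add g a b c : ccts g -> cint g a b + cint g b c = cint g a c.
Proof.
move=> gc; pose K := `|a| + `|b| + `|c| + 1.
have [H [Hg HE]] := cint_primitive K gc.
have [aK bK cK] : [/\ `|a| < K, `|b| < K & `|c| < K].
  by have := normr_ge0 a; have := normr_ge0 b; have := normr_ge0 c;
     rewrite /K; split; lra.
by rewrite !HE//; ring.
Qed.

Lemma cint_xx g a : ccts g -> cint g a a = 0.
Proof.
by move=> gc; apply: (addrI (cint g a a)); rewrite cint_add// addr0.
Qed.

Lemma cint_sym g a b : ccts g -> cint g b a = - cint g a b.
Proof.
by move=> gc; apply/eqP; rewrite -addr_eq0 cint_add// cint_xx.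
Qed.

Lemma cctsD g h : ccts g -> ccts h -> ccts (fun t => g t + h t).
Proof.
move=> gc hc t e e0; have e20 : 0 < e / 2 by rewrite divr_gt0.
have [r r0 Gr] := gc t _ e20; have [q q0 Hq] := hc t _ e20.
exists (Num.min r q); first by rewrite lt_min r0.
move=> s; rewrite lt_min => /andP[/Gr Gs /Hq Hs].
have -> : g (t + s) + h (t + s) - (g t + h t) =
  (g (t + s) - g t) + (h (t + s) - h t) by ring.
by apply: le_trans (cmodD _ _) _; apply: le_trans (lerD Gs Hs) _; rewrite -splitr.
Qed.

Lemma cctsZ g k : ccts g -> ccts (fun t => k * g t).
Proof.
move=> gc t e e0; have K0 : 0 < cmod k + 1 by rewrite ltr_wpDl// ?cmod_ge0.
have [r r0 Gr] := gc t _ (divr_gt0 e0 K0); exists r => // s /Gr Gs.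
rewrite -mulrBr cmodM; apply: le_trans (ler_wpM2l (cmod_ge0 _) Gs) _.
by rewrite ler_succ_div// ltW.
Qed.

Lemma ccts_cst k : ccts (fun _ => k).
Proof. by move=> t e e0; exists 1 => // s _; rewrite subrr cmod0 ltW. Qed.

Lemma cintD g h a b : ccts g -> ccts h ->
  cint (fun t => g t + h t) a b = cint g a b + cint h a b.
Proof.
move=> gc hc; have [K aK bK] := bound a b.
have [G [Gg ->//]] := cint_primitive K gc.
have [H [Hh ->//]] := cint_primitive K hc.
rewrite (cintE (cctsD gc hc) aK bK (fun t h => cderD (Gg t h) (Hh t h))); ring.
Qed.

Lemma cintZ g k a b : ccts g -> cint (fun t => k * g t) a b = k * cint g a b.
Proof.
move=> gc; have [K aK bK] := bound a b.
have [G [Gg ->//]] := cint_primitive K gc.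
rewrite (cintE (cctsZ k gc) aK bK (fun t h => cderZ k (Gg t h))); ring.
Qed.

Lemma cint_bound g (a b M : R) : ccts g -> a <= b ->
  (forall t, a <= t <= b -> cmod (g t) <= M) ->
  cmod (cint g a b) <= 2 * M * (b - a).
Proof.
move=> gc ab gM; have [K aK bK] := bound a b.
have [G [Gg ->//]] := cint_primitive K gc.
apply: (@cder_bound _ g) => // t /andP[at_ tb].
by apply: Gg; move: aK bK; rewrite !ltr_norml => /andP[? ?] /andP[? ?]; lra.
Qed.

End real_variable.

Section complex_variable.
Context {R : realType}.
Implicit Types (phi psi P : Cx R -> Cx R) (z w : Cx R) (x y t : R).

Lemma nbhs_CxP z (A : set (Cx R)) : nbhs z A <->
  exists2 r : R, 0 < r & forall w, cmod w < r -> A (z + w).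
Proof.
split.
  move=> /nbhs_ballP[e /= e0 eA]; exists (complex.Re e).
    by move: e0; rewrite ltcE => /andP[].
  move=> w we; apply: eA; rewrite /ball/= opprD addNKr normrN cmodE.
  move: e0; rewrite !ltcE => /andP[/eqP <- _] /=.
  by rewrite eqxx.
move=> [r r0 rA]; apply/nbhs_ballP; exists (rC r); first by rewrite /= ltcR.
move=> w; rewrite /ball/= cmodE ltcR => wr.
by rewrite -(subrKC z w); apply: rA; rewrite cmod_distC.
Qed.

Definition cdiff phi z (d : Cx R) := forall e : R, 0 < e ->
  exists2 r : R, 0 < r &
  forall w, cmod w < r -> cmod (phi (z + w) - phi z - d * w) <= e * cmod w.

Definition ccont_at phi z := forall e : R, 0 < e -> exists2 r : R, 0 < r &
  forall w, cmod w < r -> cmod (phi (z + w) - phi z) <= e.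

Lemma ccont_atP phi z : ccont_at phi z <-> {for z, continuous phi}.
Proof.
split.
  move=> h A /nbhs_CxP[r r0 rA]; apply/nbhs_CxP.
  have [q q0 hq] := h (r / 2) (divr_gt0 r0 (ltr0Sn _ _)); exists q => // w /hq hw.
  by rewrite /= -(subrKC (phi z) (phi _)); apply: rA; lra.
move=> h e e0; have /h/nbhs_CxP[r r0 rh] :
    nbhs (phi z) [set w | cmod (w - phi z) <= e].
  by apply/nbhs_CxP; exists e => // w /ltW; rewrite /= addrC addKr.
by exists r => // w /rh.
Qed.

Lemma cctsP (g : R -> Cx R) : ccts g <-> continuous g.
Proof.
split.
  move=> h t A /nbhs_CxP[r r0 rA]; apply/nbhs_ballP.
  have [q q0 hq] := h t (r / 2) (divr_gt0 r0 (ltr0Sn _ _)); exists q => //= s.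
  rewrite /ball/= => ts; rewrite -(subrKC (g t) (g s)); apply: rA.
  by have := hq (s - t); rewrite distrC subrKC => /(_ ts); lra.
move=> h t e e0; have /(h t)/nbhs_ballP[r r0 rh] :
    nbhs (g t) [set w | cmod (w - g t) <= e].
  by apply/nbhs_CxP; exists e => // w /ltW; rewrite /= addrC addKr.
exists r => // s sr; apply: (rh (t + s)).
by rewrite /ball/= opprD addNKr normrN.
Qed.

Lemma cdiff_cont phi z d : cdiff phi z d -> ccont_at phi z.
Proof.
move=> h e e0; have [r r0 hr] := h 1 ltr01.
have K0 : 0 < cmod d + 1 by rewrite ltr_wpDl.
exists (Num.min r (e / (cmod d + 1))); first by rewrite lt_min r0 divr_gt0.
move=> w; rewrite lt_min ltr_pdivlMr// => /andP[/hr hw we].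
rewrite -(subrK (d * w) (_ - phi z)); apply: le_trans (cmodD _ _) _.
by rewrite cmodM; nra.
Qed.

Lemma cder_comp P (G : R -> Cx R) t p d :
  cdiff P (G t) p -> cder G t d -> cder (fun s => P (G s)) t (p * d).
Proof.
move=> Pp Gd e e0.
pose D := cmod d + 1; have D0 : 0 < D by rewrite ltr_wpDl.
pose C := cmod p + 1; have C0 : 0 < C by rewrite ltr_wpDl.
have [r r0 Pr] := Pp (e / 2 / D) (divr_gt0 (divr_gt0 e0 (ltr0Sn _ _)) D0).
have [q1 q10 G1] := Gd 1 ltr01.
have [q2 q20 G2] := Gd (e / 2 / C) (divr_gt0 (divr_gt0 e0 (ltr0Sn _ _)) C0).
exists (Num.min (Num.min q1 q2) (r / D)); first by rewrite !lt_min q10 q20 divr_gt0.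
move=> s; rewrite !lt_min ltr_pdivlMr// => /andP[/andP[/G1 h1 /G2 h2] sr].
have L : cmod (G (t + s) - G t) <= D * `|s|.
  rewrite -(subrK (d * rC s) (_ - G t)); apply: le_trans (cmodD _ _) _.
  by rewrite cmodM cmod_rC /D mulrDl addrC lerD2l.
have := Pr (G (t + s) - G t); rewrite subrKC.
have Lr : D * `|s| < r by rewrite mulrC.
rewrite (le_lt_trans L Lr) => /(_ isT) h3.
have -> : P (G (t + s)) - P (G t) - p * d * rC s =
  (P (G (t + s)) - P (G t) - p * (G (t + s) - G t)) +
   p * (G (t + s) - G t - d * rC s) by ring.
apply: le_trans (cmodD _ _) _; rewrite (splitr e) mulrDl; apply: lerD.
  apply: le_trans h3 _; apply: le_trans (ler_wpM2l _ L) _.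
    by rewrite !divr_ge0// ltW.
  by rewrite mulrA divfK ?lt0r_neq0.
rewrite cmodM; apply: le_trans (ler_wpM2l (cmod_ge0 _) h2) _.
by rewrite mulrA ler_wpM2r// ler_succ_div// divr_ge0// ltW.
Qed.

Lemma cder_horizontal t y : cder (fun x => CC x y) t 1.
Proof.
apply: (@cder_ext _ (fun x => rC x + Ic * rC y)) => [s|]; first by rewrite -CCE.
by rewrite -[X in cder _ _ X]addr0; apply: cderD (cder_cst _ _); exact: cder_rC.
Qed.

Lemma cder_vertical t x : cder (fun y => CC x y) t Ic.
Proof.
apply: (@cder_ext _ (fun y => rC x + Ic * rC y)) => [s|]; first by rewrite -CCE.
rewrite -[X in cder _ _ X]add0r; apply: cderD (cder_cst _ _) _.
by rewrite -[X in cder _ _ X]mulr1; apply: cderZ; exact: cder_rC.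
Qed.

Definition ccont phi := forall z, ccont_at phi z.

Lemma ccont_comp phi (g : R -> Cx R) : ccont phi -> ccts g ->
  ccts (fun t => phi (g t)).
Proof.
move=> h /cctsP k; apply/cctsP => t; apply: continuous_comp; first exact: k.
exact/ccont_atP.
Qed.

Lemma cder_ccts (g dg : R -> Cx R) : (forall t, cder g t (dg t)) -> ccts g.
Proof.
move=> h t e e0; have [r r0 hr] := h t 1 ltr01.
have K0 : 0 < cmod (dg t) + 1 by rewrite ltr_wpDl.
exists (Num.min r (e / (cmod (dg t) + 1))); first by rewrite lt_min r0 divr_gt0.
move=> w; rewrite lt_min ltr_pdivlMr// => /andP[/hr hw we].
rewrite -(subrK (dg t * rC w) (_ - g t)); apply: le_trans (cmodD _ _) _.
by rewrite cmodM cmod_rC; nra.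
Qed.

Lemma ccts_horizontal phi y : ccont phi -> ccts (fun x => phi (CC x y)).
Proof. by move=> h; apply: ccont_comp h (cder_ccts (cder_horizontal^~ y)). Qed.

Lemma ccts_vertical phi x : ccont phi -> ccts (fun y => phi (CC x y)).
Proof. by move=> h; apply: ccont_comp h (cder_ccts (cder_vertical^~ x)). Qed.

Lemma ccontD phi psi : ccont phi -> ccont psi -> ccont (fun z => phi z + psi z).
Proof.
move=> h k z; apply/ccont_atP; apply: continuousD; exact/ccont_atP.
Qed.

Lemma cctsM (g h : R -> Cx R) : ccts g -> ccts h -> ccts (fun t => g t * h t).
Proof.
move=> /cctsP gc /cctsP hc; apply/cctsP => t.
by apply: continuousM; [exact: gc|exact: hc].
Qed.

Lemma cint_bound_sym (g : R -> Cx R) (a b M : R) : ccts g ->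
  (forall t, Num.min a b <= t <= Num.max a b -> cmod (g t) <= M) ->
  cmod (cint g a b) <= 2 * M * `|b - a|.
Proof.
move=> gc gM; have [ab|/ltW ba] := leP a b.
  rewrite ger0_norm ?subr_ge0//; apply: cint_bound => // t h.
  by apply: gM; rewrite min_l// max_r.
rewrite (cint_sym _ _ gc) cmodN distrC ger0_norm ?subr_ge0//.
apply: cint_bound => // t h; apply: gM; rewrite min_r// max_l//.
Qed.

Lemma cint_cst (k : Cx R) (a b : R) : cint (fun _ => k) a b = k * rC (b - a).
Proof.
have := @cintZ _ (fun _ => 1) k a b (ccts_cst 1).
under [X in cint X]eq_fun do rewrite mulr1.
move=> ->; congr (_ * _); rewrite rCB.
apply: (@cintE _ _ _ _ (ccts_cst 1) (`|a| + `|b| + 1)).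
- by have := normr_ge0 b; lra.
- by have := normr_ge0 a; lra.
- by move=> t _; exact: cder_rC.
Qed.

(** The contour integral along the boundary, counterclockwise from the lower left corner. Since
    [cint] is oriented, the bounds may come in any order, up to sign. *)
Definition rect phi (x0 x1 y0 y1 : R) : Cx R :=
  cint (fun x => phi (CC x y0)) x0 x1 + Ic * cint (fun y => phi (CC x1 y)) y0 y1
  - cint (fun x => phi (CC x y1)) x0 x1
  - Ic * cint (fun y => phi (CC x0 y)) y0 y1.

Lemma rect_addx phi x0 x1 x2 y0 y1 : ccont phi ->
  rect phi x0 x1 y0 y1 + rect phi x1 x2 y0 y1 = rect phi x0 x2 y0 y1.
Proof.
move=> h; rewrite /rect -(cint_add x0 x1 x2 (ccts_horizontal y0 h)).
by rewrite -(cint_add x0 x1 x2 (ccts_horizontal y1 h)); ring.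
Qed.

Lemma rect_addy phi x0 x1 y0 y1 y2 : ccont phi ->
  rect phi x0 x1 y0 y1 + rect phi x0 x1 y1 y2 = rect phi x0 x1 y0 y2.
Proof.
move=> h; rewrite /rect -(cint_add y0 y1 y2 (ccts_vertical x0 h)).
by rewrite -(cint_add y0 y1 y2 (ccts_vertical x1 h)); ring.
Qed.

Lemma rect_xx phi x y0 y1 : ccont phi -> rect phi x x y0 y1 = 0.
Proof.
by move=> h; rewrite /rect !cint_xx; [ring|exact: ccts_horizontal..].
Qed.

Lemma rect_yy phi x0 x1 y : ccont phi -> rect phi x0 x1 y y = 0.
Proof.
by move=> h; rewrite /rect !(@cint_xx _ _ y); [ring|exact: ccts_vertical..].
Qed.

Lemma rect_symx phi x0 x1 y0 y1 : ccont phi ->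
  rect phi x1 x0 y0 y1 = - rect phi x0 x1 y0 y1.
Proof.
by move=> h; apply/eqP; rewrite -addr_eq0 rect_addx// rect_xx.
Qed.

Lemma rect_symy phi x0 x1 y0 y1 : ccont phi ->
  rect phi x0 x1 y1 y0 = - rect phi x0 x1 y0 y1.
Proof.
by move=> h; apply/eqP; rewrite -addr_eq0 rect_addy// rect_yy.
Qed.

Lemma rectD phi psi x0 x1 y0 y1 : ccont phi -> ccont psi ->
  rect (fun z => phi z + psi z) x0 x1 y0 y1 =
  rect phi x0 x1 y0 y1 + rect psi x0 x1 y0 y1.
Proof.
move=> h k; rewrite /rect.
rewrite (cintD _ _ (ccts_horizontal y0 h) (ccts_horizontal y0 k)).
rewrite (cintD _ _ (ccts_horizontal y1 h) (ccts_horizontal y1 k)).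
rewrite (cintD _ _ (ccts_vertical x0 h) (ccts_vertical x0 k)).
rewrite (cintD _ _ (ccts_vertical x1 h) (ccts_vertical x1 k)); ring.
Qed.

Lemma rect_primitive phi P x0 x1 y0 y1 : ccont phi -> x0 <= x1 -> y0 <= y1 ->
  (forall z, cdiff P z (phi z)) -> rect phi x0 x1 y0 y1 = 0.
Proof.
move=> h x01 y01 Pd; rewrite /rect.
have H y : cint (fun x => phi (CC x y)) x0 x1 = P (CC x1 y) - P (CC x0 y).
  apply: (@cint_FTC _ _ (fun x => P (CC x y))) => //; first exact: ccts_horizontal.
  by move=> t _; rewrite -[X in cder _ _ X]mulr1;
     apply: cder_comp (Pd _) (cder_horizontal _ _).
have V x : Ic * cint (fun y => phi (CC x y)) y0 y1 = P (CC x y1) - P (CC x y0).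
  rewrite -(cintZ Ic _ _ (ccts_vertical x h)).
  apply: (@cint_FTC _ _ (fun y => P (CC x y))) => //.
    by apply: cctsZ; exact: ccts_vertical.
  by move=> t _; rewrite mulrC; apply: cder_comp (Pd _) (cder_vertical _ _).
by rewrite !H !V; ring.
Qed.

Lemma rect_bound phi x0 x1 y0 y1 (M : R) : ccont phi -> x0 <= x1 -> y0 <= y1 ->
  (forall x y, x0 <= x <= x1 -> y0 <= y <= y1 -> cmod (phi (CC x y)) <= M) ->
  cmod (rect phi x0 x1 y0 y1) <= 4 * M * ((x1 - x0) + (y1 - y0)).
Proof.
move=> h x01 y01 hM; rewrite /rect.
have H y : y0 <= y <= y1 ->
    cmod (cint (fun x => phi (CC x y)) x0 x1) <= 2 * M * (x1 - x0).
  by move=> yy; apply: cint_bound => // [|t tt]; [exact: ccts_horizontal|exact: hM].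
have V x : x0 <= x <= x1 ->
    cmod (Ic * cint (fun y => phi (CC x y)) y0 y1) <= 2 * M * (y1 - y0).
  move=> xx; rewrite cmodM cmod_Ic mul1r.
  by apply: cint_bound => // [|t tt]; [exact: ccts_vertical|exact: hM].
have := H y0; have := H y1; have := V x0; have := V x1.
rewrite !lexx x01 y01 => /(_ isT) h1 /(_ isT) h2 /(_ isT) h3 /(_ isT) h4.
do ![apply: le_trans (cmodB _ _) _|apply: le_trans (lerD (cmodB _ _) (lexx _)) _].
apply: le_trans (lerD (lerD (cmodD _ _) (lexx _)) (lexx _)) _.
lra.
Qed.

Lemma cdiff_affine (a b : Cx R) z :
  cdiff (fun w => a * w + b / 2 * w ^+ 2) z (a + b * z).
Proof.
move=> e e0; have K0 : 0 < cmod (b / 2) + 1 by rewrite ltr_wpDl.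
exists (e / (cmod (b / 2) + 1)); first by rewrite divr_gt0.
move=> w we; have -> : a * (z + w) + b / 2 * (z + w) ^+ 2 -
  (a * z + b / 2 * z ^+ 2) - (a + b * z) * w = b / 2 * w * w by field.
rewrite cmodM ler_wpM2r// cmodM.
apply: le_trans (ler_succ_div (cmod_ge0 (b / 2)) (ltW e0)).
by rewrite ler_wpM2l// ltW.
Qed.

Lemma ccont_affine (a b : Cx R) : ccont (fun z => a + b * z).
Proof.
move=> z; apply/ccont_atP; apply: continuousD; first exact: cst_continuous.
by apply: continuousM; [exact: cst_continuous|exact: cvg_id].
Qed.

(** An affine function has a quadratic primitive. In Goursat's lemma this allows the tangent at the
    limit point to be subtracted at no cost. *)
Lemma rect_affine (a b : Cx R) x0 x1 y0 y1 : x0 <= x1 -> y0 <= y1 ->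
  rect (fun z => a + b * z) x0 x1 y0 y1 = 0.
Proof.
move=> x01 y01; apply: rect_primitive => //; first exact: ccont_affine.
by move=> z; exact: cdiff_affine.
Qed.

End complex_variable.

(** * Goursat's lemma *)

Section goursat.
Context {R : realType}.
Implicit Types (phi : Cx R -> Cx R) (z w : Cx R).

Let pow_neq0 (k n : nat) : (k.+1%:R : R) ^+ n != 0.
Proof. by rewrite expf_neq0// pnatr_eq0. Qed.

Let halving (w : R) n : w / 2 ^+ n = w / 2 ^+ n.+1 + w / 2 ^+ n.+1.
Proof. by have ne := pow_neq0 1 n; rewrite exprS; field. Qed.

(** Bisection: if the integral has modulus [c > 0], nested rectangles are found whose integrals are
    at least [c / 4 ^+ n]. Differentiability at their common point makes these integrals smaller
    than that. *)
Lemma goursat phi (x0 x1 y0 y1 : R) : ccont phi -> x0 <= x1 -> y0 <= y1 ->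
  (forall x y, x0 <= x <= x1 -> y0 <= y <= y1 ->
     exists d, cdiff phi (CC x y) d) ->
  rect phi x0 x1 y0 y1 = 0.
Proof.
move=> hc x01 y01 hd; apply/eqP; rewrite -cmod_eq0; apply/negPn/negP => c0.
pose w := x1 - x0; pose h := y1 - y0.
have w0 : 0 <= w by rewrite subr_ge0.
have h0 : 0 <= h by rewrite subr_ge0.
pose c := cmod (rect phi x0 x1 y0 y1).
have {}c0 : 0 < c by rewrite lt_neqAle eq_sym c0 cmod_ge0.
have p0 n : (0 : R) < 2 ^+ n by rewrite exprn_gt0.
have wn n : 0 <= w / 2 ^+ n by rewrite divr_ge0// ltW.
have hn n : 0 <= h / 2 ^+ n by rewrite divr_ge0// ltW.
pose X n (p : R * R) := rect phi p.1 (p.1 + w / 2 ^+ n) p.2 (p.2 + h / 2 ^+ n).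
pose Inv n p := c / 4 ^+ n <= cmod (X n p).
pose near n (p q : R * R) := [/\ p.1 <= q.1, q.1 + w / 2 ^+ n.+1 <= p.1 + w / 2 ^+ n,
  p.2 <= q.2 & q.2 + h / 2 ^+ n.+1 <= p.2 + h / 2 ^+ n].
(* The implication stands inside the existential, so that [choice] yields a function of all levels
   and corners, which can then be iterated. *)
have step (np : nat * (R * R)) : exists q, Inv np.1 np.2 ->
    Inv np.1.+1 q /\ near np.1 np.2 q.
  case: np => n [a b] /=.
  set w' := w / 2 ^+ n.+1; set h' := h / 2 ^+ n.+1.
  apply: contrapT => /forallNP H.
  have small q : near n (a, b) q -> cmod (X n.+1 q) < c / 4 ^+ n.+1.
    by move=> nq; have /not_implyP[_ /not_andP[/negP|//]] := H q; rewrite -ltNge.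
  have /not_implyP[I _] := H (a, b).
  have s1 : cmod (X n.+1 (a, b)) < c / 4 ^+ n.+1.
    apply: small; rewrite /near /= (halving w n) (halving h n) -/w' -/h'.
    by have := wn n.+1; have := hn n.+1; rewrite -/w' -/h'; split; lra.
  have s2 : cmod (X n.+1 (a + w', b)) < c / 4 ^+ n.+1.
    apply: small; rewrite /near /= (halving w n) (halving h n) -/w' -/h'.
    by have := wn n.+1; have := hn n.+1; rewrite -/w' -/h'; split; lra.
  have s3 : cmod (X n.+1 (a, b + h')) < c / 4 ^+ n.+1.
    apply: small; rewrite /near /= (halving w n) (halving h n) -/w' -/h'.
    by have := wn n.+1; have := hn n.+1; rewrite -/w' -/h'; split; lra.
  have s4 : cmod (X n.+1 (a + w', b + h')) < c / 4 ^+ n.+1.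
    apply: small; rewrite /near /= (halving w n) (halving h n) -/w' -/h'.
    by have := wn n.+1; have := hn n.+1; rewrite -/w' -/h'; split; lra.
  have E : X n (a, b) = X n.+1 (a, b) + X n.+1 (a + w', b) +
      (X n.+1 (a, b + h') + X n.+1 (a + w', b + h')).
    rewrite /X /= (halving w n) (halving h n) -/w' -/h' (addrA a) (addrA b).
    by rewrite !rect_addx// rect_addy.
  move: I; rewrite /Inv E /= leNgt => /negP; apply.
  apply: le_lt_trans (cmodD _ _) _.
  apply: le_lt_trans (lerD (cmodD _ _) (cmodD _ _)) _.
  have -> : c / 4 ^+ n = c / 4 ^+ n.+1 + c / 4 ^+ n.+1 +
     (c / 4 ^+ n.+1 + c / 4 ^+ n.+1).
    by have ne := pow_neq0 3 n; rewrite exprS; field.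
  lra.
have [f fP] := choice step.
pose s n := nat_rect (fun=> R * R)%type (x0, y0) (fun n p => f (n, p)) n.
have sI n : Inv n (s n).
  elim: n => [|n IH]; last by have [] := fP (n, s n) IH.
  by rewrite /Inv /X /s /= !expr0 !divr1 /w /h !subrKC.
have sn n : near n (s n) (s n.+1) by have [] := fP (n, s n) (sI n).
have mono m n : (m <= n)%N -> [/\ (s m).1 <= (s n).1,
    (s n).1 + w / 2 ^+ n <= (s m).1 + w / 2 ^+ m, (s m).2 <= (s n).2 &
    (s n).2 + h / 2 ^+ n <= (s m).2 + h / 2 ^+ m].
  elim: n => [|n IH]; first by rewrite leqn0 => /eqP ->; split.
  rewrite leq_eqVlt => /predU1P[->|]; first by split.
  rewrite ltnS => /IH[a1 a2 a3 a4]; have [b1 b2 b3 b4] := sn n.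
  by split; lra.
have cross m n : (s m).1 <= (s n).1 + w / 2 ^+ n /\ (s m).2 <= (s n).2 + h / 2 ^+ n.
  have [mn|/ltnW nm] := leqP m n.
    have [a1 a2 a3 a4] := mono _ _ mn; have := wn n; have := hn n; split; lra.
  have [a1 a2 a3 a4] := mono _ _ nm; have := wn m; have := hn m; split; lra.
(* The common point: the lower left corners increase in both coordinates and stay below every upper
   right corner. *)
pose px := sup (range (fun n => (s n).1)); pose py := sup (range (fun n => (s n).2)).
have px1 n : (s n).1 <= px.
  apply: ub_le_sup; last by exists n.
  by exists ((s 0%N).1 + w / 2 ^+ 0%N) => _ [m _ <-]; have [] := cross m 0%N.
have py1 n : (s n).2 <= py.
  apply: ub_le_sup; last by exists n.
  by exists ((s 0%N).2 + h / 2 ^+ 0%N) => _ [m _ <-]; have [] := cross m 0%N.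
have px2 n : px <= (s n).1 + w / 2 ^+ n.
  apply: ge_sup; first by exists (s 0%N).1; exists 0%N.
  by move=> _ [m _ <-]; have [] := cross m n.
have py2 n : py <= (s n).2 + h / 2 ^+ n.
  apply: ge_sup; first by exists (s 0%N).2; exists 0%N.
  by move=> _ [m _ <-]; have [] := cross m n.
have [d hdp] : exists d, cdiff phi (CC px py) d.
  have := px1 0%N; have := px2 0%N; have := py1 0%N; have := py2 0%N.
  rewrite /s /= expr0 !divr1 /w /h !subrKC => *.
  by apply: hd; apply/andP.
pose K := w + h; have K0 : 0 <= K by rewrite addr_ge0.
(* Chosen so that [4 * e * K ^+ 2], the bound obtained at the end up to the factor [4 ^- n], is at
   most [c / 2]. *)
pose e := c / (8 * (K ^+ 2 + 1)).
have K1 : 0 < K ^+ 2 + 1 by rewrite ltr_wpDl// sqr_ge0.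
have e0 : 0 < e by rewrite divr_gt0// mulr_gt0.
have [r r0 hr] := hdp e e0.
have [n nK] : exists n, K / 2 ^+ n < r.
  exists (Num.bound (K / r)); rewrite ltr_pdivrMr// mulrC -ltr_pdivrMr//.
  have := archi_boundP (divr_ge0 K0 (ltW r0)); move/lt_trans; apply.
  by rewrite -natrX ltr_nat ltn_expl.
(* [a + b * z] is minus the tangent of [phi] at the limit point, so adding it leaves the
   differentiability remainder. *)
pose a := (- phi (CC px py)) + d * CC px py; pose b := - d.
have E : X n (s n) = rect (fun z => phi z + (a + b * z)) (s n).1
     ((s n).1 + w / 2 ^+ n) (s n).2 ((s n).2 + h / 2 ^+ n).
  rewrite (rectD _ _ _ _ hc (ccont_affine a b)) rect_affine ?addr0//.
    by rewrite lerDl.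
  by rewrite lerDl.
have := sI n; rewrite /Inv E leNgt => /negP; apply.
apply: (@le_lt_trans _ _ (4 * (e * (K / 2 ^+ n)) * (K / 2 ^+ n))).
  have -> : K / 2 ^+ n = (s n).1 + w / 2 ^+ n - (s n).1 +
                   ((s n).2 + h / 2 ^+ n - (s n).2) by rewrite /K mulrDl; ring.
  apply: rect_bound; rewrite ?lerDl//; first exact: ccontD (ccont_affine a b).
  move=> x y /andP[xa xb] /andP[ya yb].
  have Z : cmod (CC x y - CC px py) <= K / 2 ^+ n.
    apply: le_trans (cmod_le_ReIm _) _; rewrite /K mulrDl.
    by apply: lerD; rewrite ler_norml /=; apply/andP; split;
      have := px1 n; have := px2 n; have := py1 n; have := py2 n; lra.
  have := hr _ (le_lt_trans Z nK); rewrite subrKC.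
  have -> : phi (CC x y) + (a + b * CC x y) =
    phi (CC x y) - phi (CC px py) - d * (CC x y - CC px py) by rewrite /a /b; ring.
  move=> B; apply: le_trans B _; apply: (ler_wpM2l (ltW e0)).
  by apply: le_trans Z _; rewrite /K mulrDl; lra.
rewrite (_ : 4 * _ * _ = 4 * e * K ^+ 2 / 4 ^+ n); last first.
  have -> : (4 : R) = 2 * 2 by rewrite -natrM.
  by rewrite exprMn; have ne := pow_neq0 1 n; field.
rewrite ltr_pM2r ?invr_gt0 ?exprn_gt0//.
have -> : 4 * e * K ^+ 2 = c / 2 * (K ^+ 2 / (K ^+ 2 + 1)).
  by rewrite /e; field; rewrite lt0r_neq0.
have : K ^+ 2 / (K ^+ 2 + 1) <= 1 by rewrite ler_pdivrMr// mul1r lerDl.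
nra.
Qed.

End goursat.

Section goursat_point.
Context {R : realType}.
Implicit Types (phi : Cx R -> Cx R) (z w : Cx R).

(** Four rectangles that avoid [a] are cut off and contribute 0. What is left is a rectangle of
    sides at most [2 * e] around [a], where [phi] is bounded by continuity, so its contribution is
    of order [e]. *)
Lemma goursat_exceptional phi (a : Cx R) (x0 x1 y0 y1 : R) :
  ccont phi -> x0 <= x1 -> y0 <= y1 ->
  (forall x y, x0 <= x <= x1 -> y0 <= y <= y1 -> CC x y != a ->
     exists d, cdiff phi (CC x y) d) ->
  rect phi x0 x1 y0 y1 = 0.
Proof.
move=> hc x01 y01 hd; pose ax := complex.Re a; pose ay := complex.Im a.
have Ea : a = CC ax ay by exact: eqCx.
have [aX|aX] := boolP ((x0 <= ax <= x1) && (y0 <= ay <= y1)); last first.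
  apply: goursat => // x y xx yy; apply: hd => //; apply/eqP => E.
  by move/negP: aX; apply; rewrite /ax /ay -E xx.
move: aX => /andP[/andP[a1 a2] /andP[a3 a4]].
have [r r0 hr] := hc a 1 ltr01.
pose M := cmod (phi a) + 1.
have small (e : R) : 0 < e -> 2 * e < r -> cmod (rect phi x0 x1 y0 y1) <= 16 * M * e.
  move=> e0 er.
  (* The central square is clipped to the rectangle, as [a] may lie on or near the boundary; some of
     the outer pieces then degenerate. *)
  pose e1 := Num.max x0 (ax - e); pose e2 := Num.min x1 (ax + e).
  pose f1 := Num.max y0 (ay - e); pose f2 := Num.min y1 (ay + e).
  have [e1l e1r e1a] : [/\ x0 <= e1, e1 <= ax & ax - e <= e1].
    by rewrite /e1; case: (leP x0 (ax - e)) => ?; split; lra.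
  have [e2l e2r e2a] : [/\ e2 <= x1, ax <= e2 & e2 <= ax + e].
    by rewrite /e2; case: (leP x1 (ax + e)) => ?; split; lra.
  have [f1l f1r f1a] : [/\ y0 <= f1, f1 <= ay & ay - e <= f1].
    by rewrite /f1; case: (leP y0 (ay - e)) => ?; split; lra.
  have [f2l f2r f2a] : [/\ f2 <= y1, ay <= f2 & f2 <= ay + e].
    by rewrite /f2; case: (leP y1 (ay + e)) => ?; split; lra.
  have Z1 : rect phi x0 e1 y0 y1 = 0.
    have [E|E] := leP (ax - e) x0; first by rewrite /e1 max_l// rect_xx.
    apply: goursat => // x y xx yy; apply: hd => //.
      by move: xx => /andP[? ?]; apply/andP; split; lra.
    apply/eqP => /(congr1 (@complex.Re _))/= F; move: xx; rewrite F -/ax /e1.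
    by rewrite (max_r (ltW E)) => /andP[]; lra.
  have Z2 : rect phi e2 x1 y0 y1 = 0.
    have [E|E] := leP x1 (ax + e); first by rewrite /e2 min_l// rect_xx.
    apply: goursat => // x y xx yy; apply: hd => //.
      by move: xx => /andP[? ?]; apply/andP; split; lra.
    apply/eqP => /(congr1 (@complex.Re _))/= F; move: xx; rewrite F -/ax /e2.
    by rewrite (min_r (ltW E)) => /andP[]; lra.
  have Z3 : rect phi e1 e2 y0 f1 = 0.
    have [E|E] := leP (ay - e) y0; first by rewrite /f1 max_l// rect_yy.
    apply: goursat => //; first by lra.
    move=> x y xx yy; apply: hd => //.
    - by move: xx => /andP[? ?]; apply/andP; split; lra.
    - by move: yy => /andP[? ?]; apply/andP; split; lra.
    apply/eqP => /(congr1 (@complex.Im _))/= F; move: yy; rewrite F -/ay /f1.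
    by rewrite (max_r (ltW E)) => /andP[]; lra.
  have Z4 : rect phi e1 e2 f2 y1 = 0.
    have [E|E] := leP y1 (ay + e); first by rewrite /f2 min_l// rect_yy.
    apply: goursat => //; first by lra.
    move=> x y xx yy; apply: hd => //.
    - by move: xx => /andP[? ?]; apply/andP; split; lra.
    - by move: yy => /andP[? ?]; apply/andP; split; lra.
    apply/eqP => /(congr1 (@complex.Im _))/= F; move: yy; rewrite F -/ay /f2.
    by rewrite (min_r (ltW E)) => /andP[]; lra.
  have -> : rect phi x0 x1 y0 y1 = rect phi e1 e2 f1 f2.
    rewrite -(rect_addx x0 e1 x1 _ _ hc) Z1 add0r -(rect_addx e1 e2 x1 _ _ hc) Z2 addr0.
    by rewrite -(rect_addy _ _ y0 f1 y1 hc) Z3 add0r -(rect_addy _ _ f1 f2 y1 hc) Z4 addr0.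
  apply: (@le_trans _ _ (4 * M * ((e2 - e1) + (f2 - f1)))).
    apply: rect_bound => //; [lra|lra|].
    move=> x y /andP[? ?] /andP[? ?].
    have := hr (CC x y - a); rewrite subrKC.
    have L : cmod (CC x y - a) < r.
      apply: le_lt_trans (cmod_le_ReIm _) _; rewrite Ea /=.
      by apply: le_lt_trans er; rewrite mulr2n mulrDl mul1r; apply: lerD;
        rewrite ler_norml; apply/andP; split; lra.
    by move=> /(_ L); have := cmod_sub (phi (CC x y)) (phi a); rewrite /M; lra.
  have M0 : 0 <= M by rewrite addr_ge0.
  by rewrite (_ : 16 * M * e = 4 * M * (4 * e)); [apply: ler_wpM2l; [lra|lra]|ring].
apply/eqP; rewrite -cmod_eq0; apply/eqP/le_anti; rewrite cmod_ge0 andbT.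
apply/ler_addgt0Pr => e e0; rewrite add0r.
have M0 : 0 < M by rewrite ltr_wpDl.
apply: le_trans (small (Num.min (r / 3) (e / (16 * M))) _ _) _.
- by rewrite lt_min !divr_gt0// mulr_gt0.
- have : Num.min (r / 3) (e / (16 * M)) <= r / 3 by rewrite ge_min lexx.
  lra.
- rewrite mulrC -ler_pdivlMr ?mulr_gt0//.
  by rewrite ge_min lexx orbT.
Qed.

End goursat_point.

(** * Primitives on a square *)

Section primitive.
Context {R : realType}.
Implicit Types (phi : Cx R -> Cx R) (z w : Cx R).

Let interval_dist (x u t : R) :
  Num.min x (x + u) <= t <= Num.max x (x + u) -> `|t - x| <= `|u|.
Proof.
rewrite ge_min le_max => /andP[/orP[] ? /orP[] ?]; rewrite ler_norml;
  have := ler_norm u; have := ler_norm (- u); rewrite normrN => ? ?;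
  by apply/andP; split; lra.
Qed.

(** The primitive integrates [phi] from 0 along a horizontal and then a vertical segment. Its
    increment from [z] to [z + w] equals, by the vanishing of one rectangle integral, the integral
    along the similar short path from [z], where [phi] is close to [phi z]. *)
Lemma primitive_square phi (q : R) : ccont phi ->
  (forall x0 x1 y0 y1, - q < x0 -> x0 <= x1 -> x1 < q ->
     - q < y0 -> y0 <= y1 -> y1 < q -> rect phi x0 x1 y0 y1 = 0) ->
  exists P, forall z, `|complex.Re z| < q -> `|complex.Im z| < q ->
    cdiff P z (phi z).
Proof.
move=> hc H0.
have H x0 x1 y0 y1 : `|x0| < q -> `|x1| < q -> `|y0| < q -> `|y1| < q ->
    rect phi x0 x1 y0 y1 = 0.
  rewrite !ltr_norml => /andP[a1 a2] /andP[b1 b2] /andP[c1 c2] /andP[d1 d2].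
  have [x01|/ltW x10] := leP x0 x1; have [y01|/ltW y10] := leP y0 y1.
  - exact: H0.
  - by rewrite rect_symy// H0// oppr0.
  - by rewrite rect_symx// H0// oppr0.
  - by rewrite rect_symx// rect_symy// H0// !oppr0.
exists (fun z => cint (fun x => phi (CC x 0)) 0 (complex.Re z) +
  Ic * cint (fun y => phi (CC (complex.Re z) y)) 0 (complex.Im z)).
move=> z; set x := complex.Re z; set y := complex.Im z => xq yq.
have q0 : 0 < q by apply: le_lt_trans xq.
(* [e / 4]: there are two segments, each of length at most [cmod w], and [cint_bound_sym] carries a
   factor 2. *)
move=> e e0; have [r r0 hr] := hc z (e / 4) (divr_gt0 e0 (ltr0Sn _ _)).
pose dx := q - `|x|.
exists (Num.min (Num.min (r / 2) dx) (q - `|y|)).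
  by rewrite !lt_min divr_gt0//= !subr_gt0 xq.
move=> w; rewrite !lt_min => /andP[/andP[wr wx] wy].
pose u := complex.Re w; pose v := complex.Im w.
have uw : `|u| <= cmod w := ler_Re_cmod _.
have vw : `|v| <= cmod w := ler_Im_cmod _.
rewrite cReD cImD -/x -/y -/u -/v.
have xuq : `|x + u| < q by apply: le_lt_trans (ler_normD _ _) _; rewrite /dx in wx; lra.
have := H x (x + u) 0 y; rewrite normr0 => /(_ xq xuq q0 yq); rewrite /rect => E.
have Ez : z = CC x y by exact: eqCx.
have phiz : phi (CC x y) = phi z by rewrite -Ez.
have h1 := ccts_horizontal 0 hc; have h2 := ccts_horizontal y hc.
have v1 := ccts_vertical (x + u) hc; have v2 := ccts_vertical x hc.
have -> : forall A, cint (fun x => phi (CC x 0)) 0 (x + u) +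
    Ic * cint (fun y => phi (CC (x + u) y)) 0 (y + v) -
    (cint (fun x => phi (CC x 0)) 0 x + Ic * cint (fun y => phi (CC x y)) 0 y) - A =
    cint (fun x => phi (CC x y)) x (x + u) +
    Ic * cint (fun y => phi (CC (x + u) y)) y (y + v) - A.
  move=> A; rewrite -(cint_add 0 x (x + u) h1) -(cint_add 0 y (y + v) v1).
  by apply/eqP; rewrite -subr_eq0; apply/eqP; rewrite -[RHS]E; ring.
have -> : phi z * w = phi z * rC u + Ic * (phi z * rC v).
  by rewrite [in LHS](CxE w) -/u -/v; ring.
have uE : phi z * rC u = cint (fun _ => phi z) x (x + u).
  by rewrite cint_cst addrC addKr.
have vE : phi z * rC v = cint (fun _ => phi z) y (y + v).
  by rewrite cint_cst addrC addKr.
have D1 : cmod (cint (fun x => phi (CC x y)) x (x + u) - phi z * rC u) <=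
    2 * (e / 4) * `|u|.
  rewrite uE -mulN1r -(cintZ _ _ _ (ccts_cst _)) -(cintD _ _ h2 (cctsZ _ (ccts_cst _))).
  have -> : `|u| = `|x + u - x| by congr `|_|; ring.
  apply: cint_bound_sym; first exact: cctsD h2 (cctsZ _ (ccts_cst _)).
  move=> t ht; rewrite mulN1r.
  have := hr (CC t y - z); rewrite subrKC; apply.
  apply: le_lt_trans (cmod_le_ReIm _) _; rewrite Ez /= subrr normr0 addr0.
  have : `|t - x| <= `|u|.
    exact: interval_dist ht.
  lra.
have D2 : cmod (cint (fun y => phi (CC (x + u) y)) y (y + v) - phi z * rC v) <=
    2 * (e / 4) * `|v|.
  rewrite vE -mulN1r -(cintZ _ _ _ (ccts_cst _)) -(cintD _ _ v1 (cctsZ _ (ccts_cst _))).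
  have -> : `|v| = `|y + v - y| by congr `|_|; ring.
  apply: cint_bound_sym; first exact: cctsD v1 (cctsZ _ (ccts_cst _)).
  move=> t ht; rewrite mulN1r.
  have := hr (CC (x + u) t - z); rewrite subrKC; apply.
  apply: le_lt_trans (cmod_le_ReIm _) _; rewrite Ez /= addrAC subrr add0r.
  have : `|t - y| <= `|v|.
    exact: interval_dist ht.
  lra.
set A := cint _ _ _ in D1 *; set B := cint _ _ _ in D2 *.
have -> : A + Ic * B - (phi z * rC u + Ic * (phi z * rC v)) =
  (A - phi z * rC u) + Ic * (B - phi z * rC v) by ring.
apply: le_trans (cmodD _ _) _; rewrite cmodM cmod_Ic mul1r.
apply: le_trans (lerD D1 D2) _; nra.
Qed.

End primitive.

(** * Cauchy's formula and Taylor expansions in one variable *)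

Section cauchy.
Context {R : realType}.
Implicit Types (phi : Cx R -> Cx R) (z w a : Cx R) (t : R).

Lemma cdiffP phi z d : cdiff phi z d <-> is_derive z (1 : Cx R) phi d.
Proof.
have E (s : Cx R) : s *: (1 : Cx R) + z = z + s by rewrite addrC /GRing.scale/= mulr1.
have D (l : Cx R) : (fun h => h^-1 *: (phi (h *: (1 : Cx R) + z) - phi z)) @ 0^' --> l <->
    cdiff phi z l.
  split=> [h e e0|h A /nbhs_CxP[e e0 eA]].
    have /h : nbhs l [set w | cmod (w - l) <= e].
      by apply/nbhs_CxP; exists e => // w /ltW; rewrite /= addrC addKr.
    rewrite /nbhs/= /dnbhs /within/= => /nbhs_CxP[r r0 rh].
    exists r => // w wr; have [->|w0] := eqVneq w 0.
      by rewrite addr0 subrr mulr0 subr0 !cmod0 mulr0.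
    have := rh w wr; rewrite add0r => /(_ w0); rewrite /= E.
    rewrite -(@ler_pM2r _ (cmod w)) ?cmod_gt0// -cmodM mulrBl.
    by rewrite /GRing.scale/= mulrAC mulVf// mul1r.
  have [r r0 rh] := h (e / 2) (divr_gt0 e0 (ltr0Sn _ _)).
  rewrite /nbhs/= /dnbhs /within/=; apply/nbhs_CxP; exists r => // w wr.
  rewrite add0r => w0; rewrite /= E -(subrKC l (_ *: _)); apply: eA.
  apply: (@le_lt_trans _ _ (e / 2)); last by lra.
  rewrite -(@ler_pM2r _ (cmod w)) ?cmod_gt0// -cmodM mulrBl.
  by rewrite /GRing.scale/= mulrAC mulVf// mul1r rh.
split=> [/D h|[h <-]]; first by apply: DeriveDef; [exact: cvgP h|exact: cvg_lim h].
apply/D; exact: h.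
Qed.

Definition cis t : Cx R := CC (cos t) (sin t).
Definition cisN t : Cx R := CC (cos t) (- sin t).

Lemma cis_cisN t : cis t * cisN t = 1.
Proof.
apply: eqCx; rewrite !(cReM, cImM)/=; last by ring.
by rewrite mulrN opprK -!expr2 cos2Dsin2.
Qed.

Lemma cmod_cis t : cmod (cis t) = 1.
Proof.
apply/eqP; rewrite -(@pexpr_eq1 _ _ 2)// sqr_cmod /=; apply/eqP.
exact: cos2Dsin2.
Qed.

Lemma cmod_cisN t : cmod (cisN t) = 1.
Proof.
apply/eqP; rewrite -(@pexpr_eq1 _ _ 2)// sqr_cmod /= sqrrN; apply/eqP.
exact: cos2Dsin2.
Qed.

Lemma cder_cis t : cder cis t (Ic * cis t).
Proof.
have -> : Ic * cis t = CC (- sin t) (cos t).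
  by apply: eqCx; rewrite !(cReM, cImM)/=; ring.
exact: cder_ReIm.
Qed.

Lemma cder_cisN t : cder cisN t (- Ic * cisN t).
Proof.
have -> : - Ic * cisN t = CC (- sin t) (- cos t).
  by apply: eqCx; rewrite !(cReM, cImM)/=; ring.
exact: cder_ReIm.
Qed.

Lemma cderM (G H : R -> Cx R) t c d : cder G t c -> cder H t d ->
  cder (fun s => G s * H s) t (c * H t + G t * d).
Proof.
move=> Gc Hd.
have := cder_Re Gc; have := cder_Im Gc; have := cder_Re Hd; have := cder_Im Hd.
move=> dHi dHr dGi dGr.
apply: (@cder_ext _ (fun s => CC
  (complex.Re (G s) * complex.Re (H s) - complex.Im (G s) * complex.Im (H s))
  (complex.Re (G s) * complex.Im (H s) + complex.Im (G s) * complex.Re (H s)))).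
  by move=> s; apply: eqCx; rewrite !(cReM, cImM).
have -> : c * H t + G t * d = CC
    (complex.Re (G t) * complex.Re d + complex.Re (H t) * complex.Re c -
     (complex.Im (G t) * complex.Im d + complex.Im (H t) * complex.Im c))
    (complex.Re (G t) * complex.Im d + complex.Im (H t) * complex.Re c +
     (complex.Im (G t) * complex.Re d + complex.Re (H t) * complex.Im c)).
  by apply: eqCx; rewrite !(cReM, cImM, cReD, cImD)/=; ring.
apply: cder_ReIm; first by apply: is_deriveB; exact: is_deriveM.
by apply: is_deriveD; exact: is_deriveM.
Qed.

Lemma cder_cisNX j t : cder (fun s => cisN s ^+ j) t (- (j%:R * Ic) * cisN t ^+ j).
Proof.
elim: j => [|j IH].
  by rewrite mul0r oppr0 mul0r; apply: (cder_ext _ (cder_cst 1 t)).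
apply: (@cder_ext _ (fun s => cisN s * cisN s ^+ j)) => [s|]; first by rewrite exprS.
have -> : - (j.+1%:R * Ic) * cisN t ^+ j.+1 =
  (- Ic * cisN t) * cisN t ^+ j + cisN t * (- (j%:R * Ic) * cisN t ^+ j).
  by rewrite exprS -addn1 natrD; ring.
exact: cderM (cder_cisN t) IH.
Qed.

Lemma ccts_cisNX j : ccts (fun s => cisN s ^+ j).
Proof. exact: cder_ccts (cder_cisNX j). Qed.

Lemma pi2_ge0 : 0 <= 2 * pi :> R.
Proof. by rewrite mulr_ge0// pi_ge0. Qed.

Lemma cis2pi : cis (2 * pi) = 1.
Proof. by rewrite /cis mulr_natl cos2pi sin2pi. Qed.

Lemma cisN2pi : cisN (2 * pi) = 1.
Proof. by rewrite /cisN mulr_natl cos2pi sin2pi oppr0. Qed.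

Lemma cis0 : cis 0 = 1. Proof. by rewrite /cis cos0 sin0. Qed.

Lemma cisN0 : cisN 0 = 1. Proof. by rewrite /cisN cos0 sin0 oppr0. Qed.

Lemma cint_cisNX j : cint (fun s => cisN s ^+ j) 0 (2 * pi) =
  if j == 0%N then rC (2 * pi) else 0.
Proof.
case: j => [|j].
  by under [X in cint X]eq_fun do rewrite expr0; rewrite cint_cst mul1r subr0.
have I0 : Ic != 0 :> Cx R by rewrite -cmod_eq0 cmod_Ic oner_eq0.
have j0 : j.+1%:R != 0 :> Cx R by rewrite pnatr_eq0.
have h t : cder (fun s => - (j.+1%:R * Ic)^-1 * cisN s ^+ j.+1) t (cisN t ^+ j.+1).
  have E : cisN t ^+ j.+1 =
      - (j.+1%:R * Ic)^-1 * (- (j.+1%:R * Ic) * cisN t ^+ j.+1).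
    by rewrite mulrA mulrNN mulVf ?mul1r// mulf_neq0.
  by rewrite [X in cder _ _ X]E; apply: cderZ; exact: cder_cisNX.
rewrite (cint_FTC (ccts_cisNX _) pi2_ge0 (fun t _ => h t)).
by rewrite cisN2pi cisN0 subrr.
Qed.

Lemma cint_sum k (F : nat -> R -> Cx R) (a b : R) : (forall j, ccts (F j)) ->
  ccts (fun t => \sum_(j < k) F j t) /\
  cint (fun t => \sum_(j < k) F j t) a b = \sum_(j < k) cint (F j) a b.
Proof.
move=> Fc; elim: k => [|k [IH1 IH2]].
  have -> : (fun t => \sum_(j < 0) F j t) = fun=> 0.
    by apply/funext => t; rewrite big_ord0.
  by rewrite big_ord0 cint_cst mul0r; split=> //; exact: ccts_cst.
have -> : (fun t => \sum_(j < k.+1) F j t) = fun t => (\sum_(j < k) F j t) + F k t.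
  by apply/funext => t; rewrite big_ord_recr.
by rewrite big_ord_recr cintD// IH2; split=> //; exact: cctsD.
Qed.

(** Cauchy's formula with a finite geometric expansion of the kernel. The difference quotient [g] of
    [phi] at [a] has a primitive by Goursat with [a] as exceptional point, so its integral over the
    circle is 0; subtracting the first [k + 1] terms of the geometric series leaves the Taylor
    remainder. The constant 8 is 2 for [phi (gam t) - phi a], 2 for [1 / (1 - u)] with
    [cmod u <= 1 / 2], and 2 from [cint_bound]. *)
Lemma taylor_square phi (r q M : R) : 0 < r -> r < q -> ccont phi ->
  (forall z, `|complex.Re z| < q -> `|complex.Im z| < q ->
     exists d, cdiff phi z d) ->
  (forall z, cmod z <= r -> cmod (phi z) <= M) ->
  exists c : nat -> Cx R, (forall j, cmod (c j) <= 2 * M / r ^+ j) /\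
    forall k a, cmod a <= r / 2 ->
      cmod (phi a - \sum_(j < k.+1) c j * a ^+ j) <= 8 * M * (cmod a / r) ^+ k.+1.
Proof.
move=> r0 rq hc hd hM.
pose gam t := rC r * cis t.
have cgam t : cder gam t (Ic * gam t).
  by rewrite mulrCA; apply: cderZ; exact: cder_cis.
have ccgam : ccts gam := cder_ccts cgam.
have gamr t : cmod (gam t) = r.
  by rewrite cmodM cmod_rC cmod_cis mulr1 gtr0_norm.
have cphi : ccts (fun t => phi (gam t)) by exact: ccont_comp.
have cF j : ccts (fun t => phi (gam t) * cisN t ^+ j).
  by apply: cctsM => //; exact: ccts_cisNX.
have M0 : 0 <= M.
  by have := hM 0; rewrite cmod0 => /(_ (ltW r0)); exact: le_trans (cmod_ge0 _).
have pi0 : 0 < 2 * pi :> R by rewrite mulr_gt0// pi_gt0.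
have rn0 : rC r != 0 by rewrite -cmod_eq0 cmod_rC normr_eq0 lt0r_neq0.
(* Cauchy's coefficients, as Fourier coefficients of [phi] on the circle of radius [r]. They are
   chosen before [k] and [a]. *)
pose c j := rC (r ^- j) * rC (2 * pi)^-1 * cint (fun t => phi (gam t) * cisN t ^+ j) 0 (2 * pi).
exists c; split=> [j|k a ar].
  have rj : 0 <= r ^- j by rewrite invr_ge0 exprn_ge0// ltW.
  have pj : 0 <= (2 * pi)^-1 :> R by rewrite invr_ge0 ltW.
  rewrite /c !cmodM !cmod_rC (ger0_norm rj) (ger0_norm pj).
  rewrite -mulrA [leLHS]mulrC ler_wpM2r//.
  rewrite [leLHS]mulrC ler_pdivrMr// -[X in _ <= _ * X]subr0.
  apply: cint_bound => // [|t _]; first exact: ltW.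
  by rewrite cmodM cmodX cmod_cisN expr1n mulr1 hM// gamr.
have [d dP] : exists d, cdiff phi a d.
  by apply: hd; [apply: le_lt_trans (ler_Re_cmod _) _|
    apply: le_lt_trans (ler_Im_cmod _) _]; apply: le_lt_trans ar _; lra.
pose Q z := (phi z - phi a) * (z - a)^-1.
pose g z := if z == a then d else Q z.
have gQ z : z != a -> forall w, cmod w < cmod (z - a) -> g (z + w) = Q (z + w).
  move=> za w wz; rewrite /g ifN//; apply: contraTN wz => /eqP E.
  by rewrite -leNgt -cmodN -E opprB addrAC subrr add0r.
have gcont : ccont g.
  move=> z; have [->|za] := eqVneq z a.
    move=> e e0; have [s s0 hs] := dP e e0; exists s => // w ws.
    rewrite /g eqxx; case: eqVneq => [_|]; first by rewrite subrr cmod0 ltW.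
    rewrite -subr_eq0 addrAC subrr add0r => w0.
    rewrite -(@ler_pM2r _ (cmod w)) ?cmod_gt0// -cmodM mulrBl /Q.
    have -> : a + w - a = w by rewrite addrAC subrr add0r.
    by rewrite divfK//; exact: hs.
  have za' : z - a != 0 by rewrite subr_eq0.
  have : ccont_at Q z.
    apply/ccont_atP; apply: continuousM.
      by apply: continuousB; [exact/ccont_atP/hc|exact: cst_continuous].
    apply: continuousV => //; apply: continuousB; [exact: cvg_id|exact: cst_continuous].
  move=> h e e0; have [s s0 hs] := h e e0.
  exists (Num.min s (cmod (z - a))); first by rewrite lt_min s0 cmod_gt0.
  move=> w; rewrite lt_min => /andP[/hs ws wz].
  by rewrite gQ// /g ifN.
have gdiff z : `|complex.Re z| < q -> `|complex.Im z| < q -> z != a ->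
    exists d', cdiff g z d'.
  move=> zr zi za; have za' : z - a != 0 by rewrite subr_eq0.
  have [d' /cdiffP dz] := hd z zr zi.
  have h1 : derivable (fun w => phi w - phi a) z (1 : Cx R).
    by apply: derivableB; [exact: (@ex_derive _ _ _ _ _ _ _ dz)|exact: derivable_cst].
  have h2 : derivable (fun w => w - a) z (1 : Cx R).
    by apply: derivableB; [exact: derivable_id|exact: derivable_cst].
  have h3 : derivable (fun w => (w - a)^-1) z (1 : Cx R) by exact: derivableV.
  have /derivableP/cdiffP h4 := derivableM h1 h3; eexists => e e0.
  have [s s0 hs] := h4 e e0.
  exists (Num.min s (cmod (z - a))); first by rewrite lt_min s0 cmod_gt0.
  move=> w; rewrite lt_min => /andP[/hs ws wz].
  by rewrite gQ// (_ : g z = Q z); [exact: ws|rewrite /g ifN].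
have [P hP] : exists P, forall z, `|complex.Re z| < q -> `|complex.Im z| < q ->
    cdiff P z (g z).
  apply: primitive_square => // x0 x1 y0 y1 a1 a2 a3 a4 a5 a6.
  apply: (@goursat_exceptional _ _ a) => // x y /andP[b1 b2] /andP[b3 b4] xya.
  by apply: gdiff => //=; rewrite ltr_norml; apply/andP; split; lra.
have gamq t : `|complex.Re (gam t)| < q /\ `|complex.Im (gam t)| < q.
  by split; [apply: le_lt_trans (ler_Re_cmod _) _|
    apply: le_lt_trans (ler_Im_cmod _) _]; rewrite gamr.
have cg : ccts (fun t => g (gam t) * (Ic * gam t)).
  by apply: cctsM; [exact: ccont_comp|exact: cctsZ].
have I0 : cint (fun t => g (gam t) * (Ic * gam t)) 0 (2 * pi) = 0.
  rewrite (cint_FTC cg pi2_ge0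
    (fun t _ => cder_comp (hP _ (gamq t).1 (gamq t).2) (cgam t))).
  by rewrite /gam cis2pi cis0 subrr.
pose al := a / rC r; pose u t := al * cisN t.
have alE : cmod al = cmod a / r.
  by rewrite cmodM cmodV cmod_rC gtr0_norm.
have um t : cmod (u t) = cmod a / r by rewrite cmodM cmod_cisN mulr1 alE.
have al2 : cmod a / r <= 1 / 2 by rewrite ler_pdivrMr//; lra.
pose S t := \sum_(j < k.+1) u t ^+ j.
(* With [u = a / gam], the first term is [(phi (gam t) - phi a) / (1 - u t)], and it integrates to 0
   by [I0]. Removing the partial sum [S] of the geometric series turns it into a pointwise small
   remainder. *)
pose Rem t := - Ic * (g (gam t) * (Ic * gam t)) + - 1 * ((phi (gam t) - phi a) * S t).
have RemE t : cmod (Rem t) <= 4 * M * (cmod a / r) ^+ k.+1.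
  have u1 : 1 / 2 <= cmod (1 - u t).
    by have := cmod_sub 1 (u t); rewrite cmod1 um; lra.
  have u0 : 1 - u t != 0 by rewrite -cmod_gt0; lra.
  have ga : gam t - a = gam t * (1 - u t).
    rewrite mulrBr mulr1; congr (_ - _); rewrite -[LHS]mulr1 -(cis_cisN t).
    by rewrite /gam /u /al; field.
  have g0 : gam t != 0 by rewrite -cmod_gt0 gamr.
  have ga0 : gam t != a by rewrite -subr_eq0 ga mulf_neq0.
  have -> : Rem t = (phi (gam t) - phi a) * (u t ^+ k.+1 / (1 - u t)).
    have -> : Rem t = - (Ic * Ic) * (Q (gam t) * gam t) - (phi (gam t) - phi a) * S t.
      by rewrite /Rem /g ifN//; ring.
    rewrite Ic2 opprK mul1r /Q ga.
    have := subrX1 (u t) k.+1; rewrite -/(S t) => E.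
    have -> : u t ^+ k.+1 = 1 + (u t - 1) * S t by rewrite -E; ring.
    by field; rewrite u0.
  rewrite cmodM; have h1 : cmod (phi (gam t) - phi a) <= 2 * M.
    apply: le_trans (cmodB _ _) _.
    have := hM (gam t); rewrite gamr lexx => /(_ isT).
    have := hM a; rewrite (le_trans ar)  => [/(_ isT)|]; last by lra.
    lra.
  have h2 : cmod (u t ^+ k.+1 / (1 - u t)) <= 2 * (cmod a / r) ^+ k.+1.
    rewrite cmodM cmodV cmodX um ler_pdivrMr; last by lra.
    have : 0 <= (cmod a / r) ^+ k.+1 by rewrite exprn_ge0// divr_ge0// ltW.
    nra.
  apply: le_trans (ler_pM _ _ h1 h2) _ => //; lra.
have Sj j : ccts (fun t => u t ^+ j).
  have -> : (fun t => u t ^+ j) = fun t => al ^+ j * cisN t ^+ j.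
    by apply/funext => t; rewrite exprMn.
  by apply: cctsZ; exact: ccts_cisNX.
have [cS _] := cint_sum k.+1 0 (2 * pi) Sj.
have cphia : ccts (fun t => phi (gam t) - phi a) by apply: cctsD => //; exact: ccts_cst.
have cRem : ccts Rem.
  by apply: cctsD; [exact: cctsZ|apply: cctsZ; exact: cctsM].
have IRem : cint Rem 0 (2 * pi) =
    - cint (fun t => (phi (gam t) - phi a) * S t) 0 (2 * pi).
  rewrite cintD; [|exact: cctsZ|by apply: cctsZ; exact: cctsM].
  by rewrite cintZ// I0 mulr0 add0r cintZ ?mulN1r//; exact: cctsM.
pose Tj j t := al ^+ j * (phi (gam t) * cisN t ^+ j) + - (phi a * al ^+ j) * cisN t ^+ j.
have cTj j : ccts (Tj j).
  by apply: cctsD; apply: cctsZ => //; exact: ccts_cisNX.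
have [_ IT] := cint_sum k.+1 0 (2 * pi) cTj.
have ES : (fun t => (phi (gam t) - phi a) * S t) = fun t => \sum_(j < k.+1) Tj j t.
  apply/funext => t; rewrite /S mulr_sumr; apply: eq_bigr => j _.
  by rewrite /Tj /u exprMn; ring.
have IE : cint Rem 0 (2 * pi) = rC (2 * pi) * (phi a - \sum_(j < k.+1) c j * a ^+ j).
  rewrite IRem ES IT.
  have Ij (j : nat) : cint (Tj j) 0 (2 * pi) = rC (2 * pi) * (c j * a ^+ j) -
      (if j == 0%N then rC (2 * pi) * phi a else 0).
    rewrite cintD; [|by apply: cctsZ|by apply: cctsZ; exact: ccts_cisNX].
    rewrite !cintZ//; last exact: ccts_cisNX.
    rewrite cint_cisNX /c /al exprMn exprVn rCV rCX rCV.
    set I := cint _ _ _; have p0 : rC (2 * pi) != 0 :> Cx R.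
      by rewrite -cmod_eq0 cmod_rC normr_eq0 lt0r_neq0.
    have -> : rC (2 * pi) * ((rC r ^+ j)^-1 * (rC (2 * pi))^-1 * I * a ^+ j) =
      a ^+ j / rC r ^+ j * I.
      have := expf_neq0 j rn0; move: (rC (2 * pi)) p0 (rC r ^+ j) => p p0 s s0.
      by field; rewrite p0 s0.
    by case: j @I => [|j] I /=; rewrite ?expr0 ?mulr0 ?divr1; ring.
  under eq_bigr do rewrite Ij.
  rewrite sumrB -mulr_sumr opprB mulrBr; congr (_ - _).
  by rewrite big_ord_recl /= big1 ?addr0.
have : cmod (cint Rem 0 (2 * pi)) <= 2 * (4 * M * (cmod a / r) ^+ k.+1) * (2 * pi - 0).
  by apply: cint_bound; rewrite ?pi2_ge0//.
rewrite IE cmodM cmod_rC gtr0_norm// subr0 mulrC ler_pM2r//.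
by move=> /le_trans; apply; rewrite !mulrA -natrM.
Qed.

Let clampr (q x : R) : R := Num.max (- q) (Num.min q x).

Let clampr_id (q x : R) : `|x| <= q -> clampr q x = x.
Proof.
by rewrite ler_norml => /andP[h1 h2]; rewrite /clampr min_r// max_r.
Qed.

Let clampr_le (q x : R) : 0 <= q -> `|clampr q x| <= q.
Proof.
move=> q0; have h : - q <= q by rewrite (le_trans _ q0)// oppr_le0.
by rewrite ler_norml /clampr le_max lexx ge_max h ge_min lexx.
Qed.

Let clampr_lip (q x y : R) : 0 <= q -> `|clampr q x - clampr q y| <= `|x - y|.
Proof.
move=> q0; have h : - q <= q by rewrite (le_trans _ q0)// oppr_le0.
have H t : (t < - q /\ clampr q t = - q) \/ (q < t /\ clampr q t = q) \/
    (- q <= t /\ t <= q /\ clampr q t = t).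
  rewrite /clampr; have [qt|tq] := ltP q t.
    by right; left; rewrite max_r.
  have [tq'|tq'] := ltP t (- q); [left|right; right] => //.
rewrite ler_norml; have := ler_norm (x - y); have := ler_norm (- (x - y)).
rewrite normrN => h1 h2.
by have [[? ->]|[[? ->]|[? [? ->]]]] := H x; have [[? ->]|[[? ->]|[? [? ->]]]] := H y;
  apply/andP; split; lra.
Qed.

(** The path integrals were set up for functions continuous on the whole plane. Composing [phi] with
    the retraction onto a closed square makes it so, without changing it on the square. *)
Lemma taylor1 phi (r M : R) : 0 < r ->
  (forall z, cmod z < 2 * r -> exists d, cdiff phi z d) ->
  (forall z, cmod z < 2 * r -> cmod (phi z) <= M) ->
  exists c : nat -> Cx R, (forall j, cmod (c j) <= 2 * M / r ^+ j) /\
    forall k a, cmod a <= r / 2 ->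
      cmod (phi a - \sum_(j < k.+1) c j * a ^+ j) <= 8 * M * (cmod a / r) ^+ k.+1.
Proof.
(* The square of half side [q] contains the disc of radius [r] and fits in the disc of radius
   [2 * r], as twice the square of 5/4 is less than 4. *)
move=> r0 hd hM; pose q := 5 / 4 * r.
have q0 : 0 < q by rewrite mulr_gt0.
pose cl z := CC (clampr q (complex.Re z)) (clampr q (complex.Im z)).
have cl2r z : cmod (cl z) < 2 * r.
  rewrite -(@ltr_pXn2r _ 2) ?nnegrE ?cmod_ge0 ?mulr_ge0 ?(ltW r0)// sqr_cmod /=.
  have h1 := clampr_le (complex.Re z) (ltW q0).
  have h2 := clampr_le (complex.Im z) (ltW q0).
  have : complex.Re (cl z) ^+ 2 <= q ^+ 2.
    by rewrite -real_normK ?num_real// lerXn2r ?nnegrE ?(ltW q0)//; exact: clampr_le (ltW q0).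
  have : complex.Im (cl z) ^+ 2 <= q ^+ 2.
    by rewrite -real_normK ?num_real// lerXn2r ?nnegrE ?(ltW q0)//; exact: clampr_le (ltW q0).
  rewrite /q /=; nra.
have clid z : `|complex.Re z| <= q -> `|complex.Im z| <= q -> cl z = z.
  by move=> zr zi; apply: eqCx; rewrite /= clampr_id.
have cld z : cmod z <= r -> cl z = z.
  move=> zr; apply: clid; [apply: le_trans (ler_Re_cmod _) _|
    apply: le_trans (ler_Im_cmod _) _]; rewrite /q; lra.
have [|||||c [cM cT]] := @taylor_square (phi \o cl) r q M.
- exact: r0.
- by rewrite /q; lra.
- move=> z e e0; have [d /cdiff_cont dc] := hd (cl z) (cl2r z).
  have [s s0 hs] := dc e e0; exists (s / 2); first by rewrite divr_gt0.
  move=> w ws /=; rewrite -(subrKC (cl z) (cl (z + w))); apply: hs.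
  apply: le_lt_trans (cmod_le_ReIm _) _; rewrite /= cReD cImD.
  have := @clampr_lip q (complex.Re z + complex.Re w) (complex.Re z) (ltW q0).
  have := @clampr_lip q (complex.Im z + complex.Im w) (complex.Im z) (ltW q0).
  have -> : forall x y : R, x + y - x = y by move=> *; ring.
  have -> : forall x y : R, x + y - x = y by move=> *; ring.
  by have := ler_Re_cmod w; have := ler_Im_cmod w; lra.
- move=> z zr zi; have Ez := clid z (ltW zr) (ltW zi).
  have [d dz] := hd (cl z) (cl2r z); exists d => e e0.
  have [s s0 hs] := dz e e0.
  pose s' := Num.min (q - `|complex.Re z|) (q - `|complex.Im z|).
  exists (Num.min s s'); first by rewrite !lt_min s0 !subr_gt0 zr.
  move=> w; rewrite !lt_min => /andP[/hs ws /andP[w1 w2]].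
  have E : cl (z + w) = z + w.
    apply: clid; rewrite ?cReD ?cImD; apply: le_trans (ler_normD _ _) _.
      by have := ler_Re_cmod w; lra.
    by have := ler_Im_cmod w; lra.
  by rewrite /comp E Ez; rewrite Ez in ws.
- by move=> z _; apply: hM.
exists c; split=> // k a ar; have := cT k a ar.
by rewrite /= cld//; lra.
Qed.

End cauchy.

(** * Complex differentiability in several variables *)

Section row_norm.
Context {R : realType} {n : nat}.
Implicit Types (z v w : Cn R n) (a : 'I_n -> Cx R) (h : Cn R n -> Cx R).

(** The sup norm as an element of [R]; the norm of a complex normed space has its values in
    [Cx R]. *)
Definition nrm z : R := complex.Re `|z|.

Lemma nrmE z : `|z| = rC (nrm z).
Proof. by apply: eqCx => //=; apply: ger0_Im; exact: normr_ge0. Qed.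

Lemma nrm_ge0 z : 0 <= nrm z.
Proof. by have := normr_ge0 z; rewrite nrmE ler0c. Qed.

Lemma nrm0 : nrm 0 = 0. Proof. by rewrite /nrm normr0. Qed.

Lemma nrmD z w : nrm (z + w) <= nrm z + nrm w.
Proof. by have := ler_normD z w; rewrite !nrmE -rCD lecR. Qed.

Lemma nrmN z : nrm (- z) = nrm z. Proof. by rewrite /nrm normrN. Qed.

Lemma nrm_distC z w : nrm (z - w) = nrm (w - z).
Proof. by rewrite -nrmN opprB. Qed.

Lemma nrmZ (l : Cx R) z : nrm (l *: z) = cmod l * nrm z.
Proof. by apply: complexI; rewrite -[LHS]nrmE normrZ cmodE nrmE -rCM. Qed.

Lemma nrm_eq0 z : (nrm z == 0) = (z == 0).
Proof.
apply/eqP/eqP => [z0|->]; last exact: nrm0.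
by apply/eqP; rewrite -normr_eq0 nrmE z0.
Qed.

Lemma nrm_gt0 z : (0 < nrm z) = (z != 0).
Proof. by rewrite lt_neqAle nrm_ge0 andbT eq_sym nrm_eq0. Qed.

Lemma coord_le_nrm z i : cmod (z 0 i) <= nrm z.
Proof.
rewrite -lecR -[leLHS]cmodE -[leRHS]nrmE -[`|z|]/(mx_norm z) mx_normE.
rewrite -[leLHS]nngE num_le.
exact: (le_bigmax _ (fun ij : 'I_1 * 'I_n => `|z ij.1 ij.2|%:nng) (0, i)).
Qed.

Lemma nrm_le z (e : R) : 0 <= e -> (forall i, cmod (z 0 i) <= e) -> nrm z <= e.
Proof.
move=> e0 ze; have [->|z0] := eqVneq z 0; first by rewrite nrm0.
have : mx_norm z != 0 by rewrite -[mx_norm z]/(`|z|) normr_eq0.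
move=> /mx_norm_neq0[[i j] /= zij]; rewrite ord1 in zij.
have E : rC (nrm z) = rC (cmod (z 0 j)) by rewrite -nrmE -cmodE -zij.
by case: E => ->.
Qed.

Lemma nbhs_CnP z (A : set (Cn R n)) : nbhs z A <->
  exists2 r : R, 0 < r & forall v, nrm v < r -> A (z + v).
Proof.
split.
  move=> /nbhs_ballP[e /= e0 eA]; exists (complex.Re e).
    by move: e0; rewrite ltcE => /andP[].
  move=> w we; apply: eA; rewrite mx_norm_ball /ball_/= opprD addNKr normrN nrmE.
  move: e0; rewrite !ltcE => /andP[/eqP <- _] /=.
  by rewrite eqxx.
move=> [r r0 rA]; apply/nbhs_ballP; exists (rC r); first by rewrite /= ltcR.
move=> w; rewrite mx_norm_ball /ball_/= nrmE ltcR => wr.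
by rewrite -(subrKC z w); apply: rA; rewrite nrm_distC.
Qed.

Lemma openCnP (U : set (Cn R n)) : open U <->
  forall z, U z -> exists2 r : R, 0 < r & forall v, nrm v < r -> U (z + v).
Proof.
by rewrite openE; split=> h z Uz; apply/nbhs_CnP; exact: h.
Qed.

Lemma rowE_sum v : v = \sum_i v 0 i *: delta_mx 0 i.
Proof. exact: row_sum_delta. Qed.

Lemma nrm_delta i : nrm (delta_mx 0 i : Cn R n) = 1.
Proof.
apply/eqP; rewrite eq_le; apply/andP; split.
  apply: nrm_le => // j; rewrite mxE eqxx /=.
  by case: eqP => _; rewrite ?cmod1 ?cmod0.
by have := coord_le_nrm (delta_mx 0 i) i; rewrite mxE !eqxx cmod1.
Qed.

End row_norm.

Section several_variables.
Context {R : realType} {n : nat}.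
Implicit Types (z v w : Cn R n) (a : 'I_n -> Cx R) (h : Cn R n -> Cx R).

(** Complex differentiability with the gradient [a] spelled out, so that differentials are handled
    as finite sums. *)
Definition mdiff h z a := forall e : R, 0 < e -> exists2 r : R, 0 < r &
  forall v, nrm v < r ->
    cmod (h (z + v) - h z - \sum_i v 0 i * a i) <= e * nrm v.

Lemma cmod_lin v a : cmod (\sum_i v 0 i * a i) <= nrm v * \sum_i cmod (a i).
Proof.
apply: le_trans (cmod_sum _ _ _) _; rewrite mulr_sumr; apply: ler_sum => i _.
by rewrite cmodM ler_wpM2r// coord_le_nrm.
Qed.

Definition lin a v : Cx R := \sum_i v 0 i * a i.

Lemma mdiff_differentiable h z a : mdiff h z a -> differentiable h z.
Proof.
move=> ha.
have linP : linear (lin a).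
  move=> l v w; rewrite /lin scaler_sumr -big_split; apply: eq_bigr => i _ /=.
  by rewrite !mxE mulrDl -mulrA.
pose linM := GRing.isLinear.Build _ _ _ _ _ linP.
pose L : {linear Cn R n -> Cx R} := HB.pack (lin a) linM.
have Lc : continuous L.
  apply: bounded_linear_continuous; apply/linear_boundedP.
  pose K := \sum_i cmod (a i) + 1.
  have K0 : 0 < K by rewrite ltr_wpDl// sumr_ge0.
  near=> M => v; rewrite nrmE cmodE.
  have : rC K <= M by near: M; apply: nbhs_pinfty_ge; apply: ger0_real; rewrite ler0c ltW.
  move=> KM; apply: le_trans (_ : rC K * rC (nrm v) <= _); last first.
    by rewrite ler_wpM2r// ler0c nrm_ge0.
  rewrite -rCM lecR mulrC; apply: le_trans (cmod_lin v a) _.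
  by rewrite ler_wpM2l ?nrm_ge0// /K lerDl.
have E : h \o shift z = cst (h z) + (L : Cn R n -> Cx R) +o_ (0 : Cn R n) id.
  apply: (iffRL (eqaddoP _ _ _ _)) => e e0.
  have eR : 0 < complex.Re e by move: e0; rewrite ltcE => /andP[].
  have [r r0 hr] := ha _ eR.
  apply/nbhs_CnP; exists r => // v vr; rewrite add0r.
  have -> : (h \o shift z - (cst (h z) + (L : Cn R n -> Cx R))) v =
      h (z + v) - h z - \sum_i v 0 i * a i.
    by rewrite [z + v]addrC -addrA -opprD.
  have -> : e = rC (complex.Re e).
    by apply: eqCx => //=; apply: ger0_Im; exact: ltW.
  by rewrite nrmE cmodE -rCM lecR; exact: hr.
apply/diff_locallyP; rewrite (diff_unique Lc E); split=> //.
Unshelve. all: by end_near. Qed.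

Lemma differentiable_mdiff h z : differentiable h z ->
  mdiff h z (fun i => 'd h z (delta_mx 0 i)).
Proof.
move=> hd; have [_ /(iffLR (eqaddoP _ _ _ _)) E] := (diff_locallyP _ _).1 hd.
move=> e e0; have /E/nbhs_CnP[r r0 hr] : 0 < rC e by rewrite ltcR.
exists r => // v vr; have := hr v vr; rewrite add0r nrmE cmodE -rCM lecR.
suff -> : (h \o shift z - (cst (h z) + ('d h z : Cn R n -> Cx R))) v =
  h (z + v) - h z - \sum_i v 0 i * 'd h z (delta_mx 0 i) by [].
rewrite [z + v]addrC -addrA -opprD; congr (_ - (_ + _)).
by rewrite [in LHS](rowE_sum v) linear_sum; apply: eq_bigr => i _; rewrite linearZ.
Qed.

Lemma partial_diff h z i : differentiable h z -> partial i h z = 'd h z (delta_mx 0 i).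
Proof. by move=> hd; rewrite /partial deriveE. Qed.

Lemma mdiff_partial h z : differentiable h z -> mdiff h z (fun i => partial i h z).
Proof.
move=> hd; have := differentiable_mdiff hd; congr mdiff.
by apply/funext => i; rewrite partial_diff.
Qed.

Lemma diff_lin h z v : differentiable h z ->
  'd h z v = \sum_i v 0 i * partial i h z.
Proof.
move=> hd; rewrite [in LHS](rowE_sum v) linear_sum; apply: eq_bigr => i _.
by rewrite linearZ partial_diff.
Qed.

Lemma cdiff_unique phi (z : Cx R) c d : cdiff phi z c -> cdiff phi z d -> c = d.
Proof. by move=> /cdiffP[_ <-] /cdiffP[_ <-]. Qed.

Lemma mdiff_slice h z v a (l : Cx R) : mdiff h (z + l *: v) a ->
  cdiff (fun m => h (z + m *: v)) l (\sum_i v 0 i * a i).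
Proof.
move=> ha e e0; have K0 : 0 < nrm v + 1 by rewrite ltr_wpDl// nrm_ge0.
have [r r0 hr] := ha _ (divr_gt0 e0 K0).
exists (r / (nrm v + 1)); first by rewrite divr_gt0.
move=> w; rewrite ltr_pdivlMr// => wr; rewrite scalerDl addrA.
have wv : nrm (w *: v) < r.
  by rewrite nrmZ; apply: le_lt_trans wr; rewrite ler_wpM2l// lerDl.
have := hr _ wv; have -> : \sum_i (w *: v) 0 i * a i = (\sum_i v 0 i * a i) * w.
  by rewrite mulr_suml; apply: eq_bigr => i _; rewrite mxE; ring.
move=> B; apply: le_trans B _; rewrite nrmZ mulrCA mulrC ler_wpM2r// mulrC.
by apply: ler_succ_div; [exact: nrm_ge0|exact: ltW].
Qed.

Lemma mdiff_unique h z a b : mdiff h z a -> mdiff h z b -> a = b.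
Proof.
move=> ha hb; apply/funext => i.
have E (c : 'I_n -> Cx R) : \sum_j (delta_mx 0 i : Cn R n) 0 j * c j = c i.
  rewrite (bigD1 i)//= big1 ?addr0 => [|j ji]; first by rewrite mxE !eqxx mul1r.
  by rewrite mxE eqxx (negbTE ji) mul0r.
rewrite -(E a) -(E b).
by apply: (@cdiff_unique (fun m => h (z + m *: delta_mx 0 i)) 0);
  apply: mdiff_slice; rewrite scale0r addr0.
Qed.

Lemma mdiff_partialE h z a : mdiff h z a -> forall i, partial i h z = a i.
Proof.
move=> ha i.
by have := mdiff_unique ha (mdiff_partial (mdiff_differentiable ha)) => /(congr1 (@^~ i)).
Qed.

Lemma differentiable_slice h z v (l : Cx R) : differentiable h (z + l *: v) ->
  cdiff (fun m => h (z + m *: v)) l (\sum_i v 0 i * partial i h (z + l *: v)).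
Proof. by move=> /mdiff_partial; exact: mdiff_slice. Qed.

(** All of the theory in several variables is obtained by restriction to complex lines through a
    point, with bounds that do not depend on the direction [v]. *)
Lemma slice_taylor h z v (r M : R) : 0 < r -> nrm v <= 1 ->
  (forall w, nrm w < 2 * r -> differentiable h (z + w)) ->
  (forall w, nrm w < 2 * r -> cmod (h (z + w)) <= M) ->
  exists c : nat -> Cx R, (forall j, cmod (c j) <= 2 * M / r ^+ j) /\
    forall k l, cmod l <= r / 2 ->
      cmod (h (z + l *: v) - \sum_(j < k.+1) c j * l ^+ j) <=
      8 * M * (cmod l / r) ^+ k.+1.
Proof.
move=> r0 v1 hd hM.
have lv l : cmod l < 2 * r -> nrm (l *: v) < 2 * r.
  by apply: le_lt_trans; rewrite nrmZ ler_piMr.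
apply: (@taylor1 _ (fun l => h (z + l *: v))) => // l /lv.
  by move=> /hd/differentiable_slice ?; eexists; eassumption.
exact: hM.
Qed.

Lemma taylor_coef01 (phi : Cx R -> Cx R) (c : nat -> Cx R) (d : Cx R) (r C : R) : 0 < r -> 0 <= C ->
  cdiff phi 0 d ->
  (forall k (l : Cx R), cmod l <= r / 2 ->
     cmod (phi l - \sum_(j < k.+1) c j * l ^+ j) <= C * (cmod l / r) ^+ k.+1) ->
  c 0%N = phi 0 /\ c 1%N = d.
Proof.
move=> r0 C0 pd ct.
have c0 : c 0%N = phi 0.
  have := ct 0%N 0; rewrite cmod0 divr_ge0 ?(ltW r0)// => /(_ isT).
  rewrite mul0r expr1 mulr0 big_ord_recl big_ord0 expr0 mulr1 addr0.
  by move=> h; apply/esym/eqP; rewrite -subr_eq0 -cmod_eq0 eq_le h cmod_ge0.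
split=> //; apply/esym; apply: (@cdiff_unique phi 0) => // e e0.
have rr0 : 0 < C / r ^+ 2 + 1 by rewrite ltr_wpDl// divr_ge0// exprn_ge0// ltW.
exists (Num.min (r / 2) (e / (C / r ^+ 2 + 1))); first by rewrite lt_min !divr_gt0.
move=> w; rewrite lt_min => /andP[/ltW wr]; rewrite ltr_pdivlMr// => we.
have := ct 1%N w wr; rewrite !big_ord_recl big_ord0 expr0 mulr1 addr0 /= c0.
rewrite add0r opprD addrA expr1 => /le_trans; apply.
rewrite expr_div_n mulrA mulrAC expr2 mulrA ler_wpM2r//.
move: we; rewrite mulrDr mulr1 mulrC; have := cmod_ge0 w; lra.
Qed.

(** On the line through [z] directed by [v], the Taylor coefficients of index 0 and 1 are the value
    and the derivative along [v]. The coefficient bound is Cauchy's estimate for the gradient, and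
    the remainder at [k = 1] is the quadratic error. *)
Lemma second_order h z (r M : R) : 0 < r ->
  (forall w, nrm w < 2 * r -> differentiable h (z + w)) ->
  (forall w, nrm w < 2 * r -> cmod (h (z + w)) <= M) ->
  (forall v, nrm v <= 1 -> cmod (\sum_i v 0 i * partial i h z) <= 2 * M / r) /\
  (forall v, nrm v <= r / 2 ->
    cmod (h (z + v) - h z - \sum_i v 0 i * partial i h z) <= 8 * M * (nrm v / r) ^+ 2).
Proof.
move=> r0 hd hM.
have M0 : 0 <= M.
  by apply: le_trans (hM 0 _); rewrite ?nrm0 ?mulr_gt0// cmod_ge0.
have dz : differentiable h z by rewrite -[z]addr0; apply: hd; rewrite nrm0 mulr_gt0.
have T v : nrm v <= 1 -> exists c : nat -> Cx R, [/\ (forall j, cmod (c j) <= 2 * M / r ^+ j),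
    (forall k l, cmod l <= r / 2 ->
      cmod (h (z + l *: v) - \sum_(j < k.+1) c j * l ^+ j) <=
      8 * M * (cmod l / r) ^+ k.+1), c 0%N = h z & c 1%N = \sum_i v 0 i * partial i h z].
  move=> v1; have [c [cM ct]] := slice_taylor r0 v1 hd hM; exists c.
  have dv := @differentiable_slice h z v 0.
  rewrite scale0r addr0 in dv.
  have [|c0 c1] := taylor_coef01 r0 _ (dv dz) ct; first by rewrite mulr_ge0.
  by split=> //; rewrite c0 scale0r addr0.
split=> [v v1|v vr].
  by have [c [/(_ 1%N) + _ _ <-]] := T v v1; rewrite expr1.
have [->|v0] := eqVneq v 0.
  rewrite addr0 subrr nrm0 mul0r expr0n mulr0 big1 ?subrr ?cmod0// => i _.
  by rewrite mxE mul0r.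
have nv0 : 0 < nrm v by rewrite nrm_gt0.
pose l := rC (nrm v); have l0 : l != 0.
  by rewrite -cmod_eq0 cmod_rC normr_eq0 lt0r_neq0.
have lE : cmod l = nrm v by rewrite cmod_rC gtr0_norm.
have vE : v = l *: (l^-1 *: v) by rewrite scalerA divff// scale1r.
have v1 : nrm (l^-1 *: v) <= 1 by rewrite nrmZ cmodV lE mulVf// lt0r_neq0.
have [c [cM ct c0 c1]] := T _ v1.
have := ct 1%N l; rewrite lE -vE => /(_ vr).
rewrite !big_ord_recl big_ord0 /= c0 c1 expr0 mulr1 addr0 expr1.
rewrite opprD addrA mulr_suml; congr (cmod (_ - _) <= _).
by apply: eq_bigr => i _; rewrite mxE; field.
Qed.

End several_variables.

Lemma ler_quadratic (R : realFieldType) (C r e x : R) : 0 < r -> 0 <= x ->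
  x * (C / r ^+ 2 + 1) <= e -> C * (x / r) ^+ 2 <= e * x.
Proof.
move=> r0 x0 h; have -> : C * (x / r) ^+ 2 = x * (C / r ^+ 2) * x.
  by field; rewrite lt0r_neq0.
by rewrite ler_wpM2r// (le_trans _ h)// mulrDr mulr1 lerDl.
Qed.

Section complex_limits.
Context {R : realType}.

Lemma real_cauchy_cvg (u : nat -> R) :
  (forall e : R, 0 < e -> exists N, forall j k, (N <= j)%N -> (N <= k)%N ->
     `|u j - u k| <= e) ->
  exists l, forall e : R, 0 < e -> exists N, forall j, (N <= j)%N -> `|u j - l| <= e.
Proof.
move=> uc; have : cvg (u @ \oo).
  apply/cauchy_cvgP/cauchy_exP => e e0.
  have [N hN] := uc (e / 2) (divr_gt0 e0 (ltr0Sn _ _)).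
  exists (u N); exists N => // j /= Nj; rewrite /ball/=.
  by apply: le_lt_trans (hN N j (leqnn _) Nj) _; rewrite ltr_pdivrMr// ltr_pMr// ltr1n.
move=> /cvg_ex[l /cvgrPdist_le ul]; exists l => e e0.
have [N _ hN] := ul e e0; exists N => j Nj.
by rewrite distrC; exact: hN.
Qed.

Lemma complex_cauchy_cvg (u : nat -> Cx R) :
  (forall e : R, 0 < e -> exists N, forall j k, (N <= j)%N -> (N <= k)%N ->
     cmod (u j - u k) <= e) ->
  exists l, forall e : R, 0 < e -> exists N, forall j, (N <= j)%N -> cmod (u j - l) <= e.
Proof.
move=> uc.
have [|x hx] := @real_cauchy_cvg (fun j => complex.Re (u j)).
  move=> e e0; have [N hN] := uc e e0; exists N => j k Nj Nk.
  by apply: le_trans (hN j k Nj Nk); rewrite -cReN -cReD ler_Re_cmod.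
have [|y hy] := @real_cauchy_cvg (fun j => complex.Im (u j)).
  move=> e e0; have [N hN] := uc e e0; exists N => j k Nj Nk.
  by apply: le_trans (hN j k Nj Nk); rewrite -cImN -cImD ler_Im_cmod.
exists (CC x y) => e e0; have e20 : 0 < e / 2 by rewrite divr_gt0.
have [N hN] := hx _ e20; have [K hK] := hy _ e20.
exists (maxn N K) => j; rewrite geq_max => /andP[/hN h1 /hK h2].
apply: le_trans (cmod_le_ReIm _) _; rewrite cReD cImD cReN cImN /=.
by rewrite (splitr e); exact: lerD.
Qed.

Lemma fin_eventually n (P : 'I_n -> nat -> Prop) :
  (forall i, exists N, forall j, (N <= j)%N -> P i j) ->
  exists N, forall j, (N <= j)%N -> forall i, P i j.
Proof.
move=> /choice[N hN]; exists (\max_i N i)%N => j Nj i; apply: hN.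
by apply: leq_trans Nj; exact: leq_bigmax.
Qed.

End complex_limits.

(** * Limits and derivatives of holomorphic functions *)

Section holomorphic_functions.
Context {R : realType} {n : nat}.
Implicit Types (z v w : Cn R n) (h g : Cn R n -> Cx R) (U : set (Cn R n)).

Lemma partialD i h g z : differentiable h z -> differentiable g z ->
  partial i (fun w => h w + g w) z = partial i h z + partial i g z.
Proof. by move=> hd gd; apply: deriveD; exact: diff_derivable. Qed.

Lemma partialB i h g z : differentiable h z -> differentiable g z ->
  partial i (fun w => h w - g w) z = partial i h z - partial i g z.
Proof. by move=> hd gd; apply: deriveB; exact: diff_derivable. Qed.

Lemma partialM i h g z : differentiable h z -> differentiable g z ->
  partial i (fun w => h w * g w) z = h z * partial i g z + g z * partial i h z.
Proof. by move=> hd gd; apply: deriveM; exact: diff_derivable. Qed.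

Lemma differentiable_locally_bounded h z : differentiable h z ->
  exists2 r : R, 0 < r & forall v, nrm v < r -> cmod (h (z + v)) <= cmod (h z) + 1.
Proof.
move=> /differentiable_continuous hc.
have /hc/nbhs_CnP[r r0 hr] : nbhs (h z) [set w | cmod (w - h z) <= 1].
  by apply/nbhs_CxP; exists 1 => // w /ltW; rewrite /= addrC addKr.
exists r => // v /hr /= hv; have := cmod_sub (h (z + v)) (h z); lra.
Qed.

(** Weierstrass: Cauchy's estimate makes the gradients at [z] a Cauchy sequence, and the quadratic
    remainder is uniform in [j], so it survives in the limit with the limit gradient. *)
Lemma holo_limit (h_ : nat -> Cn R n -> Cx R) g z (r M : R) : 0 < r ->
  (forall j v, nrm v < 2 * r -> differentiable (h_ j) (z + v)) ->
  (forall e : R, 0 < e -> exists N, forall j, (N <= j)%N ->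
     forall v, nrm v < 2 * r -> cmod (h_ j (z + v) - g (z + v)) <= e) ->
  (forall v, nrm v < 2 * r -> cmod (g (z + v)) <= M) -> differentiable g z.
Proof.
move=> r0 hd hg gM.
have n0 : nrm (0 : Cn R n) < 2 * r by rewrite nrm0 mulr_gt0.
have dz j : differentiable (h_ j) z by rewrite -[z]addr0; exact: hd.
have M0 : 0 <= M by apply: le_trans (gM 0 n0); exact: cmod_ge0.
pose a j i := partial i (h_ j) z.
have ac i : exists l, forall e : R, 0 < e ->
    exists N, forall j, (N <= j)%N -> cmod (a j i - l) <= e.
  apply: complex_cauchy_cvg => e e0.
  have [N hN] := hg (e * r / 4) (divr_gt0 (mulr_gt0 e0 r0) (ltr0Sn _ _)).
  exists N => j k Nj Nk.
  have [|w wr|+ _] := @second_order _ _ (fun w => h_ j w - h_ k w) z r (e * r / 2) r0.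
  - by move=> w wr; apply: differentiableB; exact: hd.
  - have -> : h_ j (z + w) - h_ k (z + w) =
      (h_ j (z + w) - g (z + w)) - (h_ k (z + w) - g (z + w)) by ring.
    apply: le_trans (cmodB _ _) _.
    by apply: le_trans (lerD (hN j Nj _ wr) (hN k Nk _ wr)) _; lra.
  - move=> /(_ (delta_mx 0 i)); rewrite nrm_delta lexx => /(_ isT).
    rewrite (bigD1 i)//= big1 ?addr0 => [|l li]; last first.
      by rewrite mxE eqxx (negbTE li) mul0r.
    rewrite mxE !eqxx mul1r partialB// => /le_trans; apply.
    by rewrite (_ : 2 * (e * r / 2) / r = e)//; field; rewrite lt0r_neq0.
have {ac}[l al] := choice ac.
apply: (@mdiff_differentiable _ _ _ _ l) => e e0.
pose K := 8 * (M + 1) / r ^+ 2 + 1.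
have K0 : 0 < K.
  by rewrite ltr_wpDl// divr_ge0 ?exprn_ge0 ?(ltW r0)// mulr_ge0// addr_ge0.
exists (Num.min (r / 2) (e / K)); first by rewrite lt_min !divr_gt0.
move=> v; rewrite lt_min => /andP[vr]; rewrite ltr_pdivlMr// => ve.
have vr2 : nrm v < 2 * r by lra.
(* [d] bounds the error made when [g] and [l] are replaced by some [h_ j] and its gradient; for
   fixed [v] it can be sent to 0. *)
suff S (d : R) : 0 < d -> cmod (g (z + v) - g z - \sum_i v 0 i * l i) <=
    8 * (M + 1) * (nrm v / r) ^+ 2 + (2 + nrm v * n%:R) * d.
  apply: (@le_trans _ _ (8 * (M + 1) * (nrm v / r) ^+ 2)).
    apply/ler_addgt0Pr => d d0.
    have L0 : 0 < 2 + nrm v * n%:R.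
      by rewrite ltr_pwDl// mulr_ge0// ?nrm_ge0.
    have := S _ (divr_gt0 d0 L0).
    by rewrite [_ * (d / _)]mulrC divfK// lt0r_neq0.
  apply: ler_quadratic => //; first exact: nrm_ge0. exact: ltW.
move=> d0; have d10 : 0 < Num.min d 1 by rewrite lt_min d0 ltr01.
have [N hN] := hg _ d10.
have [N' hN'] := @fin_eventually _ (fun i j => cmod (a j i - l i) <= d)
  (fun i => al i d d0).
pose j := maxn N N'; have Nj : (N <= j)%N by exact: leq_maxl.
have hj w : nrm w < 2 * r -> cmod (h_ j (z + w) - g (z + w)) <= d /\
    cmod (h_ j (z + w) - g (z + w)) <= 1.
  by move=> /(hN j Nj); rewrite le_min => /andP.
have aj i : cmod (a j i - l i) <= d by apply: hN'; exact: leq_maxr.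
have [|w wr|_ so] := @second_order _ _ (h_ j) z r (M + 1) r0.
- exact: hd.
- rewrite -(subrK (g (z + w)) (h_ j _)) addrC; apply: le_trans (cmodD _ _) _.
  by apply: lerD; [exact: gM|have [] := hj _ wr].
have {}so := so v (ltW vr).
have -> : g (z + v) - g z - \sum_i v 0 i * l i =
  (h_ j (z + v) - h_ j z - \sum_i v 0 i * a j i) +
  (\sum_i v 0 i * (a j i - l i) + (h_ j z - g z) - (h_ j (z + v) - g (z + v))).
  under [X in _ = _ + (X + _ - _)]eq_bigr do rewrite mulrBr.
  by rewrite sumrB; ring.
apply: le_trans (cmodD _ _) _; apply: lerD => //.
apply: le_trans (cmodB _ _) _; apply: le_trans (lerD (cmodD _ _) (lexx _)) _.
have h1 : cmod (\sum_i v 0 i * (a j i - l i)) <= nrm v * n%:R * d.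
  apply: le_trans (cmod_lin _ _) _; rewrite -mulrA ler_wpM2l ?nrm_ge0//.
  apply: le_trans (ler_sum _ (fun i _ => aj i)) _.
  by rewrite sumr_const card_ord mulr_natl.
have [h2 _] := hj _ n0; rewrite addr0 in h2.
have [h3 _] := hj _ vr2.
by rewrite mulrDl; lra.
Qed.

(** Difference quotients with real steps [t j] tending to 0 converge locally uniformly to the
    partial derivative, by the quadratic remainder, and [holo_limit] applies. *)
Lemma partial_holomorphic U h i : open U -> holomorphic U h ->
  holomorphic U (partial i h).
Proof.
move=> /openCnP oU hU z Uz.
have [r1 r10 hr1] := oU z Uz.
have [r2 r20 hr2] := differentiable_locally_bounded (hU z Uz).
pose r := Num.min r1 r2 / 4; have r0 : 0 < r by rewrite divr_gt0// lt_min r10.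
have r4 w : nrm w < 4 * r -> differentiable h (z + w) /\ cmod (h (z + w)) <= cmod (h z) + 1.
  rewrite /r mulrC divfK// lt_min => /andP[w1 w2].
  by split; [apply: hU; exact: hr1|exact: hr2].
pose M := cmod (h z) + 1.
have B w : nrm w < 2 * r ->
    (forall v, nrm v < 2 * r -> differentiable h (z + w + v)) /\
    (forall v, nrm v < 2 * r -> cmod (h (z + w + v)) <= M).
  move=> wr; suff H v : nrm v < 2 * r -> nrm (w + v) < 4 * r.
    by split=> v /H/r4[hd hM]; rewrite -addrA.
  by move=> vr; apply: le_lt_trans (nrmD _ _) _; lra.
pose t j : R := r / 2 / j.+1%:R.
have t0 j : 0 < t j by apply: divr_gt0 => //; exact: divr_gt0.
have tr j : t j <= r / 2.
  by rewrite ler_pdivrMr// ler_peMr ?ler1n// divr_ge0// ltW.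
pose h_ j w := (h (w + rC (t j) *: delta_mx 0 i) - h w) * (rC (t j))^-1.
have tn0 j : rC (t j) != 0 by rewrite -cmod_eq0 cmod_rC normr_eq0 lt0r_neq0.
have tm j : cmod (rC (t j)) = t j by rewrite cmod_rC gtr0_norm.
apply: (@holo_limit h_ (partial i h) z r (2 * M / r) r0).
- move=> j v vr; apply: differentiableM; last exact: differentiable_cst.
  apply: differentiableB.
    apply: (@differentiable_comp _ _ _ _ (fun w => w + rC (t j) *: delta_mx 0 i) h).
      by apply: differentiableD; [exact: ex_diff|exact: differentiable_cst].
    apply: (B v vr).1; rewrite nrmZ nrm_delta tm mulr1.
    by have := tr j; lra.
  by rewrite -[z + v]addr0; apply: (B v vr).1; rewrite nrm0 mulr_gt0.
- move=> e e0; pose K := 8 * M / r ^+ 2 + 1.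
  have M0 : 0 <= M by rewrite addr_ge0.
  have K0 : 0 < K.
    by rewrite ltr_wpDl// divr_ge0 ?exprn_ge0 ?(ltW r0)// mulr_ge0.
  pose N := Num.bound (r / 2 * K / e).
  exists N => j Nj v vr.
  have tK : t j * K <= e.
    rewrite /t mulrAC ler_pdivrMr// [e * _]mulrC -ler_pdivrMr//.
    have := archi_boundP (divr_ge0 (mulr_ge0 (divr_ge0 (ltW r0) (ler0n _ 2)) (ltW K0)) (ltW e0)).
    move=> /ltW/le_trans; apply; rewrite ler_nat.
    exact: leq_trans Nj (leqnSn _).
  have [hd hM] := B v vr.
  have [_ so] := second_order r0 hd hM.
  have := so (rC (t j) *: delta_mx 0 i); rewrite nrmZ nrm_delta tm mulr1 => /(_ (tr j)).
  rewrite (bigD1 i)//= big1 ?addr0 => [|l li]; last first.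
    by rewrite !mxE eqxx (negbTE li) mulr0 mul0r.
  rewrite !mxE !eqxx mulr1 => bd.
  rewrite -(@ler_pM2r _ (t j))// -{1}(tm j) -cmodM /h_ mulrBl divfK//.
  rewrite [partial i h _ * _]mulrC; apply: le_trans bd _.
  by apply: ler_quadratic => //; exact: ltW.
- move=> v vr; have [hd hM] := B v vr.
  have [so _] := second_order r0 hd hM.
  have := so (delta_mx 0 i); rewrite nrm_delta lexx => /(_ isT).
  rewrite (bigD1 i)//= big1 ?addr0 => [|l li]; last first.
    by rewrite mxE eqxx (negbTE li) mul0r.
  by rewrite mxE !eqxx mul1r.
Qed.

Lemma eq_partial U h g i : open U -> {in U, h =1 g} ->
  {in U, partial i h =1 partial i g}.
Proof.
move=> oU hg z zU; rewrite /partial; apply: near_eq_derive.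
have : nbhs z U by apply: open_nbhs_nbhs; split => //; rewrite inE in zU.
by apply: filterS => w Uw; apply: hg; rewrite inE.
Qed.

Lemma eq_multi_partial U h g (al : multinom n) : open U -> {in U, h =1 g} ->
  {in U, multi_partial al h =1 multi_partial al g}.
Proof.
move=> oU hg; rewrite /multi_partial; elim: (enum 'I_n) => [|i s IH]; first exact: hg.
move: IH => /=; move: (foldr _ h s) (foldr _ g s) => h' g' hg'.
by elim: (al i) => [|k IHk]; [exact: hg'|exact: eq_partial oU IHk].
Qed.

Lemma multi_partialB U h g (al : multinom n) : open U ->
  holomorphic U h -> holomorphic U g -> {in U, multi_partial al (fun w => h w - g w) =1
    fun z => multi_partial al h z - multi_partial al g z}.
Proof.
move=> oU hU gU; rewrite /multi_partial.
suff [_ [_ ]] : holomorphic U (foldr (fun i g => iter (al i) (partial i) g) h (enum 'I_n)) /\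
   holomorphic U (foldr (fun i g => iter (al i) (partial i) g) g (enum 'I_n)) /\
   {in U, foldr (fun i g => iter (al i) (partial i) g) (fun w => h w - g w) (enum 'I_n) =1
   fun z => foldr (fun i g => iter (al i) (partial i) g) h (enum 'I_n) z -
            foldr (fun i g => iter (al i) (partial i) g) g (enum 'I_n) z} by [].
elim: (enum 'I_n) => //= i s [IH1 [IH2 IH3]].
elim: (al i) => //= k [IK1 [IK2 IK3]]; split; first exact: partial_holomorphic.
split; first exact: partial_holomorphic.
move=> z zU; rewrite (eq_partial i oU IK3 zU) partialB//.
  by apply: IK1; rewrite inE in zU.
by apply: IK2; rewrite inE in zU.
Qed.

End holomorphic_functions.

(** * Order of vanishing at the origin *)

Section vanishing_order.
Context {R : realType} {n : nat}.
Implicit Types (z v w : Cn R n) (h g : Cn R n -> Cx R) (U : set (Cn R n)).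
Implicit Types (m al be : multinom n) (k : nat) (p q : mpoly n (Cx R)).

(** Membership in M_k, stated as a growth condition: stability under products and under composition
    with maps fixing 0 then needs no formula for higher derivatives. *)
Definition ord h k := exists d C : R, [/\ 0 < d, 0 <= C &
  forall v, nrm v < d -> cmod (h v) <= C * nrm v ^+ k].

Lemma ordD h g k : ord h k -> ord g k -> ord (fun v => h v + g v) k.
Proof.
move=> [d [C [d0 C0 hC]]] [e [B [e0 B0 gB]]].
exists (Num.min d e), (C + B); split; rewrite ?addr_ge0 ?lt_min ?d0//.
move=> v; rewrite lt_min => /andP[/hC hv /gB gv].
by apply: le_trans (cmodD _ _) _; rewrite mulrDl; exact: lerD.
Qed.

Lemma ordZ h k (c : Cx R) : ord h k -> ord (fun v => c * h v) k.
Proof.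
move=> [d [C [d0 C0 hC]]]; exists d, (cmod c * C); split=> //.
  exact: mulr_ge0.
by move=> v /hC hv; rewrite cmodM -mulrA ler_wpM2l.
Qed.

Lemma ord_sum (I : Type) (s : seq I) (F : I -> Cn R n -> Cx R) k :
  (forall i, ord (F i) k) -> ord (fun v => \sum_(i <- s) F i v) k.
Proof.
move=> Fk; elim: s => [|i s IH].
  exists 1, 0; split=> // v _; rewrite big_nil cmod0 mul0r//.
have := ordD (Fk i) IH; congr (ord _ _).
by apply/funext => v; rewrite big_cons.
Qed.

Lemma ord_le h k l : (k <= l)%N -> ord h l -> ord h k.
Proof.
move=> kl [d [C [d0 C0 hC]]]; exists (Num.min d 1), C; split; rewrite ?lt_min ?d0 ?ltr01//.
move=> v; rewrite lt_min => /andP[/hC hv v1]; apply: le_trans hv _.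
by rewrite ler_wpM2l// ler_wiXn2l ?nrm_ge0// ltW.
Qed.

Lemma eq_ord h g k (r : R) : 0 < r -> (forall v, nrm v < r -> h v = g v) ->
  ord h k -> ord g k.
Proof.
move=> r0 hg [d [C [d0 C0 hC]]]; exists (Num.min d r), C; split; rewrite ?lt_min ?d0//.
by move=> v; rewrite lt_min => /andP[/hC hv /hg <-].
Qed.

Lemma ordM0 h g k : ord h k -> differentiable g 0 -> ord (fun v => g v * h v) k.
Proof.
move=> [d [C [d0 C0 hC]]] /differentiable_locally_bounded[r r0 gr].
exists (Num.min d r), ((cmod (g 0) + 1) * C); split; rewrite ?lt_min ?d0//.
  by rewrite mulr_ge0// addr_ge0.
move=> v; rewrite lt_min => /andP[/hC hv /gr]; rewrite add0r => gv.
by rewrite cmodM -mulrA ler_pM.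
Qed.

Lemma ord_fin (I : finType) (F : I -> Cn R n -> Cx R) k : (forall i, ord (F i) k) ->
  exists d C : R, [/\ 0 < d, 0 <= C &
    forall i v, nrm v < d -> cmod (F i v) <= C * nrm v ^+ k].
Proof.
move=> Fk; suff [d [C [d0 C0 H]]] : exists d C : R, [/\ 0 < d, 0 <= C &
    forall i, i \in enum I -> forall v, nrm v < d -> cmod (F i v) <= C * nrm v ^+ k].
  by exists d, C; split=> // i; apply: H; rewrite mem_enum.
elim: (enum I) => [|i s [d [C [d0 C0 IH]]]]; first by exists 1, 0; split.
have [e [B [e0 B0 hB]]] := Fk i.
exists (Num.min d e), (C + B); split; rewrite ?addr_ge0 ?lt_min ?d0//.
move=> j; rewrite inE => /predU1P[->|js] v; rewrite lt_min => /andP[vd ve].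
  by apply: le_trans (hB v ve) _; rewrite ler_wpM2r ?exprn_ge0 ?nrm_ge0// lerDr.
by apply: le_trans (IH j js v vd) _; rewrite ler_wpM2r ?exprn_ge0 ?nrm_ge0// lerDl.
Qed.

Lemma ord_eq0 h k : ord h k.+1 -> h 0 = 0.
Proof.
move=> [d [C [d0 C0 /(_ 0)]]]; rewrite nrm0 exprS mul0r mulr0 => /(_ d0) h0.
by apply/eqP; rewrite -cmod_eq0 eq_le h0 cmod_ge0.
Qed.

(** Cauchy's estimate on a ball around [v] of radius proportional to [nrm v]: the bound for [h]
    there is of order [nrm v ^+ k.+1], and one power is lost by division by the radius. *)
Lemma ord_partial U h i k : open U -> U 0 -> holomorphic U h -> ord h k.+1 ->
  ord (partial i h) k.
Proof.
move=> oU U0 hU [d [C [d0 C0 hC]]].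
have /differentiable_continuous pc := partial_holomorphic i oU hU U0.
have [r r0 hr] := (openCnP U).1 oU 0 U0.
pose d' := Num.min (d / 2) (r / 2).
have d'0 : 0 < d' by rewrite lt_min !divr_gt0.
pose B := 8 * (C * 2 ^+ k.+1).
have B0 : 0 <= B by rewrite !mulr_ge0// exprn_ge0.
have H v : v != 0 -> nrm v < d' -> cmod (partial i h v) <= B * nrm v ^+ k.
  rewrite -nrm_gt0 lt_min => v0 /andP[vd vr].
  pose s := nrm v / 4; have s0 : 0 < s by rewrite divr_gt0.
  have vw w : nrm w < 2 * s -> nrm (v + w) <= 2 * nrm v.
    by move=> ws; apply: le_trans (nrmD _ _) _; rewrite /s in ws; lra.
  have [|w ws|+ _] := @second_order _ _ h v s (C * (2 * nrm v) ^+ k.+1) s0.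
  - by move=> w /vw ws; apply: hU; rewrite -[v + w]add0r; apply: hr; lra.
  - apply: le_trans (hC _ _) _; first by have := vw _ ws; lra.
    by rewrite ler_wpM2l// lerXn2r ?nnegrE ?nrm_ge0 ?mulr_ge0 ?nrm_ge0// vw.
  move=> /(_ (delta_mx 0 i)); rewrite nrm_delta lexx => /(_ isT).
  rewrite (bigD1 i)//= big1 ?addr0 => [|l li]; last first.
    by rewrite mxE eqxx (negbTE li) mul0r.
  rewrite mxE !eqxx mul1r => /le_trans; apply.
  rewrite exprMn /s /B [nrm v ^+ k.+1]exprS.
  rewrite (_ : _ / _ = 8 * (C * 2 ^+ k.+1) * nrm v ^+ k)//.
  by field; rewrite lt0r_neq0.
exists d', B; split=> // v vd'; have [->|v0] := eqVneq v 0; last exact: H.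
(* At [v = 0] the ball degenerates, so the estimate is passed to the limit along the points [u] of a
   coordinate axis. *)
rewrite nrm0; apply/ler_addgt0Pr => e e0.
have /pc/nbhs_CnP[q q0 hq] : nbhs (partial i h 0) [set w | cmod (w - partial i h 0) <= e / 2].
  by apply/nbhs_CxP; exists (e / 2) => [|w /ltW]; rewrite ?divr_gt0//= addrC addKr.
pose t := Num.min (Num.min (q / 2) (d' / 2)) (Num.min 1 (e / 2 / (B + 1))).
have B1 : 0 < B + 1 by rewrite ltr_wpDl.
have t0 : 0 < t by rewrite !lt_min ltr01 !divr_gt0.
pose u : Cn R n := rC t *: delta_mx 0 i.
have ut : nrm u = t by rewrite nrmZ nrm_delta cmod_rC mulr1 gtr0_norm.
have u0 : u != 0 by rewrite -nrm_gt0 ut.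
have tq : t <= q / 2 by rewrite /t !ge_min lexx.
have td : t <= d' / 2 by rewrite /t !ge_min lexx !orbT.
have t1 : t <= 1 by rewrite /t !ge_min lexx !orbT.
have te : t <= e / 2 / (B + 1) by rewrite /t !ge_min lexx !orbT.
have := hq u; rewrite ut add0r => /(_ _)/= h1.
have h2 := H u u0; rewrite ut in h2.
have {}h1 : cmod (partial i h u - partial i h 0) <= e / 2 by apply: h1; lra.
have {}h2 : cmod (partial i h u) <= B * t ^+ k by apply: h2; lra.
have h3 : B * t ^+ k <= B * 0 ^+ k + e / 2.
  case: (k) => [|k']; first by rewrite !expr0 lerDl divr_ge0// ltW.
  rewrite exprS [0 ^+ _]exprS mul0r mulr0 add0r.
  apply: (@le_trans _ _ (B * (t * 1))).
    by rewrite ler_wpM2l// ler_wpM2l ?(ltW t0)// exprn_ile1// ltW.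
  rewrite mulr1; apply: le_trans (ler_wpM2l B0 te) _.
  by apply: ler_succ_div => //; rewrite divr_ge0// ltW.
have h4 : cmod (partial i h 0) <=
    cmod (partial i h u) + cmod (partial i h u - partial i h 0).
  by rewrite cmod_distC -lerBlDl; exact: cmod_sub.
apply: le_trans h4 _; apply: le_trans (lerD h2 h1) _.
by apply: le_trans (lerD h3 (lexx _)) _; rewrite -addrA -splitr.
Qed.

Lemma ord_multi_partial U h al k : open U -> U 0 -> holomorphic U h ->
  (mdeg al < k)%N -> ord h k -> multi_partial al h 0 = 0.
Proof.
move=> oU U0 hU alk hk.
suff [_] : holomorphic U (multi_partial al h) /\ ord (multi_partial al h) (k - mdeg al).
  by rewrite -subn_gt0 in alk; rewrite -(prednK alk); exact: ord_eq0.
rewrite mdegE -big_enum /multi_partial/=; elim: (enum 'I_n) => [|i s [IH1 IH2]].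
  by rewrite big_nil subn0.
rewrite big_cons addnC subnDA /=.
move: IH1 IH2; move: (foldr _ h s) (k - _)%N => g l gU gl.
elim: (al i) => [|j [IK1 IK2]]; first by rewrite subn0.
split; first exact: partial_holomorphic oU IK1.
(* The subtraction is truncated: once the order has dropped to 0, the claim is only local
   boundedness. *)
have [E|E] := posnP (l - j)%N.
  rewrite subnS E; have /differentiable_locally_bounded[r r0 hr] :=
    partial_holomorphic i oU IK1 U0.
  exists r, (cmod (partial i (iter j (partial i) g) 0) + 1).
  split=> // [|v vr]; first exact: addr_ge0.
  by have := hr v vr; rewrite add0r expr0 mulr1.
by rewrite subnS; apply: (ord_partial i oU U0 IK1); rewrite prednK.
Qed.

End vanishing_order.

(** * Taylor polynomials *)

Section polynomials.
Context {R : realType} {n : nat}.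
Implicit Types (z v w : Cn R n) (h g : Cn R n -> Cx R) (U : set (Cn R n)).
Implicit Types (m al be : multinom n) (k : nat) (p q : mpoly n (Cx R)).

Local Notation MX m := (@mpolyX n (Cx R) m).

Definition monom m z : Cx R := \prod_(i < n) z 0 i ^+ m i.

Lemma pevalE q z : peval q z = \sum_(m <- msupp q) mcoeff m q * monom m z.
Proof. by rewrite /peval mevalE. Qed.

Lemma pevalX m z : peval (MX m) z = monom m z.
Proof. by rewrite /peval mevalX. Qed.

Lemma pevalD p q z : peval (p + q) z = peval p z + peval q z.
Proof. exact: mevalD. Qed.

Lemma pevalB p q z : peval (p - q) z = peval p z - peval q z.
Proof. exact: mevalB. Qed.

Lemma pevalZ c p z : peval (c *: p) z = c * peval p z.
Proof. exact: mevalZ. Qed.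

Lemma pevalM p q z : peval (p * q) z = peval p z * peval q z.
Proof. exact: mevalM. Qed.

Lemma peval_sum (I : Type) (r : seq I) (P : pred I) (F : I -> mpoly n (Cx R)) z :
  peval (\sum_(i <- r | P i) F i) z = \sum_(i <- r | P i) peval (F i) z.
Proof. by apply: (big_morph (fun p => peval p z)) => [p q|];
  rewrite ?pevalD//; exact: meval0. Qed.

Lemma monomZ m (l : Cx R) z : monom m (l *: z) = l ^+ mdeg m * monom m z.
Proof.
rewrite /monom mdegE -prodrXr -big_split; apply: eq_bigr => i _ /=.
by rewrite mxE exprMn.
Qed.

Lemma peval_differentiable q z : differentiable (peval q) z /\
  forall i, partial i (peval q) z = peval (mderiv i q) z.
Proof.
pose good q := forall z, differentiable (peval q) z /\
  forall i, partial i (peval q) z = peval (mderiv i q) z.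
have gC (c : Cx R) : good (mpolyC n c).
  move=> x; have -> : peval (mpolyC n c) = cst c.
    by apply/funext => y; rewrite /peval mevalC.
  split; first exact: differentiable_cst.
  by move=> i; rewrite mderivC /partial derive_cst /peval meval0.
have gD p r : good p -> good r -> good (p + r).
  move=> gp gr x; have [dp pp] := gp x; have [dr pr] := gr x.
  have -> : peval (p + r) = (fun y => peval p y + peval r y).
    by apply/funext => y; rewrite pevalD.
  split; first exact: differentiableD.
  by move=> i; rewrite (partialD i dp dr) mderivD pevalD pp pr.
have gM p r : good p -> good r -> good (p * r).
  move=> gp gr x; have [dp pp] := gp x; have [dr pr] := gr x.
  have -> : peval (p * r) = (fun y => peval p y * peval r y).
    by apply/funext => y; rewrite pevalM.
  split; first exact: differentiableM.
  move=> i; rewrite (partialM i dp dr) mderivM pevalD (pevalM (mderiv i p)).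
  by rewrite (pevalM p) pp pr addrC [peval r x * _]mulrC.
have gU i : good (MX (mnm1 i)).
  have a x : mdiff (peval (MX (mnm1 i))) x (fun j => (i == j)%:R).
    move=> e e0; exists 1 => // v _; rewrite (bigD1 i)//= big1 ?eqxx ?addr0; last first.
      by move=> j ji; rewrite eq_sym (negbTE ji) mulr0.
    rewrite /peval !mevalXU mxE mulr1 [X in cmod X](_ : _ = 0); last by ring.
    by rewrite cmod0 mulr_ge0 ?nrm_ge0// ltW.
  move=> x; split; first exact: mdiff_differentiable (a x).
  move=> j; rewrite (mdiff_partialE (a x)) mderivX pevalZ pevalX mnm1E.
  case: eqP => [->|_]; last by rewrite mul0r.
  rewrite mul1r /monom big1// => l _; rewrite mnmBE subnn expr0//.
have gX m : good (MX m).
  rewrite mpolyXE_id; elim/big_ind : _ => [|p r|i _]; [|exact: gM|].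
    by rewrite -mpolyC1; exact: gC.
  elim: (m i) => [|k IH]; first by rewrite expr0 -mpolyC1; exact: gC.
  by rewrite exprS; exact: gM (gU i) IH.
apply: (_ : good q); elim/mpolyind : q => [|c m p _ _ gp].
  by rewrite -mpolyC0; exact: gC.
by apply: gD gp; rewrite -mul_mpolyC; exact: gM (gC c) (gX m).
Qed.

Lemma peval_holomorphic U q : holomorphic U (peval q).
Proof. by move=> z _; have [] := peval_differentiable q z. Qed.

Lemma partial_peval i q : partial i (peval q) = peval (mderiv i q).
Proof. by apply/funext => z; have [_] := peval_differentiable q z. Qed.

Lemma multi_partial_peval al q : multi_partial al (peval q) = peval (mderivm al q).
Proof.
rewrite /multi_partial /mderivm; elim: (enum 'I_n) => [//|i s].
move=> /=; move: (foldr _ _ s) (foldr _ _ s) => g p ->.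
by elim: (al i) => [//|k IH]; rewrite !iterS IH partial_peval.
Qed.

Lemma monom0 m : monom m 0 = (m == mnm0)%:R.
Proof.
rewrite /monom; case: eqP => [->|/eqP m0].
  by rewrite big1// => i _; rewrite mnm0E expr0.
have [i mi] : exists i, m i != 0%N.
  apply/existsP; apply: contraNT m0 => /existsPn H; apply/eqP/mnmP => i.
  by rewrite mnm0E; have := H i; rewrite negbK => /eqP.
by rewrite (bigD1 i)//= mxE expr0n (negbTE mi) mul0r.
Qed.

Lemma peval0 q : peval q 0 = mcoeff mnm0 q.
Proof.
rewrite pevalE; have [q0|q0] := boolP (mnm0 \in msupp q).
  rewrite (bigD1_seq _ q0 (msupp_uniq _))/= big1 => [|m m0].
    by rewrite monom0 eqxx mulr1 addr0.
  by rewrite monom0 (negbTE m0) mulr0.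
rewrite (memN_msupp_eq0 q0) big_seq big1// => m mq.
by rewrite monom0; case: eqP mq => [->|_]; rewrite ?(negbTE q0)// mulr0.
Qed.

Definition mfact al : Cx R := (\prod_(i < n) (al i)`!)%:R.

Lemma mfact_neq0 al : mfact al != 0.
Proof. by rewrite pnatr_eq0 -lt0n prodn_gt0// => i; rewrite fact_gt0. Qed.

Lemma multi_partial_peval0 al q :
  multi_partial al (peval q) 0 = mfact al * mcoeff al q.
Proof.
rewrite multi_partial_peval peval0 mcoeff_mderivm addm0 -mulr_natl; congr (_%:R * _).
by apply: eq_bigr => i _; rewrite ffactnn.
Qed.

Lemma ord_monom m : ord (monom m) (mdeg m).
Proof.
exists 1, 1; split=> // v _; rewrite mul1r /monom mdegE -prodrXr.
elim/big_ind2 : _ => [|x a y b xa yb|i _]; first by rewrite cmod1.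
  by rewrite cmodM ler_pM.
by rewrite cmodX lerXn2r ?nnegrE ?nrm_ge0 ?cmod_ge0 ?coord_le_nrm.
Qed.

Lemma ord_peval q k : (forall m, mcoeff m q != 0 -> (k <= mdeg m)%N) -> ord (peval q) k.
Proof.
move=> qk; have -> : peval q = fun z => \sum_(m <- msupp q)
    (if (k <= mdeg m)%N then mcoeff m q * monom m z else 0).
  apply/funext => z; rewrite pevalE big_seq [RHS]big_seq; apply: eq_bigr => m.
  by rewrite mcoeff_msupp => /qk ->.
apply: ord_sum => m; case: leqP => km; first exact: ordZ (ord_le km (ord_monom m)).
by exists 1, 0; split=> // v _; rewrite cmod0 mul0r.
Qed.

Let cder_rCX k (t : R) : cder (fun s => rC s ^+ k.+1) t (k.+1%:R * rC t ^+ k).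
Proof.
elim: k => [|k IH].
  apply: (@cder_ext _ rC); first by move=> s; rewrite expr1.
  by rewrite expr0 mulr1; exact: cder_rC.
apply: (@cder_ext _ (fun s => rC s * rC s ^+ k.+1)) => [s|]; first by rewrite [RHS]exprS.
have -> : k.+2%:R * rC t ^+ k.+1 = 1 * rC t ^+ k.+1 + rC t * (k.+1%:R * rC t ^+ k).
  by rewrite -[k.+2]addn1 natrD exprS; ring.
exact: cderM (cder_rC t) IH.
Qed.

Let cder_sum (I : Type) (s : seq I) (F : I -> R -> Cx R) (d : I -> Cx R) (t : R) :
  (forall i, cder (F i) t (d i)) ->
  cder (fun x => \sum_(i <- s) F i x) t (\sum_(i <- s) d i).
Proof.
move=> Fd; elim: s => [|i s IH].
  rewrite big_nil; apply: (cder_ext _ (cder_cst 0 t)) => x; by rewrite big_nil.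
rewrite big_cons; apply: (cder_ext _ (cderD (Fd i) IH)) => x; by rewrite big_cons.
Qed.

(* Multiplies each coefficient so that [t * peval (radial_primitive q) (t v)]
   is a primitive of [peval q (t v)] in [t]. *)
Definition radial_primitive q : mpoly n (Cx R) :=
  \sum_(m <- msupp q) (mcoeff m q / (mdeg m).+1%:R) *: MX m.

Lemma cder_radial q v (t : R) :
  cder (fun s => rC s * peval (radial_primitive q) (rC s *: v)) t
       (peval q (rC t *: v)).
Proof.
rewrite pevalE.
apply: (@cder_ext _ (fun s => \sum_(m <- msupp q)
   (mcoeff m q * monom m v / (mdeg m).+1%:R) * rC s ^+ (mdeg m).+1)).
  move=> s; rewrite peval_sum mulr_sumr; apply: eq_bigr => m _.
  by rewrite pevalZ pevalX monomZ exprS; ring.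
apply: cder_sum => m; rewrite monomZ.
have -> : mcoeff m q * (rC t ^+ mdeg m * monom m v) =
   (mcoeff m q * monom m v / (mdeg m).+1%:R) * ((mdeg m).+1%:R * rC t ^+ mdeg m).
  by field; rewrite addrC natr1 pnatr_eq0.
exact: cderZ.
Qed.

(** Induction through the gradient: if the partial derivatives agree with polynomials [p i] to order
    [k], integrating these along the segments from 0 gives a polynomial that agrees with [h] to
    order [k.+1]. *)
Lemma taylor_exists k U h : open U -> U 0 -> holomorphic U h ->
  exists p, ord (fun z => h z - peval p z) k.
Proof.
move=> oU U0; elim: k h => [|k IH] h hU.
  exists 0; have [r r0 hr] := differentiable_locally_bounded (hU 0 U0).
  exists r, (cmod (h 0) + 1); split; rewrite ?addr_ge0// => v /hr.
  by rewrite add0r expr0 mulr1 /peval meval0 subr0.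
have [p hp] := choice (fun i => IH _ (partial_holomorphic i oU hU)).
have [d [C [d0 C0 H]]] := ord_fin hp.
have [r r0 hr] := (openCnP U).1 oU 0 U0.
(* The formula h v = h 0 + the integral over [0, 1] of the sum of v_i (d_i h)(t v), with [p i] put
   in place of the partial derivatives. *)
pose P := mpolyC n (h 0) + \sum_i MX (mnm1 i) * radial_primitive (p i).
exists P, (Num.min d r), (2 * (n%:R * C)); split; rewrite ?mulr_ge0// ?lt_min ?d0//.
move=> v; rewrite lt_min => /andP[vd vr].
pose G (t : R) := h (rC t *: v) - \sum_i v 0 i *
  (rC t * peval (radial_primitive (p i)) (rC t *: v)).
pose dG (t : R) := \sum_i v 0 i * (partial i h (rC t *: v) - peval (p i) (rC t *: v)).
have tv (t : R) : 0 <= t <= 1 -> nrm (rC t *: v) <= nrm v.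
  move=> /andP[t0 t1]; rewrite nrmZ cmod_rC ger0_norm//.
  by rewrite ler_piMl// nrm_ge0.
have GdG (t : R) : 0 <= t <= 1 -> cder G t (dG t).
  move=> t01; have ht : differentiable h (0 + rC t *: v).
    by apply: hU; apply: hr; apply: le_lt_trans vr; exact: tv.
  have h1 : cder (fun s => h (rC s *: v)) t (\sum_i v 0 i * partial i h (rC t *: v)).
    have := differentiable_slice ht; rewrite add0r => hc.
    have := cder_comp hc (cder_rC t); rewrite mulr1; apply: cder_ext => s.
    by rewrite add0r.
  have h2 : cder (fun s => \sum_i v 0 i *
        (rC s * peval (radial_primitive (p i)) (rC s *: v))) t
      (\sum_i v 0 i * peval (p i) (rC t *: v)).
    by apply: cder_sum => i; apply: cderZ; exact: cder_radial.
  have -> : dG t = \sum_i v 0 i * partial i h (rC t *: v) +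
      (-1) * \sum_i v 0 i * peval (p i) (rC t *: v).
    rewrite mulN1r -sumrB; apply: eq_bigr => i _; ring.
  apply: (cder_ext _ (cderD h1 (cderZ (-1) h2))) => s.
  by rewrite mulN1r.
have dGb (t : R) : 0 <= t <= 1 -> cmod (dG t) <= n%:R * C * nrm v ^+ k.+1.
  move=> t01; apply: le_trans (cmod_sum _ _ _) _.
  apply: (@le_trans _ _ (\sum_(i < n) nrm v * (C * nrm v ^+ k))).
    apply: ler_sum => i _; rewrite cmodM ler_pM ?coord_le_nrm//.
    apply: le_trans (H i _ _) _; first exact: le_lt_trans (tv t t01) vd.
    by rewrite ler_wpM2l// lerXn2r ?nnegrE ?nrm_ge0// tv.
  rewrite sumr_const card_ord -mulr_natl exprS.
  by rewrite le_eqVlt; apply/orP; left; apply/eqP; ring.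
have := cder_bound ler01 GdG dGb.
have -> : G 1 - G 0 = h v - peval P v.
  rewrite /G !scale1r !rC0 !scale0r.
  rewrite [X in h 0 - X]big1 => [|i _]; last by rewrite mul0r mulr0.
  rewrite subr0 pevalD [peval (mpolyC _ _) _]mevalC peval_sum.
  rewrite opprD addrA addrAC; congr (_ - _ - _).
  by apply: eq_bigr => i _; rewrite pevalM [peval (MX _) _]mevalXU mul1r.
by rewrite subr0 mulr1 mulrA.
Qed.

(** [bmultinom n k] consists of the multi-indices of degree less than [k], so degree [k] itself is
    left out, in accordance with [ord _ k]. *)
Definition taylor_poly k h : mpoly n (Cx R) :=
  \sum_(m : bmultinom n k) (multi_partial m h 0 / mfact m) *: MX m.

Lemma mcoeff_taylor_poly k h al : mcoeff al (taylor_poly k h) =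
  if (mdeg al < k)%N then multi_partial al h 0 / mfact al else 0.
Proof.
rewrite /taylor_poly raddf_sum /=.
under eq_bigr do rewrite mcoeffZ mcoeffX.
case: ifPn => alk.
  rewrite (bigD1 (BMultinom alk))//= eqxx mulr1 big1 ?addr0// => m mal.
  case: eqP => [E|_]; last by rewrite mulr0.
  by case/negP: mal; apply/eqP/val_inj.
rewrite big1// => m _; case: eqP => [E|_]; last by rewrite mulr0.
by case/negP: alk; rewrite -E; case: m E.
Qed.

(** A polynomial that agrees with [h] to order [k] has the same derivatives at 0 in degrees below
    [k], hence differs from [taylor_poly k h] only by monomials of degree at least [k]. *)
Lemma ord_taylor_poly k U h : open U -> U 0 -> holomorphic U h ->
  ord (fun z => h z - peval (taylor_poly k h) z) k.
Proof.
move=> oU U0 hU; have [p hp] := taylor_exists k oU U0 hU.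
have E al : (mdeg al < k)%N -> multi_partial al h 0 = mfact al * mcoeff al p.
  move=> alk; have pU := @peval_holomorphic U p.
  have hpU : holomorphic U (fun z => h z - peval p z).
    by move=> z Uz; apply: differentiableB; [exact: hU|exact: pU].
  have := ord_multi_partial oU U0 hpU alk hp.
  rewrite (multi_partialB al oU hU pU); last by rewrite inE.
  by move/eqP; rewrite subr_eq0 => /eqP ->; exact: multi_partial_peval0.
have : ord (peval (p - taylor_poly k h)) k.
  apply: ord_peval => m; rewrite mcoeffB mcoeff_taylor_poly.
  case: ltnP => // mk; rewrite E// mulrC mulKf ?mfact_neq0// subrr eqxx//.
move=> /(ordD hp); apply: (@eq_ord _ _ _ _ _ 1) => // v _.
by rewrite pevalB; ring.
Qed.

End polynomials.

(** * The theorems of Vitali and of identity *)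

Section identity_theorem.
Context {R : realType} {n : nat}.
Implicit Types (z v w : Cn R n) (h g : Cn R n -> Cx R) (U : set (Cn R n)).

Lemma differentiable_coordinate (f : Cn R n -> Cn R n) z i :
  differentiable f z -> differentiable (fun w => f w 0 i) z.
Proof.
move=> fd; apply: (@differentiable_comp _ _ _ _ f (fun w : Cn R n => w 0 i)).
  exact: fd.
exact: differentiable_coord.
Qed.

Lemma ord_differentiable h : differentiable h 0 -> h 0 = 0 -> ord h 1.
Proof.
move=> /mdiff_partial hd h0; have [r r0 hr] := hd 1 ltr01.
exists r, (\sum_i cmod (partial i h 0) + 1); split; rewrite ?addr_ge0 ?sumr_ge0//.
move=> v /hr; rewrite add0r h0 subr0 expr1 mul1r => hv.
rewrite -(subrK (\sum_i v 0 i * partial i h 0) (h v)) mulrDl mul1r addrC.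
apply: le_trans (cmodD _ _) _; apply: lerD => //.
by rewrite [leRHS]mulrC; exact: cmod_lin.
Qed.

Lemma ord_comp h (f : Cn R n -> Cn R n) k : differentiable f 0 -> f 0 = 0 ->
  ord h k -> ord (fun v => h (f v)) k.
Proof.
move=> fd f0 [d [C [d0 C0 hC]]].
have [|e [B [e0 B0 fB]]] := @ord_fin R n _ (fun i v => f v 0 i) 1.
  move=> i; apply: ord_differentiable; first exact: differentiable_coordinate.
  by rewrite f0 mxE.
have B1 : 0 < B + 1 by rewrite ltr_wpDl.
have fL v : nrm v < e -> nrm (f v) <= (B + 1) * nrm v.
  move=> ve; apply: nrm_le; first by rewrite mulr_ge0 ?nrm_ge0// ltW.
  move=> i; apply: le_trans (fB i v ve) _; rewrite expr1 ler_wpM2r ?nrm_ge0//.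
  by rewrite lerDl.
exists (Num.min e (d / (B + 1))), (C * (B + 1) ^+ k); split.
- by rewrite lt_min e0 divr_gt0.
- by rewrite mulr_ge0// exprn_ge0// ltW.
- move=> v; rewrite lt_min => /andP[ve]; rewrite ltr_pdivlMr// mulrC => vd.
  apply: le_trans (hC _ (le_lt_trans (fL v ve) vd)) _.
  rewrite -mulrA -exprMn ler_wpM2l// lerXn2r ?nnegrE ?nrm_ge0 ?fL//.
  by rewrite mulr_ge0 ?nrm_ge0// ltW.
Qed.

(** Strong induction on the index: when the earlier coefficients vanish, [b j] times the [j]-th
    power is bounded by the next power, so [b j] is arbitrarily small. Uniqueness of Taylor
    coefficients rests on this. *)
Lemma power_sum_eq0 (b : nat -> Cx R) N : (forall k, (k <= N)%N -> exists d K : R, 0 < d /\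
    forall l, cmod l <= d -> cmod (\sum_(j < k.+1) b j * l ^+ j) <= K * cmod l ^+ k.+1) ->
  forall j, (j <= N)%N -> b j = 0.
Proof.
move=> H j; elim/ltn_ind: j => j IH jN.
have [d [K [d0 hK]]] := H j jN; apply/eqP; rewrite -cmod_eq0 eq_le cmod_ge0 andbT.
apply/ler_addgt0Pr => e e0; rewrite add0r.
have K0 : 0 < `|K| + 1 by rewrite ltr_wpDl.
pose t := Num.min d (e / (`|K| + 1)).
have t0 : 0 < t by rewrite lt_min d0 divr_gt0.
have tt : cmod (rC t) = t by rewrite cmod_rC gtr0_norm.
have := hK (rC t); rewrite tt ge_min lexx => /(_ isT).
rewrite big_ord_recr big1 /= => [|i _].
  2: by rewrite IH ?mul0r// (leq_trans (ltnW (ltn_ord i)) jN).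
rewrite add0r cmodM cmodX tt exprS mulrA ler_pM2r ?exprn_gt0//.
move=> /le_trans; apply; apply: (@le_trans _ _ (`|K| * (e / (`|K| + 1)))).
  apply: (@le_trans _ _ (`|K| * t)); first by rewrite ler_wpM2r ?ler_norm// ltW.
  by rewrite ler_wpM2l// ge_min lexx orbT.
by apply: ler_succ_div => //; exact: ltW.
Qed.

Lemma taylor_coef_unique (phi : Cx R -> Cx R) (c c' : nat -> Cx R) (r s M N : R) :
  0 < r -> 0 < s ->
  (forall k l, cmod l <= r / 2 ->
    cmod (phi l - \sum_(j < k.+1) c j * l ^+ j) <= M * (cmod l / r) ^+ k.+1) ->
  (forall k l, cmod l <= s / 2 ->
    cmod (phi l - \sum_(j < k.+1) c' j * l ^+ j) <= N * (cmod l / s) ^+ k.+1) ->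
  c =1 c'.
Proof.
move=> r0 s0 H H' j; apply/eqP; rewrite -subr_eq0; apply/eqP.
apply: (@power_sum_eq0 (fun j => c j - c' j) j) => // k _.
exists (Num.min (r / 2) (s / 2)), (M / r ^+ k.+1 + N / s ^+ k.+1).
split=> [|l]; first by rewrite lt_min !divr_gt0.
rewrite le_min => /andP[/(H k) h1 /(H' k) h2].
have -> : \sum_(i < k.+1) (c i - c' i) * l ^+ i =
    (phi l - \sum_(i < k.+1) c' i * l ^+ i) - (phi l - \sum_(i < k.+1) c i * l ^+ i).
  under eq_bigr do rewrite mulrBl.
  by rewrite sumrB; ring.
apply: le_trans (cmodB _ _) _; rewrite addrC; apply: le_trans (lerD h1 h2) _.
by rewrite !expr_div_n mulrDl le_eqVlt; apply/orP; left; apply/eqP; ring.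
Qed.

Lemma geometric_small (M e : R) : 0 <= M -> 0 < e ->
  exists k, 8 * M * (1 / 2) ^+ k.+1 <= e.
Proof.
move=> M0 e0; exists (Num.bound (8 * M / e)).
rewrite expr_div_n expr1n mulrA mulr1 ler_pdivrMr ?exprn_gt0// [e * _]mulrC -ler_pdivrMr//.
have := archi_boundP (divr_ge0 (mulr_ge0 (ler0n _ 8) M0) (ltW e0)).
move=> /ltW/le_trans; apply; rewrite -natrX ler_nat.
by apply: ltnW; apply: leq_trans (ltn_expl _ (leqnn 2)) _; rewrite leq_exp2l.
Qed.

(** Each value is read off the Taylor expansion along a line through [z]. The uniform bound [M] on
    the large ball makes the tail small for one fixed number of terms; Cauchy's estimate on the
    small ball makes those finitely many terms small. *)
Lemma small_propagates (h_ : nat -> Cn R n -> Cx R) z (r s M : R) :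
  0 < r -> 0 < s -> s < 2 * r ->
  (forall N v, nrm v < 2 * r -> differentiable (h_ N) (z + v)) ->
  (forall N v, nrm v < 2 * r -> cmod (h_ N (z + v)) <= M) ->
  (forall e : R, 0 < e -> exists N0, forall N, (N0 <= N)%N ->
     forall v, nrm v < s -> cmod (h_ N (z + v)) <= e) ->
  forall e : R, 0 < e -> exists N0, forall N, (N0 <= N)%N ->
     forall v, nrm v <= r / 2 -> cmod (h_ N (z + v)) <= e.
Proof.
move=> r0 s0 sr hd hM hs e e0.
have M0 : 0 <= M.
  apply: le_trans (hM 0%N 0 _); [exact: cmod_ge0|by rewrite nrm0 mulr_gt0].
have e20 : 0 < e / 2 by rewrite divr_gt0.
have [k hk] := geometric_small M0 e20.
pose s' := s / 2; have s'0 : 0 < s' by rewrite divr_gt0.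
(* The first [k.+1] terms, at distance [r / 2], add up to at most [S] times the supremum on the ball
   of radius [s]. *)
pose S := \sum_(j < k.+1) 2 / s' ^+ j * (r / 2) ^+ j.
have S0 : 0 <= S.
  apply: sumr_ge0 => j _; apply: mulr_ge0; last by rewrite exprn_ge0// divr_ge0// ltW.
  by rewrite divr_ge0// exprn_ge0// ltW.
have S1 : 0 < S + 1 by rewrite ltr_wpDl.
have [N0 hN0] := hs _ (divr_gt0 e20 S1).
exists N0 => N NN v vr.
have r20 : 0 < r / 2 by rewrite divr_gt0.
have [l [u [u1 lr ->]]] : exists (l : Cx R) (u : Cn R n),
    [/\ nrm u <= 1, cmod l <= r / 2 & v = l *: u].
  exists (rC (r / 2)), (rC (r / 2)^-1 *: v); split.
  - by rewrite nrmZ cmod_rC gtr0_norm ?invr_gt0// mulrC ler_pdivrMr// mul1r.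
  - by rewrite cmod_rC gtr0_norm.
  - by rewrite scalerA -rCM mulfV ?lt0r_neq0// scale1r.
have [c [cM ct]] := slice_taylor r0 u1 (hd N) (hM N).
have ss : s = 2 * s' by rewrite /s' mulrC divfK.
have [||c' [cM' ct']] := @slice_taylor _ _ (h_ N) z u s' (e / 2 / (S + 1)) s'0 u1.
- by move=> w; rewrite -ss => ws; apply: hd; exact: lt_trans sr.
- by move=> w; rewrite -ss => ws; exact: hN0.
have cc := taylor_coef_unique r0 s'0 ct ct'.
rewrite -(subrK (\sum_(j < k.+1) c j * l ^+ j) (h_ N _)) (splitr e).
apply: le_trans (cmodD _ _) _; apply: lerD.
  apply: le_trans (ct k l lr) _; apply: le_trans hk.
  rewrite ler_wpM2l ?mulr_ge0// lerXn2r ?nnegrE ?divr_ge0 ?cmod_ge0 ?(ltW r0)//.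
  by rewrite ler_pdivrMr// mulrAC mul1r.
apply: le_trans (cmod_sum _ _ _) _.
apply: (@le_trans _ _ (S * (e / 2 / (S + 1)))); last first.
  by apply: ler_succ_div => //; exact: ltW.
rewrite /S mulr_suml; apply: ler_sum => j _; rewrite cmodM cmodX mulrAC.
apply: ler_pM => //; first by rewrite exprn_ge0.
  by rewrite cc; apply: le_trans (cM' j) _; rewrite le_eqVlt; apply/orP; left; apply/eqP; ring.
by rewrite lerXn2r ?nnegrE// ltW.
Qed.

(** The points near which the convergence to 0 is uniform form an open set, which is closed in [U]
    by [small_propagates]; it contains 0, and [U] is connected. *)
Lemma vitali U (h_ : nat -> Cn R n -> Cx R) : open U -> connected U -> U 0 ->
  (forall N, holomorphic U (h_ N)) ->
  (forall z, U z -> exists d M : R, 0 < d /\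
     forall N v, nrm v < d -> cmod (h_ N (z + v)) <= M) ->
  (exists2 d : R, 0 < d & forall e : R, 0 < e -> exists N0, forall N, (N0 <= N)%N ->
     forall v, nrm v < d -> cmod (h_ N v) <= e) ->
  forall z, U z -> forall e : R, 0 < e ->
    exists N0, forall N, (N0 <= N)%N -> cmod (h_ N z) <= e.
Proof.
move=> oU cU U0 hU hb [d0 d00 h0].
pose near0 z (d : R) := forall e : R, 0 < e -> exists N0, forall N, (N0 <= N)%N ->
     forall v, nrm v < d -> cmod (h_ N (z + v)) <= e.
pose Z := [set z | U z /\ exists2 d : R, 0 < d & near0 z d].
have oZ : open Z.
  apply/openCnP => z [Uz [d d_0 zd]]; have [r r0 hr] := (openCnP U).1 oU z Uz.
  exists (Num.min r (d / 2)); first by rewrite lt_min r0 divr_gt0.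
  move=> v; rewrite lt_min => /andP[vr vd]; split; first exact: hr.
  exists (d / 2); first by rewrite divr_gt0.
  move=> e e0; have [N0 hN] := zd e e0; exists N0 => N NN w wd.
  by rewrite -addrA; apply: hN => //; apply: le_lt_trans (nrmD _ _) _; lra.
suff ZU : Z = U.
  move=> z Uz e e0; have [_ [d d_0 /(_ e e0)[N0 hN]]] : Z z by rewrite ZU.
  by exists N0 => N NN; rewrite -[z]addr0; apply: hN => //; rewrite nrm0.
apply: cU.
- exists 0; split=> //; exists d0 => // e e0; have [N0 hN] := h0 e e0.
  by exists N0 => N NN v vd; rewrite add0r; exact: hN.
- by exists Z => //; apply/seteqP; split=> z; [case=> Uz ?; split|case].
- exists (closure Z); first exact: closed_closure.
  apply/seteqP; split=> z; first by move=> Zz; split; [case: Zz|exact: subset_closure].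
  move=> [Uz clz]; split=> //.
  have [r1 r10 hr1] := (openCnP U).1 oU z Uz.
  have [r2 [M [r20 hM]]] := hb z Uz.
  pose d := Num.min r1 r2; have d_0 : 0 < d by rewrite lt_min r10.
  (* With [r = d / 4], smallness around [z'] spreads to radius [r / 2 = d / 8], which covers the
     ball of radius [d / 16] around [z], while the ball of radius [2 * r] around [z'] stays within
     [d] of [z]. *)
  have [z' [[Uz' [s s0 hs]] z'z]] : Z `&` [set w | nrm (w - z) < d / 16] !=set0.
    apply: clz; apply/nbhs_CnP; exists (d / 16) => [|v vd]; first by rewrite divr_gt0.
    by rewrite /= addrC addKr.
  rewrite /= in z'z.
  pose r := d / 4; have r0 : 0 < r by rewrite divr_gt0.
  have zz' v : nrm v < 2 * r -> nrm (z' - z + v) < d.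
    by move=> vr; apply: le_lt_trans (nrmD _ _) _; rewrite /r in vr; lra.
  have zE v : z' + v = z + (z' - z + v) by rewrite addrA subrKC.
  pose s' := Num.min s r; have s'0 : 0 < s' by rewrite lt_min s0.
  exists (r / 4) => [|e e0]; first by rewrite divr_gt0.
  have [||||N0 hN] := @small_propagates h_ z' r s' M r0 s'0 _ _ _ _ e e0.
  - have : s' <= r by rewrite ge_min lexx orbT.
    lra.
  - move=> N v /zz' vd; rewrite zE; apply: hU; apply: hr1.
    by apply: lt_le_trans vd _; rewrite ge_min lexx.
  - move=> N v /zz' vd; rewrite zE; apply: hM.
    by apply: lt_le_trans vd _; rewrite ge_min lexx orbT.
  - move=> e' e'0; have [N0 hN] := hs e' e'0; exists N0 => N NN v vs; apply: hN => //.
    by apply: lt_le_trans vs _; rewrite ge_min lexx.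
  exists N0 => N NN v vr.
  have -> : z + v = z' + (z - z' + v) by rewrite addrA subrKC.
  apply: hN => //; apply: le_trans (nrmD _ _) _; rewrite nrm_distC /r.
  rewrite /r in vr; lra.
Qed.

(** On each line through 0 the Taylor coefficients up to index [k] vanish, and the remainder alone
    is left. The bound depends on [h] only through [M], as is needed for sequences of averages whose
    order tends to infinity. *)
Lemma ord_decay h (r M : R) k v : 0 < r ->
  (forall w, nrm w < 2 * r -> differentiable h w) ->
  (forall w, nrm w < 2 * r -> cmod (h w) <= M) -> ord h k.+1 -> nrm v < r / 2 ->
  cmod (h v) <= 8 * M * (1 / 2) ^+ k.+1.
Proof.
move=> r0 hd' hM' hk vr; have r20' : 0 < r / 2 by rewrite divr_gt0.
have hd w : nrm w < 2 * r -> differentiable h (0 + w) by rewrite add0r; exact: hd'.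
have hM w : nrm w < 2 * r -> cmod (h (0 + w)) <= M by rewrite add0r; exact: hM'.
pose l := rC (r / 2); pose u := rC (r / 2)^-1 *: v.
have vE : v = l *: u by rewrite scalerA -rCM mulfV ?lt0r_neq0// scale1r.
have lr : cmod l = r / 2 by rewrite cmod_rC gtr0_norm.
have u1 : nrm u <= 1.
  by rewrite nrmZ cmod_rC gtr0_norm ?invr_gt0// mulrC ler_pdivrMr// mul1r ltW.
have [c [cM ct]] := slice_taylor r0 u1 hd hM.
have c0 : forall j, (j <= k)%N -> c j = 0.
  apply: power_sum_eq0 => i ik; have [d [C [d0 C0 hC]]] := ord_le (ik : (i.+1 <= k.+1)%N) hk.
  exists (Num.min (r / 2) (d / 2)), (8 * M / r ^+ i.+1 + C).
  split=> [|x]; first by rewrite lt_min r20' divr_gt0.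
  rewrite le_min => /andP[xr xd].
  rewrite -[X in cmod X](subKr (h (0 + x *: u))) .
  apply: le_trans (cmodB _ _) _; rewrite mulrDl addrC; apply: lerD.
    by apply: le_trans (ct i x xr) _; rewrite expr_div_n mulrA mulrAC.
  have xu : nrm (x *: u) <= cmod x by rewrite nrmZ ler_piMr.
  rewrite add0r; apply: le_trans (hC _ _) _; first by apply: le_lt_trans xu _; lra.
  by rewrite ler_wpM2l// lerXn2r ?nnegrE ?nrm_ge0.
have := ct k l; rewrite lr lexx => /(_ isT).
rewrite add0r -vE big1 ?subr0 => [|j _]; last by rewrite c0 ?mul0r// -ltnS.
by rewrite (_ : r / 2 / r = 1 / 2)//; field; rewrite lt0r_neq0.
Qed.

(** Letting [k] grow in [ord_decay] gives [h = 0] near 0, and [vitali] for the constant sequence [h]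
    carries this to all of [U]. *)
Lemma identity_theorem U h : open U -> connected U -> U 0 -> holomorphic U h ->
  (forall k, ord h k) -> forall z, U z -> h z = 0.
Proof.
move=> oU cU U0 hU hk.
have [r1 r10 hr1] := (openCnP U).1 oU 0 U0.
have [r2 r20 hr2] := differentiable_locally_bounded (hU 0 U0).
pose r := Num.min r1 r2 / 2; have r0 : 0 < r by rewrite divr_gt0// lt_min r10.
pose M := cmod (h 0) + 1; have M0 : 0 <= M by rewrite addr_ge0.
have r2E : 2 * r = Num.min r1 r2 by rewrite /r mulrC divfK.
have hd w : nrm w < 2 * r -> differentiable h w.
  by rewrite r2E lt_min => /andP[w1 _]; apply: hU; rewrite -[w]add0r; exact: hr1.
have hM w : nrm w < 2 * r -> cmod (h w) <= M.
  by rewrite r2E lt_min => /andP[_ w2]; rewrite -[w]add0r; exact: hr2.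
have h0 v : nrm v < r / 2 -> h v = 0.
  move=> vr; apply/eqP; rewrite -cmod_eq0 eq_le cmod_ge0 andbT.
  apply/ler_addgt0Pr => e e0; rewrite add0r; have [k hk'] := geometric_small M0 e0.
  exact: le_trans (ord_decay r0 hd hM (hk _) vr) hk'.
move=> z Uz; apply/eqP; rewrite -cmod_eq0 eq_le cmod_ge0 andbT.
apply/ler_addgt0Pr => e e0; rewrite add0r.
have [] := @vitali U (fun _ => h) oU cU U0 (fun _ => hU) _ _ z Uz e e0.
- move=> w Uw; have [d d0 hw] := differentiable_locally_bounded (hU w Uw).
  by exists d, (cmod (h w) + 1); split.
- exists (r / 2) => [|e' e'0]; first by rewrite divr_gt0.
  by exists 0%N => _ _ v /h0 ->; rewrite cmod0 ltW.
- by move=> N0 /(_ N0 (leqnn _)).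
Qed.

End identity_theorem.

(** * Lebesgue measure on real tuples: translations and boxes *)

Section tuple_measure.
Context {R : realType}.
Local Notation L := (measurableTypeR R).
Local Notation pp N := (product_power (@lebesgue_measure R) N).

Definition tadd N (s t : N.-tuple L) : N.-tuple L :=
  [tuple (tnth s i + tnth t i : R) | i < N].
Definition topp N (t : N.-tuple L) : N.-tuple L := [tuple (- tnth t i : R) | i < N].

Lemma tnth_tadd N (s t : N.-tuple L) i : tnth (tadd s t) i = tnth s i + tnth t i :> R.
Proof. by rewrite tnth_mktuple. Qed.

Lemma tnth_topp N (t : N.-tuple L) i : tnth (topp t) i = - tnth t i :> R.
Proof. by rewrite tnth_mktuple. Qed.

Lemma measurable_mktuple d (X : measurableType d) N (F : 'I_N -> X -> L) :
  (forall i, measurable_fun setT (F i)) ->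
  measurable_fun setT (fun x => [tuple F i x | i < N]).
Proof.
move=> mF; apply/measurable_fun_tnthP => i.
rewrite (_ : _ \o _ = F i)//; apply/funext => x /=; by rewrite tnth_mktuple.
Qed.

Lemma measurable_coord d (X : measurableType d) N (f : X -> N.-tuple L) i :
  measurable_fun setT f -> measurable_fun setT (fun x => tnth (f x) i : L).
Proof. by move=> mf; apply: (measurableT_comp (measurable_tnth i) mf). Qed.

Lemma measurable_tadd d (X : measurableType d) N (f g : X -> N.-tuple L) :
  measurable_fun setT f -> measurable_fun setT g ->
  measurable_fun setT (fun x => tadd (f x) (g x)).
Proof.
move=> mf mg; apply: measurable_mktuple => i.
by apply: measurable_funD; exact: measurable_coord.
Qed.

Lemma measurable_topp d (X : measurableType d) N (f : X -> N.-tuple L) :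
  measurable_fun setT f -> measurable_fun setT (fun x => topp (f x)).
Proof.
move=> mf; apply: measurable_mktuple => i.
by apply: measurableT_comp; [exact: oppr_measurable|exact: measurable_coord].
Qed.

Lemma preimage_measurable d d' (X : measurableType d) (Y : measurableType d')
  (f : X -> Y) (A : set Y) : measurable_fun setT f -> measurable A ->
  measurable (f @^-1` A).
Proof. by move=> mf mA; rewrite -[X in measurable X]setTI; exact: mf. Qed.

Lemma lebesgue_shift (c : R) (A : set L) : measurable A ->
  lebesgue_measure [set x : L | A (x + c : R)] = lebesgue_measure A.
Proof.
have ms : measurable_fun setT (fun x : L => (x + c : R) : L).
  by apply: measurable_funD => //.
move=> mA; rewrite [RHS](@lebesgue_measure_unique R
  (pushforward (@lebesgue_measure R) (fun x : L => (x + c : R) : L)))//.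
move=> _ [[a b]] _ <- /=.
rewrite /pushforward (_ : _ @^-1` _ = `](a - c), (b - c)]%classic); last first.
  by apply/seteqP; split=> x /=; rewrite !in_itv/= ltrBlDr lerBrDr.
rewrite !lebesgue_measure_itv/= !lte_fin ltrD2r.
by case: ifP => // _; rewrite !EFinB; congr (_%:E); ring.
Qed.

Lemma product_power_cons N (A : set (N.+1.-tuple L)) : pp N.+1 A =
  (\int[@lebesgue_measure R]_x pp N (xsection (@tcons _ _ N @^-1` A) x))%E.
Proof. by []. Qed.

Lemma lebesgue_integral_shift (c : R) (g : L -> \bar R) : measurable_fun setT g ->
  (forall x, 0 <= g x)%E ->
  (\int[@lebesgue_measure R]_x g ((x : R) + c)%R = \int[@lebesgue_measure R]_x g x)%E.
Proof.
move=> mg g0.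
have ms : measurable_fun setT (fun x : L => (x + c : R) : L).
  by apply: measurable_funD => //.
transitivity (\int[pushforward (@lebesgue_measure R)
    (fun x : L => ((x : R) + c)%R : L)]_x g x)%E.
  by rewrite ge0_integral_pushforward// preimage_setT.
apply: eq_measure_integral => A mA _; exact: lebesgue_shift.
Qed.

Lemma product_power_shift N (c : N.-tuple L) (A : set (N.-tuple L)) :
  measurable A -> pp N [set t | A (tadd t c)] = pp N A.
Proof.
elim: N c A => [|N IH] c A mA.
  have E t : tadd t c = t by apply: eq_from_tnth => -[].
  by congr (pp 0 _); apply/seteqP; split=> t /=; rewrite E.
have mA' := preimage_measurable (@measurable_tcons _ _ N) mA.
rewrite !product_power_cons.
rewrite -[RHS](lebesgue_integral_shift (thead c)) => [| |x]; last exact: measure_ge0.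
  apply: eq_integral => x _.
  rewrite -[RHS](IH [tuple of behead c]); last exact: (measurable_xsection _ mA').
  congr (pp N _); apply/funext => t; rewrite /xsection /= !in_setE /=.
  suff -> : tadd (tcons (x, t)) c =
    tcons (((x : R) + thead c)%R : L, tadd t [tuple of behead c]) by [].
  apply: eq_from_tnth => i; rewrite tnth_tadd.
  have [j ->|->] := unliftP ord0 i; last by rewrite !tnth0.
  rewrite !tnthS /= tnth_tadd tnth_behead; congr (_ + tnth c _).
  by apply/val_inj; rewrite /= inordK ?lift0 ?ltnS.
exact: measurable_fun_xsection.
Qed.

(** Half-open, so that the dyadic boxes of a given level partition the space. *)
Definition box N (a b : 'I_N -> R) : set (N.-tuple L) :=
  [set t | forall i, a i <= (tnth t i : R) < b i].

Lemma measurable_box N (a b : 'I_N -> R) : measurable (box a b).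
Proof.
rewrite (_ : box a b = \bigcap_(i in [set: 'I_N]) [set t | `[a i, b i[%classic (tnth t i : R)]).
  apply: fin_bigcap_measurable => [|i _]; first exact: finite_finset.
  by apply: (preimage_measurable (measurable_tnth i)); exact: measurable_itv.
apply/seteqP; split=> t /= H i; last by have := H i Logic.I; rewrite /= in_itv.
by move=> _; rewrite /= in_itv/=; exact: H.
Qed.

Lemma measure_box N (a b : 'I_N -> R) : (forall i, a i <= b i) ->
  pp N (box a b) = (\prod_i (b i - a i))%:E.
Proof.
elim: N a b => [|N IH] a b ab.
  rewrite big_ord0 /= (_ : box a b = setT) ?diracT//.
  by apply/seteqP; split=> // t _ [].
rewrite product_power_cons.
pose a' i := a (lift ord0 i); pose b' i := b (lift ord0 i).
rewrite (eq_integral (fun x : L => (\1_(`[a ord0, b ord0[%classic : set L) x)%:E * pp N (box a' b'))%E).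
  rewrite ge0_integralZr//; last exact/measurable_EFinP/measurable_indic.
  have E : lebesgue_measure (`[a ord0, b ord0[%classic : set L) = (b ord0 - a ord0)%:E.
    rewrite [LHS](lebesgue_measure_itv `[a ord0, b ord0[) /= lte_fin; case: ltP => // ba.
    by rewrite (_ : b ord0 = a ord0) ?subrr//; apply/eqP; rewrite eq_le ba ab.
  rewrite integral_indic// setIT IH => [|i]; last exact: ab.
  by rewrite big_ord_recl EFinM -E.
move=> x _; rewrite indicE; have [xab|xab] := boolP (x \in _).
  rewrite mul1e; congr (pp N _); apply/seteqP; split=> t; rewrite /xsection/= inE /=.
    by move=> H i; have := H (lift ord0 i); rewrite tnthS.
  move=> H i; have [j ->|->] := unliftP ord0 i; first by rewrite tnthS; exact: H.
  by rewrite tnth0; move: xab; rewrite inE /= in_itv.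
rewrite mul0e (_ : xsection _ _ = set0) ?measure0//; apply/seteqP; split=> // t.
rewrite /xsection/= inE /= => /(_ ord0); rewrite tnth0 => xab'.
by move/negP: xab; apply; rewrite inE /= in_itv.
Qed.

End tuple_measure.

(** * Uniqueness of Haar measure *)

Section haar.
Context {R : realType} {N : nat}.
Local Notation L := (measurableTypeR R).
Local Notation T := (N.-tuple L).
Local Notation mu := (product_power (@lebesgue_measure R) N).
Local Open Scope ereal_scope.

Lemma sections_swap (E : set (T * T)) : measurable E ->
  \int[mu]_x mu (xsection E x) = \int[mu]_y mu (ysection E y).
Proof.
move=> mE; rewrite -[LHS]/((mu \x mu) E) -[RHS]/((mu \x^ mu) E).
by apply: product_measure_unique => //= A B mA mB; rewrite product_measure2E.
Qed.

(* Both sides are the measure of [{(x, y) | A x /\ B (phi y + x)}], computed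
   by integrating over the first or over the second variable. *)
Lemma haar_swap (phi psi : T -> T) (A B : set T) :
  measurable_fun setT phi ->
  (forall x y, phi (tadd y (psi x)) = tadd (phi y) x) ->
  measurable A -> measurable B ->
  mu A * mu (phi @^-1` B) = mu [set y | A (topp (phi y))] * mu B.
Proof.
move=> mphi phiD mA mB.
have mfst : measurable_fun setT (@fst T T) by exact: measurable_fst.
have msnd : measurable_fun setT (@snd T T) by exact: measurable_snd.
have mphis : measurable_fun setT (fun p : T * T => phi p.2).
  exact: measurableT_comp mphi msnd.
pose E := [set p : T * T | A p.1 /\ B (tadd (phi p.2) p.1)].
have mE : measurable E.
  apply: measurableI; first exact: (preimage_measurable mfst).
  exact: (preimage_measurable (measurable_tadd mphis mfst)).
(* [E] with its section at each [y] translated by [phi y], which changes no section measure and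
   frees [B] from [phi]. *)
pose E' := [set p : T * T | A (tadd p.1 (topp (phi p.2))) /\ B p.1].
have mE' : measurable E'.
  apply: measurableI; last exact: (preimage_measurable mfst).
  exact: (preimage_measurable (measurable_tadd mfst (measurable_topp mphis))).
have mphiB := preimage_measurable mphi mB.
have mphiA : measurable [set y | A (topp (phi y))].
  by apply: (preimage_measurable (measurable_topp mphi)).
transitivity (\int[mu]_x mu (xsection E x)).
  rewrite (eq_integral (fun x => (\1_A x)%:E * mu (phi @^-1` B))).
    rewrite ge0_integralZr//; last exact/measurable_EFinP/measurable_indic.
    by rewrite integral_indic// setIT.
  move=> x _; rewrite indicE; have [xA|xA] := boolP (x \in A).
    (* Translating [y] by [psi x] translates [phi y] by [x]: the section over any [x] in [A] has the
       measure of the preimage of [B]. *)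
    rewrite mul1e -(product_power_shift (psi x) mphiB); congr (mu _).
    apply/seteqP; split=> y; rewrite /xsection/= !inE /= phiD; first by case.
    by move=> ?; split=> //; rewrite inE in xA.
  rewrite mul0e (_ : xsection _ _ = set0) ?measure0//; apply/seteqP; split=> // y.
  by rewrite /xsection/= inE /= => -[xA' _]; move/negP: xA; apply; rewrite inE.
rewrite sections_swap//.
transitivity (\int[mu]_y mu (ysection E' y)).
  apply: eq_integral => y _.
  rewrite -(product_power_shift (phi y) (measurable_ysection y mE')); congr (mu _).
  apply/seteqP; split=> x; rewrite /ysection /E /E' /= !inE /=.
    have -> : tadd (tadd x (phi y)) (topp (phi y)) = x.
      by apply: eq_from_tnth => i; rewrite !tnth_tadd tnth_topp addrK.
    have -> : tadd x (phi y) = tadd (phi y) x.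
      by apply: eq_from_tnth => i; rewrite !tnth_tadd addrC.
    by case.
  have -> : tadd (tadd x (phi y)) (topp (phi y)) = x.
    by apply: eq_from_tnth => i; rewrite !tnth_tadd tnth_topp addrK.
  have -> : tadd x (phi y) = tadd (phi y) x.
    by apply: eq_from_tnth => i; rewrite !tnth_tadd addrC.
  by case.
rewrite -sections_swap//.
rewrite (eq_integral (fun x => mu [set y | A (topp (phi y))] * (\1_B x)%:E)).
  rewrite ge0_integralZl//; last exact/measurable_EFinP/measurable_indic.
  by rewrite integral_indic// setIT.
move=> x _; rewrite indicE; have [xB|xB] := boolP (x \in B); last first.
  rewrite mule0 (_ : xsection _ _ = set0) ?measure0//; apply/seteqP; split=> // y.
  by rewrite /xsection/= inE /= => -[_ xB']; move/negP: xB; apply; rewrite inE.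
rewrite mule1 -(product_power_shift (psi x) (measurable_xsection x mE')); congr (mu _).
have H y : tadd x (topp (phi (tadd y (psi x)))) = topp (phi y).
  rewrite phiD; apply: eq_from_tnth => i.
  by rewrite tnth_tadd !tnth_topp tnth_tadd; ring.
apply/seteqP; split=> y; rewrite /xsection /E' /= !inE /= H; first by case.
by move=> ?; split=> //; rewrite inE in xB.
Qed.

End haar.

(** * Dyadic cubes and measurability on the complex space *)

Section identification.
Context {R : realType} {n : nat}.
Local Notation L := (measurableTypeR R).
Local Notation T := ((n + n).-tuple L).
Local Notation mu := (lebesgue_Cn R n).
Local Notation vec := (@vec_of_tuple R n).
Implicit Types (z w : Cn R n) (t s : T) (S D : set (Cn R n)).

Definition tuple_of_vec z : T :=
  [tuple (match fintype.split k with inl i => complex.Re (z 0 i) | inr i => complex.Im (z 0 i) end : L)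
  | k < n + n].

Lemma tnth_tovl z i : tnth (tuple_of_vec z) (lshift n i) = complex.Re (z 0 i).
Proof. by rewrite tnth_mktuple; have := unsplitK (inl i : 'I_n + 'I_n) => /= ->. Qed.

Lemma tnth_tovr z i : tnth (tuple_of_vec z) (rshift n i) = complex.Im (z 0 i).
Proof. by rewrite tnth_mktuple; have := unsplitK (inr i : 'I_n + 'I_n) => /= ->. Qed.

Lemma vecE t i : vec t 0 i = CC (tnth t (lshift n i)) (tnth t (rshift n i)).
Proof. by rewrite mxE. Qed.

Lemma tuple_of_vecK z : vec (tuple_of_vec z) = z.
Proof. by apply/rowP => i; rewrite vecE tnth_tovl tnth_tovr; exact: eqCx. Qed.

Lemma vec_of_tupleK t : tuple_of_vec (vec t) = t.
Proof.
apply: eq_from_tnth => k; rewrite -(splitK k); case: (fintype.split k) => i /=.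
  by rewrite tnth_tovl vecE.
by rewrite tnth_tovr vecE.
Qed.

Lemma vec_tadd s t : vec (tadd s t) = vec s + vec t.
Proof. by apply/rowP => i; rewrite !mxE !tnth_tadd; exact: eqCx. Qed.

Lemma vec_topp t : vec (topp t) = - vec t.
Proof. by apply/rowP => i; rewrite !mxE !tnth_topp; exact: eqCx. Qed.

Lemma nrm_vec t (e : R) : 0 <= e -> (forall k, `|tnth t k : R| <= e) -> nrm (vec t) <= 2 * e.
Proof.
move=> e0 te; apply: nrm_le; first exact: mulr_ge0.
move=> i; apply: le_trans (cmod_le_ReIm _) _; rewrite vecE /= mulr2n mulrDl mul1r.
by apply: lerD; exact: te.
Qed.

Lemma tnth_le_nrm t k : `|tnth t k : R| <= nrm (vec t).
Proof.
rewrite -(splitK k); case: (fintype.split k) => i /=; apply: le_trans (coord_le_nrm _ i).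
  by have := ler_Re_cmod (vec t 0 i); rewrite vecE.
by have := ler_Im_cmod (vec t 0 i); rewrite vecE.
Qed.

Definition dyadic N (l : nat) (v : {ffun 'I_N -> int}) : set (N.-tuple L) :=
  box (fun i => (v i)%:~R / 2 ^+ l) (fun i => (v i + 1)%:~R / 2 ^+ l).

Definition dyadic_index N (l : nat) (t : N.-tuple L) : {ffun 'I_N -> int} :=
  [ffun i => Num.floor ((tnth t i : R) * 2 ^+ l)].

Let p2 l : (0 : R) < 2 ^+ l. Proof. exact: exprn_gt0. Qed.

Lemma dyadicP N l (v : {ffun 'I_N -> int}) (t : N.-tuple L) :
  dyadic l v t <-> dyadic_index l t = v.
Proof.
split=> [H|<- i].
  apply/ffunP => i; rewrite ffunE; apply: floor_def.
  by have := H i; rewrite ler_pdivrMr// ltr_pdivlMr.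
by rewrite ffunE ler_pdivrMr// ltr_pdivlMr// real_floor_itv// num_real.
Qed.

Lemma measurable_dyadic N l (v : {ffun 'I_N -> int}) : measurable (dyadic l v).
Proof. exact: measurable_box. Qed.

Lemma measure_dyadic N l (v : {ffun 'I_N -> int}) :
  product_power (@lebesgue_measure R) N (dyadic l v) = ((2 ^- l) ^+ N)%:E.
Proof.
rewrite measure_box => [|i]; last first.
  by rewrite ler_pM2r ?invr_gt0// ler_int lerDl.
congr (_%:E); under eq_bigr do rewrite -mulrBl -intrB [v _ + _]addrC addrK mul1r.
by rewrite prodr_const card_ord.
Qed.

Lemma dyadic_close N l (v : {ffun 'I_N -> int}) (s t : N.-tuple L) i :
  dyadic l v s -> dyadic l v t -> `|(tnth s i : R) - tnth t i| <= 2 ^- l.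
Proof.
move=> /(_ i)/andP[s1 s2] /(_ i)/andP[t1 t2].
rewrite intrD mulrDl mul1r in s2 t2.
by rewrite ler_norml; apply/andP; split; lra.
Qed.

Lemma pow2_small (e : R) : 0 < e -> exists l0, forall l, (l0 <= l)%N -> 2 ^- l <= e.
Proof.
move=> e0; exists (Num.bound e^-1) => l ll.
rewrite -[e]invrK lef_pV2 ?posrE ?invr_gt0//.
have := archi_boundP (ltW (_ : 0 < e^-1)); rewrite invr_gt0 => /(_ e0)/ltW/le_trans.
apply; rewrite -natrX ler_nat; apply: leq_trans ll _; exact: ltnW (ltn_expl _ _).
Qed.

Lemma dyadic_in_nbhs (U : set (Cn R n)) z : open U -> U z ->
  exists l0, forall l, (l0 <= l)%N -> forall v t, dyadic l v (tuple_of_vec z) ->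
    dyadic l v t -> U (vec t).
Proof.
move=> /openCnP oU Uz; have [r r0 hr] := oU z Uz.
have [l0 hl] := pow2_small (divr_gt0 r0 (ltr0Sn _ 3)).
exists l0 => l ll v t vz vt; have -> : vec t = z + (vec t - z) by rewrite addrC subrK.
apply: hr; have -> : vec t - z = vec (tadd t (topp (tuple_of_vec z))).
  by rewrite vec_tadd vec_topp tuple_of_vecK.
have r40 : 0 <= r / 4 by rewrite divr_ge0// ltW.
apply: le_lt_trans (nrm_vec r40 _) _; last by lra.
move=> k; rewrite tnth_tadd tnth_topp; apply: le_trans (hl l ll).
exact: dyadic_close vt vz.
Qed.

(** An open set is the union of the dyadic cubes it contains, and there are countably many dyadic
    cubes. *)
Lemma open_measurable_Cn (U : set (Cn R n)) : open U -> measurable (vec @^-1` U).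
Proof.
move=> oU; pose I := (nat * {ffun 'I_(n + n) -> int})%type.
rewrite (_ : vec @^-1` U = \bigcup_(p in [set: I])
    (if `[< dyadic p.1 p.2 `<=` vec @^-1` U >] then dyadic p.1 p.2 else set0)).
  apply: countable_bigcupT_measurable => [|p]; first exact: countableP.
  by case: ifP => _ //; exact: measurable_dyadic.
apply/seteqP; split=> t.
  move=> Ut; have [l0 /(_ l0 (leqnn _)) H] := dyadic_in_nbhs oU Ut.
  have tv : dyadic l0 (dyadic_index l0 t) t by exact/dyadicP.
  exists (l0, dyadic_index l0 t) => //; rewrite ifT//; apply/asboolP => s /= sv.
  by apply: H sv; rewrite vec_of_tupleK.
by move=> [p _]; case: asboolP => // H /H.
Qed.

Lemma measurable_fun_Cn D (G : Cn R n -> R) : open D ->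
  (forall z, D z -> forall e : R, 0 < e -> exists2 r : R, 0 < r &
     forall v, nrm v < r -> `|G (z + v) - G z| <= e) ->
  measurable_fun (vec @^-1` D) (G \o vec).
Proof.
move=> oD hG _; apply: (measurability _ (RGenOInfty.measurableE R)).
move=> _ [_ [a ->] <-].
rewrite [X in measurable X](_ : _ = vec @^-1` (D `&` [set z | a < G z])); last first.
  by apply/seteqP; split=> t /=; rewrite in_itv/= andbT.
apply: open_measurable_Cn; apply/openCnP => z [Dz] /= az.
have [r1 r10 h1] := (openCnP D).1 oD z Dz.
have e0 : 0 < (G z - a) / 2 by rewrite divr_gt0// subr_gt0.
have [r2 r20 h2] := hG z Dz _ e0.
exists (Num.min r1 r2); first by rewrite lt_min r10.
move=> v; rewrite lt_min => /andP[/h1 v1 /h2 v2]; split=> //.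
move: v2; rewrite /= ler_norml => /andP[v2 _]; lra.
exact: open_measurable_Cn.
Qed.

Lemma continuous_coord_real (h : Cn R n -> Cx R) z (e : R) : differentiable h z -> 0 < e ->
  exists2 r : R, 0 < r & forall v, nrm v < r -> cmod (h (z + v) - h z) <= e.
Proof.
move=> /differentiable_continuous hc e0.
have /hc/nbhs_CnP[r r0 hr] : nbhs (h z) [set w | cmod (w - h z) <= e].
  by apply/nbhs_CxP; exists e => // w /ltW; rewrite /= addrC addKr.
by exists r.
Qed.

Lemma measurable_Re D (h : Cn R n -> Cx R) : open D -> holomorphic D h ->
  measurable_fun (vec @^-1` D) (fun t => complex.Re (h (vec t))).
Proof.
move=> oD hD; apply: (@measurable_fun_Cn _ (fun z => complex.Re (h z))) => // z Dz e e0.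
have [r r0 hr] := continuous_coord_real (hD z Dz) e0; exists r => // v /hr.
by apply: le_trans; rewrite -cReN -cReD ler_Re_cmod.
Qed.

Lemma measurable_Im D (h : Cn R n -> Cx R) : open D -> holomorphic D h ->
  measurable_fun (vec @^-1` D) (fun t => complex.Im (h (vec t))).
Proof.
move=> oD hD; apply: (@measurable_fun_Cn _ (fun z => complex.Im (h z))) => // z Dz e e0.
have [r r0 hr] := continuous_coord_real (hD z Dz) e0; exists r => // v /hr.
by apply: le_trans; rewrite -cImN -cImD ler_Im_cmod.
Qed.

Definition tmap (f : Cn R n -> Cn R n) : T -> T := fun t => tuple_of_vec (f (vec t)).

Lemma vec_tmap f t : vec (tmap f t) = f (vec t).
Proof. exact: tuple_of_vecK. Qed.

Lemma measurable_tmap (f : Cn R n -> Cn R n) :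
  (forall i, holomorphic setT (fun z => f z 0 i)) -> measurable_fun setT (tmap f).
Proof.
move=> fh; apply: measurable_mktuple => k.
have oT := @openT (Cn R n).
case: (fintype.split k) => i; rewrite -[X in measurable_fun X](preimage_setT vec).
  by have := measurable_Re oT (fh i).
by have := measurable_Im oT (fh i).
Qed.

End identification.

(** * Linear maps and Lebesgue measure *)

Section scaling.
Context {R : realType} {n : nat}.
Local Notation L := (measurableTypeR R).
Local Notation T := ((n + n).-tuple L).
Local Notation mu := (lebesgue_Cn R n).
Local Notation vec := (@vec_of_tuple R n).
Implicit Types (z w : Cn R n) (S : set (Cn R n)) (A B : 'M[Cx R]_n).

Definition lam S : \bar R := mu (vec @^-1` S).
Definition meas S := measurable (vec @^-1` S).

Lemma mdiff_mulmx A z i : mdiff (fun w => (w *m A) 0 i) z (fun j => A j i).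
Proof.
move=> e e0; exists 1 => // v _.
have -> : ((z + v) *m A) 0 i - (z *m A) 0 i - \sum_j v 0 j * A j i = 0.
  have E (a b c : Cx R) : c = b -> a + b - a - c = 0 by move=> ->; ring.
  by rewrite mulmxDl [X in X - _ - _]mxE; apply: E; rewrite mxE.
by rewrite cmod0 mulr_ge0 ?nrm_ge0// ltW.
Qed.

Lemma measurable_mulmx A : measurable_fun setT (tmap (fun z : Cn R n => z *m A)).
Proof.
by apply: measurable_tmap => i z _; exact: mdiff_differentiable (mdiff_mulmx A z i).
Qed.

Lemma meas_mulmx A S : meas S -> meas [set z | S (z *m A)].
Proof.
move=> mS; have := preimage_measurable (measurable_mulmx A) mS.
have E : tmap (fun z => z *m A) @^-1` (vec @^-1` S) = vec @^-1` [set z | S (z *m A)].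
  by apply/seteqP; split=> t /=; rewrite vec_tmap.
by rewrite E.
Qed.

Definition mx_abs A : R := \sum_j \sum_i cmod (A i j).

Lemma nrm_mulmx z A : nrm (z *m A) <= nrm z * mx_abs A.
Proof.
have A0 : 0 <= mx_abs A by apply: sumr_ge0 => j _; exact: sumr_ge0.
apply: nrm_le; first by rewrite mulr_ge0 ?nrm_ge0.
move=> j; rewrite mxE; apply: le_trans (cmod_lin _ _) _; rewrite ler_wpM2l ?nrm_ge0//.
rewrite /mx_abs [leRHS](bigD1 j)//= lerDl; apply: sumr_ge0 => k _; exact: sumr_ge0.
Qed.

Definition cube (e : R) : set T := box (fun=> - e) (fun=> e).

Lemma measure_cube (e : R) : 0 <= e -> mu (cube e) = ((2 * e) ^+ (n + n))%:E.
Proof.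
move=> e0; rewrite [LHS]measure_box => [|_]; last by rewrite ge0_cp.
by rewrite prodr_const card_ord opprK -mulr2n mulr_natl.
Qed.

Lemma cubeP (e : R) t : (forall k, `|tnth t k : R| < e) -> cube e t.
Proof. by move=> H k; have := H k; rewrite ltr_norml => /andP[/ltW -> ->]. Qed.

Lemma cube_le (e : R) t k : cube e t -> `|tnth t k : R| <= e.
Proof. by move=> /(_ k)/andP[h1 /ltW h2]; rewrite ler_norml h1. Qed.

Definition Cube (e : R) : set (Cn R n) := [set z | cube e (tuple_of_vec z)].

Lemma vec_Cube (e : R) : vec @^-1` Cube e = cube e.
Proof. by apply/seteqP; split=> t; rewrite /Cube /= vec_of_tupleK. Qed.

Lemma meas_Cube (e : R) : meas (Cube e).
Proof. by rewrite /meas vec_Cube; exact: measurable_box. Qed.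

Lemma lam_Cube (e : R) : 0 <= e -> lam (Cube e) = ((2 * e) ^+ (n + n))%:E.
Proof. by move=> e0; rewrite /lam vec_Cube measure_cube. Qed.

Lemma nrm_lt_Cube (e : R) z : nrm z < e -> Cube e z.
Proof.
move=> ze; apply: cubeP => k; apply: le_lt_trans ze.
by apply: le_trans (tnth_le_nrm _ k) _; rewrite tuple_of_vecK.
Qed.

Lemma Cube_nrm (e : R) z : 0 <= e -> Cube e z -> nrm z <= 2 * e.
Proof.
move=> e0 ze; rewrite -[z]tuple_of_vecK; apply: nrm_vec => // k.
exact: cube_le ze.
Qed.

Lemma lam_le S S' : meas S -> meas S' -> S `<=` S' -> (lam S <= lam S')%E.
Proof.
move=> mS mS' SS'; rewrite /lam; apply: le_measure; rewrite ?inE//.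
by move=> t; exact: SS'.
Qed.

(** [K] is the factor for preimages under right multiplication by [A]; [scales_det] finds it to be
    the inverse square of the modulus of the determinant. *)
Definition scales A (K : R) := 0 < K /\ forall S, meas S ->
  lam [set z | S (z *m A)] = (K%:E * lam S)%E.

Lemma pow_gt0 : 0 < (2 * 1 : R) ^+ (n + n).
Proof. by rewrite exprn_gt0// mulr_gt0. Qed.

(** [haar_swap] with the unit cube for its first set and multiplication by [A] for [phi] shows that
    the measure of a preimage is proportional to that of the set. *)
Lemma scales_exists A : A \in unitmx -> exists K, scales A K.
Proof.
move=> uA; pose phi := tmap (fun z : Cn R n => z *m A).
pose psi := tmap (fun z : Cn R n => z *m invmx A).
have phiD x y : phi (tadd y (psi x)) = tadd (phi y) x.
  apply: (can_inj (@vec_of_tupleK R n)).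
  by rewrite !(vec_tmap, vec_tadd) mulmxDl mulmxKV.
have mphi : measurable_fun setT phi := measurable_mulmx A.
pose c := mu [set y | cube 1 (topp (phi y))].
have mc : measurable [set y | cube 1 (topp (phi y))].
  by apply: (preimage_measurable (measurable_topp mphi)); exact: measurable_box.
have cfin : c \is a fin_num.
  pose M := 2 * 1 * mx_abs (invmx A) + 1.
  rewrite ge0_fin_numE ?measure_ge0//; apply: (@le_lt_trans _ _ (mu (cube M))).
    apply: le_measure; rewrite ?inE//; first exact: measurable_box.
    move=> y /= yU; apply: cubeP => k; apply: le_lt_trans (tnth_le_nrm y k) _.
    have : nrm (vec (phi y)) <= 2 * 1.
      by rewrite -nrmN -vec_topp; apply: nrm_vec => // i; exact: cube_le yU.
    rewrite vec_tmap => yA; rewrite -[vec y](mulmxK uA).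
    apply: le_lt_trans (nrm_mulmx _ _) _; rewrite /M ltr_pwDr//.
    rewrite ler_wpM2r//; apply: sumr_ge0 => j _; exact: sumr_ge0.
  rewrite measure_cube ?ltry// addr_ge0// !mulr_ge0//.
  by apply: sumr_ge0 => j _; exact: sumr_ge0.
have cE (U : set T) : measurable U -> mu (phi @^-1` U) = ((fine c / (2 * 1) ^+ (n + n))%:E * mu U)%E.
  move=> mB; have := haar_swap mphi phiD (measurable_box _ _ : measurable (cube 1)) mB.
  rewrite measure_cube// -/c -[c]fineK// => E.
  rewrite [fine c / _]mulrC EFinM -muleA -E muleA -EFinM mulVf ?mul1e//.
(* If the factor vanished, the unit cube, being the preimage under [phi] of its own preimage under
   [psi], would be a null set. *)
have K0 : fine c / (2 * 1) ^+ (n + n) != 0.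
  apply/eqP => E.
  have mB : measurable (psi @^-1` cube 1).
    by apply: (preimage_measurable (measurable_mulmx _)); exact: measurable_box.
  have := cE _ mB; rewrite E mul0e => /eqP.
  rewrite (_ : phi @^-1` _ = cube 1) ?measure_cube//.
    by rewrite eqe (gt_eqF pow_gt0).
  apply/seteqP; split=> t /=; have -> : psi (phi t) = t => //.
    by apply: (can_inj (@vec_of_tupleK R n)); rewrite !vec_tmap mulmxK.
  by apply: (can_inj (@vec_of_tupleK R n)); rewrite !vec_tmap mulmxK.
exists (fine c / (2 * 1) ^+ (n + n)); split.
  rewrite lt_neqAle eq_sym K0 /= divr_ge0 ?fine_ge0 ?measure_ge0//.
move=> S mS; rewrite -(cE _ mS) /lam; congr (mu _).
by apply/seteqP; split=> t /=; rewrite vec_tmap.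
Qed.

Lemma scales_unique A K K' S (x : R) : scales A K -> meas S -> 0 < x ->
  lam S = x%:E -> lam [set z | S (z *m A)] = (K' * x)%:E -> K = K'.
Proof.
move=> [_ hK] mS x0 Sx; rewrite hK// Sx -EFinM => -[].
by move=> /(mulIf (lt0r_neq0 x0)).
Qed.

Lemma scalesM A B K K' : scales A K -> scales B K' -> scales (A *m B) (K * K').
Proof.
move=> [K0 hK] [K'0 hK']; split=> [|S mS]; first exact: mulr_gt0.
rewrite EFinM -muleA -hK'// -hK; last exact: meas_mulmx.
by congr lam; apply/seteqP; split=> z /=; rewrite mulmxA.
Qed.

Lemma scales_inj A K K' : scales A K -> scales A K' -> K = K'.
Proof.
move=> hK [_ hK']; apply: (scales_unique hK (meas_Cube 1) pow_gt0 (lam_Cube ler01)).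
by rewrite hK' ?lam_Cube//; exact: meas_Cube.
Qed.

Lemma scales1 : scales 1%:M 1.
Proof.
split=> // S mS; rewrite mul1e; congr lam.
by apply/seteqP; split=> z /=; rewrite mulmx1.
Qed.

Lemma scales_conj D A K : D \in unitmx -> scales A K -> scales (D *m A *m invmx D) K.
Proof.
move=> uD hA; have [k hk] := scales_exists uD.
have uD' : invmx D \in unitmx by rewrite unitmx_inv.
have [k' hk'] := scales_exists uD'.
have := scalesM (scalesM hk hA) hk'.
have := scales_inj (scalesM hk hk'); rewrite mulmxV// => /(_ _ scales1) kk.
by rewrite mulrAC kk mul1r.
Qed.

Lemma bernoulli (N : nat) (x : R) : 0 <= x <= 1 -> 1 - N%:R * x <= (1 - x) ^+ N.
Proof.
move=> /andP[x0 x1]; elim: N => [|N IH]; first by rewrite mul0r subr0 expr0.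
have x1' : 0 <= 1 - x by rewrite subr_ge0.
rewrite exprS; apply: le_trans (ler_wpM2l x1' IH).
have : 0 <= N%:R * x ^+ 2 by rewrite mulr_ge0// sqr_ge0.
rewrite -natr1 expr2; lra.
Qed.

(** Coordinates of points of the unit cube move by at most [2 * (n%:R * e)], so the slightly larger
    cube has a preimage containing the unit cube; compare volumes. *)
Lemma scales_near_id A K (e : R) : scales A K -> 0 <= e ->
  (forall i j, cmod (A i j - (i == j)%:R) <= e) ->
  1 <= K * (1 + 2 * (n%:R * e)) ^+ (n + n).
Proof.
move=> [K0 hK] e0 Ae; pose d := 1 + 2 * (n%:R * e).
have d0 : 0 <= 2 * (n%:R * e) by rewrite !mulr_ge0.
have d1 : 0 <= d by rewrite addr_ge0.
have : (lam (Cube 1) <= lam [set z | Cube d (z *m A)])%E.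
  apply: lam_le; [exact: meas_Cube|by apply: meas_mulmx; exact: meas_Cube|].
  move=> z z1; have zn := Cube_nrm ler01 z1.
  have E : nrm (z *m A - z) <= 2 * (n%:R * e).
    apply: nrm_le => // j; have -> : (z *m A - z) 0 j = \sum_i z 0 i * (A i j - (i == j)%:R).
      under [RHS]eq_bigr do rewrite mulrBr; rewrite sumrB [LHS]mxE [X in X + _]mxE [X in _ + X]mxE; congr (_ - _).
      rewrite (bigD1 j)//= eqxx mulr1 big1 ?addr0// => i ij.
      by rewrite (negbTE ij) mulr0.
    apply: le_trans (cmod_lin _ _) _; apply: ler_pM => //; first exact: nrm_ge0.
    + exact: sumr_ge0.
    + by rewrite mulr1 in zn.
    + apply: le_trans (ler_sum _ (fun i _ => Ae i j)) _.
      by rewrite sumr_const card_ord mulr_natl.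
  move=> k; have := z1 k; have := tnth_le_nrm (tuple_of_vec (z *m A - z)) k.
  rewrite tuple_of_vecK => /le_trans/(_ E).
  have -> : tnth (tuple_of_vec (z *m A - z)) k =
     (tnth (tuple_of_vec (z *m A)) k : R) - tnth (tuple_of_vec z) k.
    rewrite -(splitK k); case: (fintype.split k) => i /=.
      by rewrite !tnth_tovl !mxE cReD cReN.
    by rewrite !tnth_tovr !mxE cImD cImN.
  by rewrite ler_norml /d => /andP[h1 h2] /andP[h3 h4]; apply/andP; split; lra.
rewrite hK; last exact: meas_Cube.
rewrite !lam_Cube// -EFinM lee_fin !exprMn expr1n mulr1 mulrCA.
by rewrite -[leLHS]mulr1 ler_pM2l// exprn_gt0.
Qed.

(* Conjugating by diag(s ^ e i) with s small brings such a matrix close to 1. *)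
Lemma scales_unipotent A K (e : 'I_n -> nat) : scales A K -> (forall i, A i i = 1) ->
  (forall i j, i != j -> (e i <= e j)%N -> A i j = 0) -> 1 <= K.
Proof.
move=> hA A1 Ae; have K0 := hA.1.
have C0 : 0 <= mx_abs A by apply: sumr_ge0 => j _; exact: sumr_ge0.
pose N := (n + n)%N; pose c := 2 * (n%:R * mx_abs A).
have c0 : 0 <= c by rewrite !mulr_ge0.
(* Conjugation leaves the factor unchanged and multiplies each nonzero off-diagonal entry by a
   positive power of [s]. *)
have near (s : R) : 0 < s -> s <= 1 -> 1 <= K * (1 + c * s) ^+ N.
  move=> s0 s1; have sn i : rC s ^+ e i != 0.
    by rewrite expf_neq0// -cmod_eq0 cmod_rC normr_eq0 lt0r_neq0.
  pose d : 'rV[Cx R]_n := \row_i rC s ^+ e i.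
  have dV : diag_mx d *m diag_mx (\row_i (rC s ^+ e i)^-1) = 1%:M.
    apply/matrixP => i j; rewrite mul_diag_mx !mxE; case: eqP => [->|_].
      by rewrite mulr1n divff.
    by rewrite mulr0n mulr0.
  have uD : diag_mx d \in unitmx by have [] := mulmx1_unit dV.
  have iD : invmx (diag_mx d) = diag_mx (\row_i (rC s ^+ e i)^-1).
    by rewrite -[LHS]mulmx1 -dV mulKmx.
  have hc := scales_conj uD hA; rewrite iD in hc.
  have -> : c * s = 2 * (n%:R * (mx_abs A * s)) by rewrite /c; ring.
  apply: (scales_near_id hc); first by rewrite mulr_ge0// ltW.
  move=> i j; rewrite mul_mx_diag mul_diag_mx !mxE.
  have [<-|ij] := eqVneq i j.
    by rewrite A1 mulr1 divff// subrr cmod0 mulr_ge0// ltW.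
  rewrite subr0; have [eij|eji] := leqP (e i) (e j).
    by rewrite (Ae i j)// mulr0 mul0r cmod0 mulr_ge0// ltW.
  rewrite mulrAC -expfB// cmodM cmodX cmod_rC gtr0_norm// mulrC; apply: ler_pM => //.
  - by rewrite exprn_ge0// ltW.
  - rewrite /mx_abs [leRHS](bigD1 j)//= (bigD1 i)//= -addrA lerDl addr_ge0//; first exact: sumr_ge0.
    by apply: sumr_ge0 => k _; exact: sumr_ge0.
  - have ee : (1 <= e i - e j)%N by rewrite subn_gt0.
    by rewrite -[leRHS]expr1; apply: ler_wiXn2l => //; exact: ltW.
apply/ler_addgt0Pr => x x0.
have Nc : 0 <= N%:R * c by rewrite mulr_ge0.
have D1 : 0 < N%:R * c + 1 by rewrite ltr_wpDl.
(* These bounds give [c * s <= 1] and [N%:R * (c * s) <= x]; then K >= (1 + c s)^-N >= (1 - c s)^N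
   >= 1 - N c s by Bernoulli. *)
pose s := Num.min 1 (Num.min (1 / (c + 1)) (x / (N%:R * c + 1))).
have C1 : 0 < c + 1 by rewrite ltr_wpDl.
have s0 : 0 < s by rewrite !lt_min ltr01 !divr_gt0.
have s1 : s <= 1 by rewrite ge_min lexx.
have sc : s <= 1 / (c + 1) by rewrite /s !ge_min lexx !orbT.
have sx : s <= x / (N%:R * c + 1) by rewrite /s !ge_min lexx !orbT.
have cs : 0 <= c * s <= 1.
  rewrite mulr_ge0 ?(ltW s0)//=; apply: le_trans (ler_wpM2l c0 sc) _.
  exact: ler_succ_div.
have h1 := near s s0 s1; have h2 := bernoulli N cs.
have h3 : (1 + c * s) ^+ N * (1 - c * s) ^+ N <= 1.
  have /andP[cs0 cs1] := cs.
  have q0 : 0 <= (1 + c * s) * (1 - c * s) by apply: mulr_ge0; rewrite ?subr_ge0//; exact: addr_ge0.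
  rewrite -exprMn; apply: exprn_ile1 => //.
  have := sqr_ge0 (c * s); rewrite expr2; lra.
have h4 : (1 - c * s) ^+ N <= K.
  have q0 : 0 <= (1 - c * s) ^+ N.
    by rewrite exprn_ge0// subr_ge0; have /andP[] := cs.
  apply: le_trans (_ : K * ((1 + c * s) ^+ N * (1 - c * s) ^+ N) <= _); last first.
    by rewrite -[leRHS]mulr1 ler_wpM2l// ltW.
  by rewrite mulrA -[leLHS]mul1r ler_wpM2r.
have h7 : 1 - N%:R * (c * s) <= K by apply: le_trans h2 h4.
have h5 : N%:R * (c * s) <= x.
  rewrite mulrA; apply: le_trans (ler_wpM2l Nc sx) _.
  by apply: ler_succ_div => //; exact: ltW.
by lra.
Qed.

Lemma CubeP (e : R) z : Cube e z <-> forall i,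
  (- e <= complex.Re (z 0 i) < e) && (- e <= complex.Im (z 0 i) < e).
Proof.
split=> [h i|h k].
  have := h (rshift n i); have := h (lshift n i).
  by rewrite tnth_tovl tnth_tovr => -> ->.
rewrite -(splitK k); case: (fintype.split k) => i /=.
  by rewrite tnth_tovl; have /andP[] := h i.
by rewrite tnth_tovr; have /andP[] := h i.
Qed.

Lemma scales_perm K (s : 'S_n) : scales (perm_mx s) K -> K = 1.
Proof.
move=> hK; apply: (scales_unique hK (meas_Cube 1) pow_gt0 (lam_Cube ler01)).
rewrite mul1r -lam_Cube//; congr lam.
have zE z i : (z *m perm_mx s) 0 i = z 0 (s^-1%g i).
  by rewrite -[s]invgK -col_permE mxE invgK.
apply/seteqP; split=> z /= /CubeP h; apply/CubeP => i.
  by have := h (s i); rewrite !zE permK.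
by rewrite zE.
Qed.

(** Phases do not preserve the cube of [scales_perm], but they preserve the unit polydisc, whose
    measure lies between those of two cubes and is therefore positive and finite. *)
Lemma scales_phase K (d : 'rV[Cx R]_n) : (forall i, cmod (d 0 i) = 1) ->
  scales (diag_mx d) K -> K = 1.
Proof.
move=> d1 hK; pose P := [set z : Cn R n | nrm z < 1].
have oP : open P.
  apply/openCnP => z zP; exists (1 - nrm z); first by rewrite subr_gt0.
  move=> v vz; rewrite /P /=.
  by apply: le_lt_trans (nrmD _ _) _; rewrite -ltrBrDl.
have mP : meas P := open_measurable_Cn oP.
have P1 : (lam P <= lam (Cube 1))%E.
  by apply: lam_le => //; [exact: meas_Cube|exact: nrm_lt_Cube].
have q0 : (0 : R) <= 4^-1 by rewrite invr_ge0.
have P2 : (lam (Cube 4^-1) <= lam P)%E.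
  apply: lam_le => //; first exact: meas_Cube.
  by move=> z /(Cube_nrm q0) zn; rewrite /P /=; apply: le_lt_trans zn _; lra.
have Pfin : lam P \is a fin_num.
  by rewrite ge0_fin_numE ?measure_ge0//; apply: le_lt_trans P1 _; rewrite lam_Cube// ltry.
apply: (scales_unique hK mP (x := fine (lam P))); last first.
- rewrite mul1r fineK//; congr lam.
  have nE z : nrm (z *m diag_mx d) = nrm z.
    by apply/eqP; rewrite eq_le; apply/andP; split; apply: nrm_le (nrm_ge0 _) _ => i;
      [rewrite mul_mx_diag mxE cmodM d1 mulr1; exact: coord_le_nrm|
       have := coord_le_nrm (z *m diag_mx d) i; rewrite mul_mx_diag mxE cmodM d1 mulr1].
  by apply/seteqP; split=> z; rewrite /P /= nE.
- by rewrite fineK.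
apply: fine_gt0; apply/andP; split; last by rewrite -ge0_fin_numE ?measure_ge0.
apply: lt_le_trans P2; rewrite lam_Cube// lte_fin exprn_gt0//; lra.
Qed.

(** The preimage of the unit cube is a box. Each complex coordinate accounts for two real sides,
    hence the square. *)
Lemma scales_pos_diag K (d : 'I_n -> R) : (forall i, 0 < d i) ->
  scales (diag_mx (\row_i rC (d i))) K -> K = (\prod_i d i)^-1 ^+ 2.
Proof.
move=> d0 hK; apply: (scales_unique hK (meas_Cube 1) pow_gt0 (lam_Cube ler01)).
pose b (k : 'I_(n + n)) : R := match fintype.split k with inl i | inr i => (d i)^-1 end.
have bl i : b (lshift n i) = (d i)^-1 by rewrite /b -[lshift _ _]/(unsplit (inl i)) unsplitK.
have br i : b (rshift n i) = (d i)^-1 by rewrite /b -[rshift _ _]/(unsplit (inr i)) unsplitK.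
have b0 k : 0 <= b k by rewrite /b; case: fintype.split => i; rewrite invr_ge0 ltW.
rewrite /lam (_ : vec @^-1` _ = box (fun k => - b k) b); last first.
  have E i (x : R) : (- 1 <= x * d i < 1) = (- (d i)^-1 <= x < (d i)^-1).
    by rewrite -(ler_pdivrMr _ _ (d0 i)) mulN1r -(ltr_pdivlMr _ _ (d0 i)) mul1r.
  have zE t i : (vec t *m diag_mx (\row_i rC (d i))) 0 i = vec t 0 i * rC (d i).
    by rewrite mul_mx_diag !mxE.
  apply/seteqP; split=> t /=.
    move=> /CubeP h k; rewrite -(splitK k); case: (fintype.split k) => i /=;
      have := h i; rewrite zE vecE; move=> /andP[].
      by rewrite cReM /= mulr0 subr0 E bl.
    by move=> _; rewrite cImM /= mulr0 add0r E br.
  move=> h; apply/CubeP => i; rewrite zE vecE cReM cImM /= !mulr0 subr0 add0r !E.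
  by have := h (lshift n i); have := h (rshift n i); rewrite bl br => -> ->.
rewrite measure_box => [|k]; last by rewrite ge0_cp.
congr (_%:E); under eq_bigr do rewrite opprK -mulr2n -[b _ *+ 2]mulr_natl.
rewrite big_split prodr_const card_ord /= mulrC mulr1; congr (_ * _).
rewrite big_split_ord /=; under eq_bigr do rewrite bl.
by under [X in _ * X]eq_bigr do rewrite br; rewrite prodfV expr2.
Qed.

Lemma scales_diag K (d : 'rV[Cx R]_n) : (forall i, d 0 i != 0) ->
  scales (diag_mx d) K -> K = (\prod_i cmod (d 0 i))^-1 ^+ 2.
Proof.
move=> d0 hK; pose r i := cmod (d 0 i); have r0 i : 0 < r i by rewrite cmod_gt0.
have rn i : rC (r i) != 0 by rewrite -cmod_eq0 cmod_rC normr_eq0 lt0r_neq0.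
pose e : 'rV[Cx R]_n := \row_i (d 0 i / rC (r i)).
have dE : diag_mx d = diag_mx (\row_i rC (r i)) *m diag_mx e.
  apply/matrixP => i j; rewrite mul_diag_mx !mxE; case: eqP => [->|_].
    by rewrite !mulr1n mulrC divfK.
  by rewrite !mulr0n mulr0.
have e1 i : cmod (e 0 i) = 1.
  by rewrite mxE cmodM cmodV cmod_rC gtr0_norm// divff//; apply: lt0r_neq0; exact: r0.
have u1 : diag_mx (\row_i rC (r i)) \in unitmx.
  rewrite unitmxE det_diag unitfE; apply/prodf_neq0 => i _; by rewrite mxE.
have u2 : diag_mx e \in unitmx.
  rewrite unitmxE det_diag unitfE; apply/prodf_neq0 => i _.
  by rewrite -cmod_eq0 e1 oner_eq0.
have [K1 h1] := scales_exists u1; have [K2 h2] := scales_exists u2.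
have := scalesM h1 h2; rewrite -dE => /(scales_inj hK) ->.
by rewrite (scales_phase e1 h2) mulr1 (scales_pos_diag r0 h1).
Qed.

End scaling.

Section scaling_det.
Context {R : realType} {n : nat}.
Implicit Types (A : 'M[Cx R]_n.+1) (K : R).

Lemma scales_triangular A K : A \in unitmx -> scales A K ->
  (forall i j : 'I_n.+1, (j < i)%N -> A i j = 0) -> (cmod (\det A))^-1 ^+ 2 <= K.
Proof.
move=> uA hK Au.
have dA : \det A = \prod_i A i i.
  rewrite -det_tr det_trig; first by apply: eq_bigr => i _; rewrite mxE.
  by apply/is_trig_mxP => i j ij; rewrite mxE Au.
have A0 i : A i i != 0.
  by move: uA; rewrite unitmxE unitfE dA => /prodf_neq0/(_ i isT).
pose d : 'rV[Cx R]_n.+1 := \row_i A i i.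
pose B := \matrix_(i, j) ((A i i)^-1 * A i j).
have AE : A = diag_mx d *m B.
  by apply/matrixP => i j; rewrite mul_diag_mx !mxE mulrA divff// mul1r.
have uB : B \in unitmx by move: uA; rewrite AE unitmx_mul => /andP[].
have ud : diag_mx d \in unitmx by move: uA; rewrite AE unitmx_mul => /andP[].
have [K1 h1] := scales_exists ud; have [K2 h2] := scales_exists uB.
have := scalesM h1 h2; rewrite -AE => /(scales_inj hK) ->.
have d0 i : d 0 i != 0 by rewrite mxE.
have K2_1 : 1 <= K2.
  (* The exponents decrease with the row index, as the matrix is upper triangular. *)
  apply: (scales_unipotent (e := fun i => (n - i)%N) h2) => [i|i j ij].
    by rewrite mxE mulVf.
  move=> eij; rewrite mxE; have ji : (j < i)%N.
    have := ltn_ord i; have := ltn_ord j; move: ij eij; rewrite -val_eqE /=; lia.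
  by rewrite (Au _ _ ji) mulr0.
have -> : cmod (\det A) = \prod_i cmod (d 0 i).
  by rewrite dA; elim/big_rec2: _ => [|i x y _ <-]; rewrite ?cmodM ?mxE//; exact: (cmod_nat 1).
by rewrite -(scales_diag d0 h1) -[leLHS]mulr1 ler_pM2l// h1.1.
Qed.

(** From the decomposition P A = L U: the factor of the permutation is 1, that of the unipotent L is
    at least 1, and that of U is bounded below by its diagonal. *)
Lemma scales_ge A K : A \in unitmx -> scales A K -> (cmod (\det A))^-1 ^+ 2 <= K.
Proof.
move=> uA hK; have := cormen_lup_correct A; have := cormen_lup_perm A.
have := cormen_lup_detL A; have := cormen_lup_lower A; have := cormen_lup_upper A.
case: (cormen_lup A) => [[P L] U] /= Uu Ll dL /is_perm_mxP[s ->] E.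
rewrite -!mulmxE in E.
have uL : L \in unitmx by rewrite unitmxE dL unitr1.
have uP : (perm_mx s : 'M[Cx R]_n.+1) \in unitmx := unitmx_perm _ s.
have uU : U \in unitmx.
  have : perm_mx s *m A \in unitmx by rewrite unitmx_mul uP.
  by rewrite E unitmx_mul => /andP[].
have [KP hP] := scales_exists uP; have [KL hL] := scales_exists uL.
have [KU hU] := scales_exists uU.
have := scalesM hP hK; rewrite E => /(scales_inj (scalesM hL hU)) EK.
have KP1 := scales_perm hP; rewrite KP1 mul1r in EK; rewrite -EK.
have KL1 : 1 <= KL.
  apply: (scales_unipotent (e := fun i => i) hL) => [i|i j ij eij].
    by rewrite Ll// eqxx.
  by rewrite Ll// (negbTE ij).
have dE : cmod (\det A) = cmod (\det U).
  have := congr1 (fun M => cmod (\det M)) E; rewrite /= !det_mulmx dL mul1r cmodM.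
  by rewrite det_perm cmodX cmodN (cmod_nat 1) expr1n mul1r.
rewrite dE; apply: le_trans (scales_triangular uU hU Uu) _.
by rewrite -[leLHS]mul1r ler_pM2r// hU.1.
Qed.

(** The factors of [A] and of its inverse have product 1, as have their lower bounds from
    [scales_ge], so both bounds are attained. *)
Lemma scales_det A : A \in unitmx -> scales A ((cmod (\det A))^-1 ^+ 2).
Proof.
move=> uA; have uV : invmx A \in unitmx by rewrite unitmx_inv.
have [K hK] := scales_exists uA; have [K' hK'] := scales_exists uV.
have := scalesM hK hK'; rewrite mulmxV// => /(scales_inj (scales1)) KK.
have h1 := scales_ge uA hK; have := scales_ge uV hK'.
rewrite det_inv cmodV => h2.
have d0 : 0 < cmod (\det A) by rewrite cmod_gt0 -unitfE -unitmxE.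
suff -> : (cmod (\det A))^-1 ^+ 2 = K by [].
apply/eqP; rewrite eq_le h1 /=.
have : K * (cmod (\det A))^-1^-1 ^+ 2 <= 1 by rewrite KK ler_pM2l// hK.1.
by rewrite invrK exprVn -ler_pdivlMr ?exprn_gt0// div1r.
Qed.

End scaling_det.

(** * Change of variables *)

Section jacobian.
Context {R : realType} {n : nat}.
Implicit Types (z v w : Cn R n) (h : Cn R n -> Cx R) (f F : Cn R n -> Cn R n)
  (D : set (Cn R n)).

(** The transpose of the usual Jacobian matrix: vectors are rows, and the differential is
    [v |-> v *m jac f z]. *)
Definition jac f z : 'M[Cx R]_n := \matrix_(i, j) partial i (fun w => f w 0 j) z.

Lemma jac_expansion f z (e : R) : differentiable f z -> 0 < e ->
  exists2 r : R, 0 < r & forall v, nrm v < r ->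
    nrm (f (z + v) - f z - v *m jac f z) <= e * nrm v.
Proof.
(* Writing the radius as [2 ^- j] turns the choice of a common radius for all coordinates into that
   of a common threshold, given by [fin_eventually]. *)
move=> fd e0; pose P (i : 'I_n) (j : nat) := forall v, nrm v < 2 ^- j ->
  cmod ((f (z + v) - f z - v *m jac f z) 0 i) <= e * nrm v.
have [i|N hN] := @fin_eventually n P.
  have [r r0 hr] := mdiff_partial (differentiable_coordinate i fd) e0.
  have [N hN] := pow2_small r0; exists N => j Nj v vj.
  have E : (f (z + v) - f z - v *m jac f z) 0 i =
      f (z + v) 0 i - f z 0 i - \sum_k v 0 k * partial k (fun w => f w 0 i) z.
    rewrite [LHS]mxE [X in X + _]mxE; congr (_ + _); first by rewrite [X in _ + X]mxE.
    by rewrite [LHS]mxE [X in - X]mxE; under eq_bigr do rewrite mxE.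
  by rewrite E; apply: hr; apply: lt_le_trans vj (hN _ Nj).
exists (2 ^- N); first by rewrite invr_gt0 exprn_gt0.
move=> v vN; apply: nrm_le => [|i]; first by rewrite mulr_ge0 ?nrm_ge0// ltW.
exact: (hN N (leqnn _) i v vN).
Qed.

Lemma partial_coord (i k : 'I_n) z : partial i (fun w : Cn R n => w 0 k) z = (i == k)%:R.
Proof.
have H : mdiff (fun w : Cn R n => w 0 k) z (fun l => (l == k)%:R).
  move=> e e0; exists 1 => // v _.
  have E (a b c : Cx R) : c = b -> a + b - a - c = 0 by move=> ->; ring.
  rewrite [X in X - _ - _]mxE E ?cmod0 ?mulr_ge0 ?nrm_ge0 ?(ltW e0)//.
  rewrite (bigD1 k)//= eqxx mulr1 big1 ?addr0 => [//|l lk].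
  by rewrite (negbTE lk) mulr0.
exact: (mdiff_partialE H).
Qed.

Lemma partial_comp h f z i : differentiable f z -> differentiable h (f z) ->
  partial i (fun w => h (f w)) z = \sum_k jac f z i k * partial k h (f z).
Proof.
move=> fd hd; rewrite partial_diff; last exact: (differentiable_comp fd hd).
rewrite (diff_comp fd hd) /= (diff_lin _ hd); apply: eq_bigr => k _.
rewrite mxE; congr (_ * _).
have cd : differentiable (fun w : Cn R n => w 0 k) (f z) by exact: differentiable_coord.
rewrite partial_diff; last exact: differentiable_coordinate.
rewrite (@diff_comp _ _ _ _ f (fun w : Cn R n => w 0 k) z fd cd) /=.
rewrite (diff_lin _ cd) (bigD1 k)//= big1 ?addr0 => [|l lk].
  by rewrite partial_coord eqxx mulr1.
by rewrite partial_coord (negbTE lk) mulr0.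
Qed.

Lemma jac_inverse D f F z : open D -> holomorphic D f -> holomorphic D F ->
  (forall w, D w -> D (f w)) -> (forall w, D w -> F (f w) = w) -> D z ->
  jac f z *m jac F (f z) = 1%:M.
Proof.
move=> oD fh Fh fD fK Dz; apply/matrixP => i j.
rewrite [RHS]mxE -(partial_coord _ _ z) [LHS]mxE.
transitivity (partial i (fun w => F (f w) 0 j) z).
  rewrite (@partial_comp (fun w => F w 0 j) f z i (fh z Dz)); last first.
    exact: differentiable_coordinate (Fh _ (fD _ Dz)).
  by apply: eq_bigr => k _; congr (_ * _); rewrite /jac mxE; reflexivity.
have E : {in D, (fun w => F (f w) 0 j) =1 (fun w => w 0 j)}.
  by move=> w; rewrite inE => Dw /=; rewrite fK.
by apply: (eq_partial i oD E); rewrite inE.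
Qed.

Lemma holomorphic_sum (I : Type) (s : seq I) (G : I -> Cn R n -> Cx R) D :
  (forall i, holomorphic D (G i)) -> holomorphic D (fun z => \sum_(i <- s) G i z).
Proof.
move=> Gh z Dz; elim: s => [|i s IH].
  rewrite (_ : (fun _ => _) = cst 0); first exact: differentiable_cst.
  by apply/funext => w; rewrite big_nil.
rewrite (_ : (fun _ => _) = G i + (fun w => \sum_(j <- s) G j w)).
  exact: differentiableD (Gh i z Dz) IH.
by apply/funext => w; rewrite big_cons.
Qed.

Lemma holomorphicM D h g : holomorphic D h -> holomorphic D g ->
  holomorphic D (fun z => h z * g z).
Proof. by move=> hh gh z Dz; exact: (differentiableM (hh z Dz) (gh z Dz)). Qed.

Lemma holomorphic_prod (I : Type) (s : seq I) (G : I -> Cn R n -> Cx R) D :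
  (forall i, holomorphic D (G i)) -> holomorphic D (fun z => \prod_(i <- s) G i z).
Proof.
move=> Gh z Dz; elim: s => [|i s IH].
  rewrite (_ : (fun _ => _) = cst 1); first exact: differentiable_cst.
  by apply/funext => w; rewrite big_nil.
rewrite (_ : (fun _ => _) = G i * (fun w => \prod_(j <- s) G j w)).
  exact: differentiableM (Gh i z Dz) IH.
by apply/funext => w; rewrite big_cons.
Qed.

Lemma det_jac_holomorphic D f : open D -> holomorphic D f ->
  holomorphic D (fun z => \det (jac f z)).
Proof.
move=> oD fh; rewrite /determinant; apply: holomorphic_sum => s.
apply: holomorphicM; first by move=> z _; exact: differentiable_cst.
apply: holomorphic_prod => i; rewrite [X in holomorphic D X](_ : _ =
    partial i (fun w => f w 0 (s i))).
  by apply: partial_holomorphic => // z Dz; apply: differentiable_coordinate; exact: fh.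
by apply/funext => z; rewrite mxE.
Qed.

End jacobian.

Lemma ler_pow1 (R : realFieldType) (N : nat) (x : R) : 0 <= x <= 1 ->
  (1 + x) ^+ N <= 1 + 3 ^+ N * x.
Proof.
move=> /andP[x0 x1]; elim: N => [|N IH]; first by rewrite !expr0 mul1r lerDl.
rewrite exprS; apply: le_trans (_ : (1 + x) * (1 + 3 ^+ N * x) <= _).
  by rewrite ler_wpM2l// addr_ge0.
have p1 : (1 : R) <= 3 ^+ N by apply: exprn_ege1; rewrite ler1n.
rewrite exprS; set p := _ ^+ N in p1 *.
have : 0 <= p * x * (1 - x) by rewrite !mulr_ge0 ?subr_ge0// (le_trans _ p1).
have : 0 <= (p - 1) * x by rewrite mulr_ge0// subr_ge0.
by move=> ? ?; lra.
Qed.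

Lemma floor_double_eq (R : realType) (x y : R) :
  Num.floor (2 * x) = Num.floor (2 * y) -> Num.floor x = Num.floor y.
Proof.
move=> E; apply: floor_def.
have /andP[x1 x2] := floor_itv (2 * x); have /andP[y1 y2] := floor_itv (2 * y).
have /andP[q1 q2] := floor_itv y; rewrite E in x1 x2.
set p := Num.floor (2 * y) in x1 x2 y1 y2 *; set q := Num.floor y in q1 q2 *.
rewrite intrD in q2 x2 y2; rewrite intrD.
have qp : 2 * q <= p.
  by rewrite -ltzD1 -(ltr_int R) intrD intrM; lra.
have pq : p <= 2 * q + 1.
  by rewrite -ltzD1 -(ltr_int R) !intrD intrM; lra.
rewrite -(ler_int R) intrM in qp; rewrite -(ler_int R) intrD intrM in pq.
by apply/andP; split; lra.
Qed.

Section change_of_variables_tools.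
Context {R : realType} {n : nat}.
Local Notation L := (measurableTypeR R).
Local Notation T := ((n + n).-tuple L).
Local Notation mu := (lebesgue_Cn R n).
Local Notation vec := (@vec_of_tuple R n).
Local Notation tov := (@tuple_of_vec R n).
Implicit Types (z w : Cn R n) (S : set (Cn R n)) (g : Cn R n -> Cx R).

Lemma tnth_tovD z w k : tnth (tov (z + w)) k = (tnth (tov z) k : R) + tnth (tov w) k :> R.
Proof.
have -> : tov (z + w) = tadd (tov z) (tov w).
  by apply: (can_inj (@vec_of_tupleK R n)); rewrite vec_tadd !tuple_of_vecK.
exact: tnth_tadd.
Qed.

Lemma sq_continuous g z (e : R) : differentiable g z -> 0 < e ->
  exists2 r : R, 0 < r & forall v, nrm v < r ->
    `|cmod (g (z + v)) ^+ 2 - cmod (g z) ^+ 2| <= e.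
Proof.
move=> gd e0; pose b := cmod (g z); pose K := 2 * b + 1.
have b0 : 0 <= b := cmod_ge0 _.
have K0 : 0 <= K by rewrite addr_ge0// mulr_ge0.
have d0 : 0 < Num.min 1 (e / (K + 1)).
  by rewrite lt_min ltr01 divr_gt0// ltr_wpDl.
have [r r0 hr] := continuous_coord_real gd d0; exists r => // v /hr.
rewrite le_min => /andP[x1 xe]; set a := cmod (g (z + v)).
have a0 : 0 <= a := cmod_ge0 _.
have ab : `|a - b| <= cmod (g (z + v) - g z).
  rewrite ler_norml lerNl opprB {1}cmod_distC.
  by apply/andP; split; exact: cmod_sub.
rewrite subr_sqr normrM [`|a + b|]ger0_norm ?addr_ge0//.
have aK : a + b <= K.
  have := le_trans ab x1; rewrite ler_norml => /andP[_]; rewrite /K; lra.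
apply: le_trans (ler_succ_div K0 (ltW e0)); rewrite mulrC.
by apply: ler_pM => //; [exact: addr_ge0|exact: le_trans ab xe].
Qed.

Lemma measurable_sq D g : open D -> holomorphic D g ->
  measurable_fun (vec @^-1` D) (fun t => (cmod (g (vec t)) ^+ 2)%:E).
Proof.
move=> oD gh; apply/measurable_EFinP.
apply: (@measurable_fun_Cn _ _ _ (fun z => cmod (g z) ^+ 2)) => // z Dz e e0.
by have [r r0 hr] := sq_continuous (gh z Dz) e0; exists r.
Qed.

Lemma meas_shift c S : meas S -> meas [set z | S (z + c)].
Proof.
move=> mS; have := @preimage_measurable _ _ _ _ (fun t : T => tadd t (tov c)) _ _ mS.
have E : (fun t : T => tadd t (tov c)) @^-1` (vec @^-1` S) = vec @^-1` [set z | S (z + c)].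
  by apply/seteqP; split=> t /=; rewrite vec_tadd tuple_of_vecK.
by rewrite E; apply; exact: (measurable_tadd (@measurable_id _ _ _) (measurable_cst _)).
Qed.

Lemma lam_shift c S : meas S -> lam [set z | S (z + c)] = lam S.
Proof.
move=> mS; rewrite /lam -(product_power_shift (tov c) mS); congr (mu _).
by apply/seteqP; split=> t /=; rewrite vec_tadd tuple_of_vecK.
Qed.

Lemma measurable_preimage_dyadic D (F : Cn R n -> Cn R n) l v : open D -> holomorphic D F ->
  measurable [set t : T | D (vec t) /\ dyadic l v (tov (F (vec t)))].
Proof.
move=> oD Fh; have mD := open_measurable_Cn oD.
pose G k (t : T) : L := tnth (tov (F (vec t))) k.
have mG k : measurable_fun (vec @^-1` D) (G k).
  have Fk i : holomorphic D (fun z => F z 0 i).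
    by move=> z Dz; apply: differentiable_coordinate; exact: Fh.
  rewrite /G -(splitK k); case: (fintype.split k) => i /=.
    rewrite (_ : (fun _ => _) = (fun t => complex.Re (F (vec t) 0 i) : L)).
      exact: measurable_Re oD (Fk i).
    by apply/funext => t; rewrite tnth_tovl.
  rewrite (_ : (fun _ => _) = (fun t => complex.Im (F (vec t) 0 i) : L)).
    exact: measurable_Im oD (Fk i).
  by apply/funext => t; rewrite tnth_tovr.
rewrite (_ : mkset _ = vec @^-1` D `&` \bigcap_(k in [set: 'I_(n + n)]) (vec @^-1` D `&`
    G k @^-1` `[((v k)%:~R / 2 ^+ l), ((v k + 1)%:~R / 2 ^+ l)[%classic)).
  apply: measurableI => //; apply: fin_bigcap_measurable => [|k _].
    exact: finite_finset.
  by apply: mG => //; exact: measurable_itv.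
apply/seteqP; split=> t /=.
  move=> [Dt H]; split=> // k _; split=> //; rewrite /= in_itv/=; exact: H.
by move=> [Dt H]; split=> // k; have [_] := H k Logic.I; rewrite /= in_itv.
Qed.

Lemma dyadic_nrm a t l v : dyadic l v (tov a) -> dyadic l v t -> nrm (vec t - a) <= 2 * 2 ^- l.
Proof.
move=> va vt; have -> : vec t - a = vec (tadd t (topp (tov a))).
  by rewrite vec_tadd vec_topp tuple_of_vecK.
apply: nrm_vec => [|k]; first by rewrite invr_ge0 exprn_ge0.
by rewrite tnth_tadd tnth_topp; exact: dyadic_close vt va.
Qed.

Lemma dyadic_nested N l l' (v v' : {ffun 'I_N -> int}) (s t : N.-tuple L) : (l' <= l)%N ->
  dyadic l v s -> dyadic l v t -> dyadic l' v' s -> dyadic l' v' t.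
Proof.
move=> ll' /dyadicP sv /dyadicP tv /dyadicP sv'; apply/dyadicP; rewrite -{}sv'.
move: sv tv => <-; rewrite -(subnK ll'); elim: (l - l')%N => [|k IH]; first by rewrite add0n.
rewrite addSn => E; apply: IH; apply/ffunP => i; move/ffunP/(_ i): E; rewrite !ffunE exprS.
set x := (tnth t i : R) * 2 ^+ (k + l'); set y := (tnth s i : R) * 2 ^+ (k + l').
rewrite mulrCA [X in _ = Num.floor X]mulrCA -/x -/y => E.
exact: floor_double_eq.
Qed.

End change_of_variables_tools.

Section real_estimates.
Context {R : realFieldType}.
Implicit Types (b c e r s t x y z d : R).

Lemma lt_of_quarter s r x : 0 < r -> s <= r / 4 -> x <= 2 * s -> x < r.
Proof. by move=> *; lra. Qed.

Lemma itv_perturb x y z t d : - d <= y <= d -> x <= z < t -> x - d <= z + y < t + d.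
Proof. by move=> /andP[? ?] /andP[? ?]; apply/andP; split; lra. Qed.

Lemma half_slack x y e : - (e / 2) <= x - y -> y + e / 2 <= x + e.
Proof. by move=> ?; lra. Qed.

Lemma density_slack b c e s t : 0 <= b -> 0 <= t -> s <= 1 ->
  c * b * s <= e / 4 -> b * t <= e / 8 -> (c + t) * b * (1 + s) <= c * b + e / 2.
Proof.
move=> b0 t0 s1 h1 h2.
have : b * t * s <= b * t by rewrite ler_piMr// mulr_ge0.
by move=> ?; lra.
Qed.

End real_estimates.

Section change_of_variables.
Context {R : realType} {n' : nat}.
Local Notation n := n'.+1.
Local Notation L := (measurableTypeR R).
Local Notation T := ((n + n).-tuple L).
Local Notation N := (n + n)%N.
Local Notation mu := (lebesgue_Cn R n).
Local Notation vec := (@vec_of_tuple R n).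
Local Notation tov := (@tuple_of_vec R n).
Implicit Types (z w : Cn R n) (S : set (Cn R n)).

Lemma lam_affine (J : 'M[Cx R]_n) (b c : Cn R n) S : J \in unitmx -> meas S ->
  lam [set y | S ((y + c) *m invmx J + b)] = ((cmod (\det J) ^+ 2)%:E * lam S)%E.
Proof.
move=> uJ mS; have uV : invmx J \in unitmx by rewrite unitmx_inv.
have mS1 : meas [set z | S (z + b)] := meas_shift b mS.
rewrite (@lam_shift _ _ c [set z | S (z *m invmx J + b)]); last exact: (meas_mulmx _ mS1).
have [_ /(_ _ mS1)] := scales_det uV; rewrite /= => ->.
by rewrite (lam_shift b mS) det_inv cmodV invrK.
Qed.

Context (D : set (Cn R n)) (f F : Cn R n -> Cn R n) (h : Cn R n -> Cx R).
Context (oD : open D) (fh : holomorphic D f) (Fh : holomorphic D F)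
  (fD : forall z, D z -> D (f z)) (FD : forall z, D z -> D (F z))
  (fK : forall z, D z -> F (f z) = z) (FK : forall z, D z -> f (F z) = z)
  (hh : holomorphic D h).

(** The operator that turns out to be unitary. The map and the function are explicit arguments, as
    it is also applied to the inverse map. *)
Definition transport (f : Cn R n -> Cn R n) (h : Cn R n -> Cx R) z :=
  \det (jac f z) * h (f z).

Lemma transport_holomorphic : holomorphic D (transport f h).
Proof.
apply: holomorphicM; first exact: det_jac_holomorphic.
by move=> z Dz; exact: (differentiable_comp (fh Dz) (hh (fD Dz))).
Qed.

(** The image under [f] of the part of [Q] in [D], written as a preimage under [F] so that
    measurability is clear. *)
Let img (Q : set T) : set T := [set t : T | D (vec t) /\ Q (tov (F (vec t)))].

Let sq (g : Cn R n -> Cx R) (t : T) : R := cmod (g (vec t)) ^+ 2.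

(** Cubes inside [D] on which the inequality to be proved holds with an error [e] per unit of
    volume; errors of this kind add up over a partition. *)
Let good (e : R) l v := (forall t : T, dyadic l v t -> D (vec t)) /\
  (\int[mu]_(t in img (dyadic l v)) (sq h t)%:E <=
   \int[mu]_(t in dyadic l v) (sq (transport f h) t + e)%:E)%E.

Let mD : measurable (vec @^-1` D) := open_measurable_Cn oD.

Let sq_ge0 g t : (0 <= (sq g t)%:E)%E.
Proof. by rewrite lee_fin sqr_ge0. Qed.

(** Near [a] the image of a small cube lies in the affine image, by the differential at [a], of a
    slightly enlarged cube, whose volume is known from [scales_det]. On such a cube the two
    integrands are nearly the constants [c] and [c * B]. *)
Lemma good_near (e : R) a : 0 < e -> D a -> exists l0, forall l, (l0 <= l)%N ->
  forall v, dyadic l v (tov a) -> good e l v.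
Proof.
move=> e0 Da; pose J := jac f a; pose B := cmod (\det J) ^+ 2.
pose c := cmod (h (f a)) ^+ 2; pose C := mx_abs (invmx J).
have [uJ _] := mulmx1_unit (jac_inverse oD fh Fh fD fK Da); rewrite -/J in uJ.
have B0 : 0 <= B := sqr_ge0 _; have c0 : 0 <= c := sqr_ge0 _.
have cB0 : 0 <= c * B by exact: mulr_ge0.
have C0 : 0 <= C by apply: sumr_ge0 => j _; exact: sumr_ge0.
have e4 : 0 < e / 4 by rewrite divr_gt0.
have e8 : 0 < e / 8 by rewrite divr_gt0.
(* The error budget of [density_slack]: [kap] is the relative excess of volume and [eta] the
   oscillation of the left integrand. Together they cost [e / 2], and the oscillation of the right
   integrand takes the other half. *)
pose kap := Num.min 1 (e / 4 / (c * B + 1)); pose eta := e / 8 / (B + 1).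
have kap0 : 0 < kap by rewrite lt_min ltr01 divr_gt0// ltr_wpDl.
have eta0 : 0 < eta by rewrite divr_gt0// ltr_wpDl.
have kapB : c * B * kap <= e / 4.
  apply: le_trans (ler_succ_div cB0 (ltW e4)); rewrite ler_wpM2l//.
  by rewrite /kap ge_min lexx orbT.
have kap1 : kap <= 1 by rewrite /kap ge_min lexx.
have etaB : B * eta <= e / 8 by apply: ler_succ_div => //; exact: ltW.
have p3 : 0 < (3 : R) ^+ N by rewrite exprn_gt0.
have [dl dl0 hdl] : exists2 dl : R, 0 < dl & (1 + 2 * dl) ^+ N <= 1 + kap.
  have m0 : 0 < Num.min 1 (kap / 3 ^+ N) by rewrite lt_min ltr01 divr_gt0.
  exists (Num.min 1 (kap / 3 ^+ N) / 2); first by rewrite divr_gt0.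
  rewrite mulrC divfK//; apply: le_trans (ler_pow1 _ _) _.
    by rewrite (ltW m0) ge_min lexx.
  by rewrite lerD2l mulrC -ler_pdivlMr// ge_min lexx orbT.
(* The affine approximation error [tau * (2 * s)], pulled back by the inverse differential of size
   [C], must stay within [dl * s]. *)
pose tau := dl / (2 * C + 1).
have tau0 : 0 < tau by rewrite divr_gt0// ltr_wpDl// mulr_ge0.
have tauC : 2 * C * tau <= dl by apply: ler_succ_div; [exact: mulr_ge0|exact: ltW].
have e2 : 0 < e / 2 by rewrite divr_gt0.
have [r1 r10 h1] := jac_expansion (fh Da) tau0.
have hfd : differentiable (fun z => h (f z)) a.
  exact: (differentiable_comp (fh Da) (hh (fD Da))).
have [r2 r20 h2] := sq_continuous hfd eta0.
have [r3 r30 h3] := sq_continuous (transport_holomorphic Da) e2.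
have [l1 hl1] := dyadic_in_nbhs oD Da.
pose r := Num.min r1 (Num.min r2 r3).
have r0 : 0 < r by rewrite !lt_min r10 r20 r30.
have r4 : 0 < r / 4 by rewrite divr_gt0.
have [l2 hl2] := pow2_small r4.
exists (maxn l1 l2) => l; rewrite geq_max => /andP[ll1 ll2] v av.
pose s : R := 2 ^- l; have s0 : 0 < s by rewrite invr_gt0 exprn_gt0.
have sr : s <= r / 4 := hl2 _ ll2.
have QD t : dyadic l v t -> D (vec t) := hl1 l ll1 v t av.
have near2 t : dyadic l v t -> nrm (vec t - a) <= 2 * s by exact: dyadic_nrm.
have nearr t : dyadic l v t -> [/\ nrm (vec t - a) < r1, nrm (vec t - a) < r2 & nrm (vec t - a) < r3].
  move=> /near2 /(lt_of_quarter r0 sr).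
  by rewrite !lt_min => /andP[-> /andP[-> ->]].
split=> //.
pose lo (k : 'I_N) : R := (v k)%:~R / 2 ^+ l - dl * s.
pose hi (k : 'I_N) : R := (v k + 1)%:~R / 2 ^+ l + dl * s.
(* The cube of level [l] enlarged by [dl * s] on every side. *)
pose Q' : set (Cn R n) := [set z | box lo hi (tov z)].
have vQ' : vec @^-1` Q' = box lo hi.
  by apply/seteqP; split=> t; rewrite /Q' /= vec_of_tupleK.
have mQ' : meas Q' by rewrite /meas vQ'; exact: measurable_box.
have hl k : hi k - lo k = (1 + 2 * dl) * s.
  by rewrite /hi /lo intrD mulrDl mul1r -/s; ring.
have lQ' : lam Q' = (((1 + 2 * dl) * s) ^+ N)%:E.
  rewrite /lam vQ' measure_box => [|k].
    by under eq_bigr do rewrite hl; rewrite prodr_const card_ord.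
  rewrite -subr_ge0 hl; apply: mulr_ge0; last exact: ltW.
  by apply: addr_ge0 => //; apply: mulr_ge0 => //; exact: ltW.
have sub : img (dyadic l v) `<=` vec @^-1` [set y | Q' ((y - f a) *m invmx J + a)].
  move=> t [Dt Qt]; set z := F (vec t) in Qt.
  have tz : vec t = f z by rewrite FK.
  have [] := nearr _ Qt; rewrite tuple_of_vecK => zr1 _ _.
  have := near2 _ Qt; rewrite tuple_of_vecK => zs.
  pose E := (f (a + (z - a)) - f a - (z - a) *m J) *m invmx J.
  have az : a + (z - a) = z by rewrite addrC subrK.
  have EE : (vec t - f a) *m invmx J + a = z + E.
    rewrite /E az tz [in RHS]mulmxBl mulmxK//; set X := _ *m _.
    by rewrite opprB addrCA [z + _]addrC subrK.
  have En : nrm E <= dl * s.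
    apply: le_trans (nrm_mulmx _ _) _; rewrite -/C.
    apply: le_trans (ler_wpM2r C0 (h1 _ zr1)) _.
    apply: le_trans (_ : tau * (2 * s) * C <= _).
      by rewrite ler_wpM2r// ler_wpM2l// ltW.
    by rewrite [leLHS](_ : _ = 2 * C * tau * s) ?ler_wpM2r ?(ltW s0)//; ring.
  have Qj j : lo j <= (tnth (tov (z + E)) j : R) < hi j; last by rewrite -EE in Qj.
  rewrite tnth_tovD; have := Qt j.
  have := tnth_le_nrm (tov E) j; rewrite tuple_of_vecK => /le_trans/(_ En).
  by rewrite ler_norml; exact: itv_perturb.
have mimg : measurable (img (dyadic l v)) by exact: measurable_preimage_dyadic.
have imgD : img (dyadic l v) `<=` vec @^-1` D by move=> t [].
have dyD : dyadic l v `<=` vec @^-1` D by move=> t /QD.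
have mW : measurable_fun (vec @^-1` D) (fun t => (sq (transport f h) t + e)%:E).
  apply/measurable_EFinP; apply: measurable_funD; last exact: measurable_cst.
  by apply/measurable_EFinP; exact: (measurable_sq oD transport_holomorphic).
apply: (@le_trans _ _ ((c + eta) * (B * ((1 + 2 * dl) * s) ^+ N))%:E).
  have h4 : (\int[mu]_(t in img (dyadic l v)) (sq h t)%:E <=
      \int[mu]_(t in img (dyadic l v)) (cst (c + eta)%:E) t)%E.
    apply: ge0_le_integral => //.
      exact: (measurable_funS mD imgD (measurable_sq oD hh)).
    move=> t [Dt Qt]; set z := F (vec t) in Qt.
    have [] := nearr _ Qt; rewrite tuple_of_vecK => _ zr2 _.
    rewrite lee_fin /sq; have := h2 _ zr2; rewrite [a + _]addrC subrK FK// -/c.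
    by rewrite ler_norml => /andP[_]; rewrite lerBlDl.
  apply: (le_trans h4); rewrite integral_cst// EFinM; apply: lee_wpmul2l.
    by rewrite lee_fin addr_ge0// ltW.
  rewrite EFinM -lQ' -(lam_affine a (- f a) uJ mQ').
  have mS : meas [set y | Q' ((y - f a) *m invmx J + a)].
    exact: (meas_shift (- f a) (meas_mulmx (invmx J) (meas_shift a mQ'))).
    exact: (le_measure mu (mem_set mimg) (mem_set mS) sub).
apply: (@le_trans _ _ (\int[mu]_(t in dyadic l v) (cst (c * B + e / 2)%:E) t)%E).
  rewrite integral_cst; last exact: measurable_dyadic.
  rewrite [X in (_ <= _ * X)%E](_ : _ = (s ^+ N)%:E); last exact: measure_dyadic.
  rewrite -EFinM lee_fin exprMn [B * (_ * _)]mulrA [leLHS]mulrA [(c + eta) * (B * _)]mulrA ler_pM2r ?exprn_gt0//.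
  apply: le_trans (ler_wpM2l _ hdl) _.
    by apply: mulr_ge0 B0; apply: addr_ge0 c0 _; exact: ltW.
  by apply: density_slack => //; exact: ltW.
apply: ge0_le_integral => //.
- exact: measurable_dyadic.
- by move=> t _; rewrite lee_fin addr_ge0// ltW// divr_gt0.
- by apply: (measurable_funS mD dyD).
- move=> t Qt; have [_ _ tr3] := nearr _ Qt.
  rewrite lee_fin /sq; have := h3 _ tr3; rewrite [a + _]addrC subrK.
  have -> : cmod (transport f h a) ^+ 2 = c * B by rewrite cmodM exprMn mulrC.
  by rewrite ler_norml => /andP[+ _]; exact: half_slack.
Qed.

Let I := (nat * {ffun 'I_N -> int})%type.
Let dy (p : I) : set T := dyadic p.1 p.2.

(* Dyadic cubes being nested, the minimal good ones are pairwise disjoint. *)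
Let minimal_good (e : R) (p : I) := good e p.1 p.2 /\
  forall q : I, (q.1 < p.1)%N -> dy p `<=` dy q -> ~ good e q.1 q.2.

(** The minimal good cubes listed by [nat] through [pickle], with empty sets at the other codes, in
    order to apply countable additivity. *)
Let cell (e : R) (k : nat) : set T :=
  if pickle_inv k is Some p then
    if `[< minimal_good e p >] then dy p else set0
  else set0.

Let cellP e k t : cell e k t -> exists2 p : I, k = pickle p & minimal_good e p /\ dy p t.
Proof.
rewrite /cell; have := @pickle_invK I k; case: pickle_inv => //= p <-.
by case: asboolP => // mp pt; exists p.
Qed.

Let cellE e p : minimal_good e p -> cell e (pickle p) = dy p.
Proof. by move=> mp; rewrite /cell pickleK_inv; case: asboolP. Qed.

Let measurable_cell e k : measurable (cell e k).
Proof.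
rewrite /cell; case: pickle_inv => [p|]; last exact: measurable0.
case: ifP => _; [exact: measurable_dyadic|exact: measurable0].
Qed.

Let cell_disjoint e k k' t : cell e k t -> cell e k' t -> k = k'.
Proof.
move=> /cellP[p -> [[pg pm] pt]] /cellP[p' -> [[pg' pm'] pt']]; congr pickle.
have [lt|lt|eq1] := ltngtP p.1 p'.1.
- by case: (pm' p lt) => // s sp; exact: dyadic_nested (ltnW lt) pt' sp pt.
- by case: (pm p' lt) => // s sp; exact: dyadic_nested (ltnW lt) pt sp pt'.
move: p p' pt pt' eq1 {pg pm pg' pm'} => [l v] [l' v'] /= + + ll'.
by rewrite -{}ll' /dy /= => /dyadicP E /dyadicP E'; rewrite -E -E'.
Qed.

Let domain_cells e : 0 < e -> vec @^-1` D = \bigcup_k cell e k.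
Proof.
move=> e0; apply/seteqP; split=> t; last first.
  by move=> [k _ /cellP[p _ [[[pD _] _] pt]]]; exact: pD.
move=> Dt; pose P l := `[< good e l (dyadic_index l t) >].
have exP : exists l, P l.
  have [l0 hl] := good_near e0 Dt; exists l0; apply/asboolP/hl => //.
  by rewrite vec_of_tupleK; apply/dyadicP.
(* Every cube containing [t] is determined by its level, so the least good level gives a minimal
   good cube. *)
have [l /asboolP gl lmin] := ex_minnP exP.
have tl : dy (l, dyadic_index l t) t by apply/dyadicP.
have mg : minimal_good e (l, dyadic_index l t).
  split=> // q ql sub gq; have /dyadicP qE := sub t tl.
  have := lmin q.1; rewrite leqNgt ql => /(_ _)/negP; apply=> //.
  by apply/asboolP; rewrite qE.
by exists (pickle (l, dyadic_index l t) : nat) => //; rewrite cellE.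
Qed.

(** The cells partition [D], and so do their images since [f] is a bijection of [D]; the
    inequalities of the cells are summed. *)
Lemma cov_eps (e : R) : 0 < e ->
  (\int[mu]_(t in vec @^-1` D) (sq h t)%:E <=
   \int[mu]_(t in vec @^-1` D) (sq (transport f h) t + e)%:E)%E.
Proof.
move=> e0; have DE := domain_cells e0.
have DI : vec @^-1` D = \bigcup_k img (cell e k).
  apply/seteqP; split=> t; last by move=> [k _ []].
  move=> Dt; have : (vec @^-1` D) (tov (F (vec t))).
    by rewrite /= tuple_of_vecK; exact: FD.
  by rewrite DE => -[k _ kt]; exists k.
have mI k : measurable (img (cell e k)).
  rewrite /cell; case: pickle_inv => [p|].
    case: ifP => _; first exact: measurable_preimage_dyadic.
    by rewrite (_ : img set0 = set0) ?measurable0//; apply/seteqP; split=> t // -[].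
  by rewrite (_ : img set0 = set0) ?measurable0//; apply/seteqP; split=> t // -[].
have tI : trivIset setT (fun k => img (cell e k)).
  by move=> k k' _ _ [t [[_ h1] [_ h2]]]; exact: cell_disjoint h1 h2.
have tC : trivIset setT (cell e).
  by move=> k k' _ _ [t [h1 h2]]; exact: cell_disjoint h1 h2.
have mh := measurable_sq oD hh.
have mW : measurable_fun (vec @^-1` D) (fun t => (sq (transport f h) t + e)%:E).
  apply/measurable_EFinP; apply: measurable_funD; last exact: measurable_cst.
  by apply/measurable_EFinP; exact: (measurable_sq oD transport_holomorphic).
have We0 t : (0 <= (sq (transport f h) t + e)%:E)%E.
  by rewrite lee_fin; apply: addr_ge0; [exact: sqr_ge0|exact: ltW].
rewrite {1}DI DE !ge0_integral_bigcup//; [|by rewrite -DE|by rewrite -DI].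
apply: lee_nneseries => [k _ _|k _]; first exact: integral_ge0.
rewrite /cell; case: pickle_inv => [p|]; last first.
  rewrite (_ : img set0 = set0) ?integral_set0//.
  by apply/seteqP; split=> t // -[].
case: asboolP => [[[]]//|_]; rewrite (_ : img set0 = set0) ?integral_set0//.
by apply/seteqP; split=> t // -[].
Qed.

Lemma change_of_variables_le : (mu (vec @^-1` D) < +oo)%E ->
  (\int[mu]_(t in vec @^-1` D) (cmod (h (vec t)) ^+ 2)%:E <=
   \int[mu]_(t in vec @^-1` D) (cmod (transport f h (vec t)) ^+ 2)%:E)%E.
Proof.
move=> Dfin; apply/lee_addgt0Pr => e e0; pose M := fine (mu (vec @^-1` D)).
have M0 : 0 <= M by apply: fine_ge0; exact: measure_ge0.
have eM : 0 < e / (M + 1) by rewrite divr_gt0// ltr_wpDl.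
apply: (le_trans (cov_eps eM)); under eq_integral do rewrite EFinD.
rewrite ge0_integralD//; last first.
- by move=> t _; rewrite lee_fin ltW.
- exact: (measurable_sq oD transport_holomorphic).
rewrite leeD2l// (integral_cst _ mD) [X in (_ * X)%E](_ : _ = M%:E); last first.
  by rewrite /M fineK// ge0_fin_numE//; exact: measure_ge0.
by rewrite -EFinM lee_fin mulrC; apply: ler_succ_div => //; exact: ltW.
Qed.

End change_of_variables.

Section conjugate.
Context {R : realType}.
Implicit Types z w : Cx R.

Lemma cRe_conj z : complex.Re (z^*) = complex.Re z.
Proof. by case: z. Qed.

Lemma cIm_conj z : complex.Im (z^*) = - complex.Im z.
Proof. by case: z. Qed.

Lemma Re_le_sq z w : `|complex.Re (z * w)| <= cmod z ^+ 2 + cmod w ^+ 2.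
Proof.
apply: le_trans (ler_Re_cmod _) _; rewrite cmodM.
have := sqr_ge0 (cmod z - cmod w); have := sqr_ge0 (cmod z); have := sqr_ge0 (cmod w).
rewrite sqrrB => ? ? ?; lra.
Qed.

Lemma Im_le_sq z w : `|complex.Im (z * w)| <= cmod z ^+ 2 + cmod w ^+ 2.
Proof.
apply: le_trans (ler_Im_cmod _) _; rewrite cmodM.
have := sqr_ge0 (cmod z - cmod w); have := sqr_ge0 (cmod z); have := sqr_ge0 (cmod w).
rewrite sqrrB => ? ? ?; lra.
Qed.

Lemma cmod_conj z : cmod (z^*) = cmod z.
Proof.
by apply: complexI; rewrite -[LHS]cmodE norm_conjC cmodE.
Qed.

Lemma cmod_sqD z w : cmod (z + w) ^+ 2 <= 2 * cmod z ^+ 2 + 2 * cmod w ^+ 2.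
Proof.
apply: le_trans (_ : (cmod z + cmod w) ^+ 2 <= _).
  by rewrite ler_pXn2r ?nnegrE ?addr_ge0 ?cmod_ge0// cmodD.
have := sqr_ge0 (cmod z - cmod w); rewrite sqrrB sqrrD => ?; lra.
Qed.

End conjugate.

(** * The Bergman space *)

Section bergman.
Context {R : realType} {n : nat}.
Local Notation L := (measurableTypeR R).
Local Notation T := ((n + n).-tuple L).
Local Notation mu := (lebesgue_Cn R n).
Local Notation vec := (@vec_of_tuple R n).
Local Notation tov := (@tuple_of_vec R n).
Context (D : set (Cn R n)) (oD : open D) (Dfin : (mu (vec @^-1` D) < +oo)%E).
Implicit Types (h g : Cn R n -> Cx R) (z w : Cn R n) (c : Cx R).
Local Notation D' := (vec @^-1` D).
Local Notation "<< h , g >>" := (L2_inner D h g).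

Let mD : measurable D' := open_measurable_Cn oD.

Definition sqint h : \bar R := (\int[mu]_(t in D') (cmod (h (vec t)) ^+ 2)%:E)%E.

Lemma sqintE h : sqint h = (\int[mu]_(t in D') (complex.Re `|h (vec t)| ^+ 2)%:E)%E.
Proof. by apply: eq_integral => t _; rewrite cmodE. Qed.

Lemma H2P h : H2 D h <-> holomorphic D h /\ (sqint h < +oo)%E.
Proof.
rewrite sqintE; split=> [[hh [_ _ hf]]|[hh hf]]; first by split.
by split=> //; split=> //; [exact: measurable_Re|exact: measurable_Im].
Qed.

Lemma H2_holo h : H2 D h -> holomorphic D h. Proof. by case. Qed.

Lemma H2_bounded h (M : R) : holomorphic D h -> (forall z, D z -> cmod (h z) <= M) -> H2 D h.
Proof.
move=> hh hM; apply/H2P; split=> //.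
apply: (@le_lt_trans _ _ (\int[mu]_(t in D') (cst (M ^+ 2)%:E) t)%E).
  apply: ge0_le_integral => //.
  - by move=> t _; rewrite lee_fin sqr_ge0.
  - exact: measurable_sq.
  - move=> t Dt; rewrite lee_fin ler_pXn2r ?nnegrE ?cmod_ge0 ?hM//.
    exact: le_trans (cmod_ge0 _) (hM _ Dt).
by rewrite integral_cst// lte_mul_pinfty// lee_fin sqr_ge0.
Qed.

Lemma sq_integrable h : H2 D h -> mu.-integrable D' (fun t => (cmod (h (vec t)) ^+ 2)%:E).
Proof.
move=> /H2P[hh hf]; apply/integrableP; split; first exact: measurable_sq.
rewrite (eq_integral (fun t => (cmod (h (vec t)) ^+ 2)%:E))// => t _.
by rewrite gee0_abs// lee_fin sqr_ge0.
Qed.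

Lemma sq_integrableD h g : H2 D h -> H2 D g ->
  mu.-integrable D' (fun t => (cmod (h (vec t)) ^+ 2 + cmod (g (vec t)) ^+ 2)%:E).
Proof. by move=> hH gH; exact: (integrableD mD (sq_integrable hH) (sq_integrable gH)). Qed.

Lemma le_H2 h k g : holomorphic D h -> H2 D k -> H2 D g ->
  (forall z, D z -> cmod (h z) ^+ 2 <= cmod (k z) ^+ 2 + cmod (g z) ^+ 2) -> H2 D h.
Proof.
move=> hh kH gH le; apply/H2P; split=> //.
have /integrableP[_] := sq_integrableD kH gH; apply: le_lt_trans.
apply: ge0_le_integral => //.
- by move=> t _; rewrite lee_fin sqr_ge0.
- exact: measurable_sq.
- apply: measurableT_comp => //; apply/measurable_EFinP; apply: measurable_funD;
    by apply/measurable_EFinP; apply: measurable_sq => //; exact: H2_holo.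
- move=> t Dt; rewrite gee0_abs ?lee_fin ?addr_ge0 ?sqr_ge0//; exact: le.
Qed.

Lemma H2Z c h : H2 D h -> H2 D (fun z => c * h z).
Proof.
move=> /H2P[hh hf]; apply/H2P; split.
  by apply: holomorphicM => // z _; exact: differentiable_cst.
rewrite /sqint; under eq_integral do rewrite cmodM exprMn EFinM.
rewrite ge0_integralZl_EFin//.
- by rewrite lte_mul_pinfty// lee_fin sqr_ge0.
- by move=> t _; rewrite lee_fin sqr_ge0.
- exact: measurable_sq.
- exact: sqr_ge0.
Qed.

Lemma H2D h g : H2 D h -> H2 D g -> H2 D (fun z => h z + g z).
Proof.
move=> hH gH; have k2 : 0 <= (2 : R) by [].
have hH' := H2Z (rC (Num.sqrt 2)) hH; have gH' := H2Z (rC (Num.sqrt 2)) gH.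
apply: (le_H2 _ hH' gH') => [z Dz|z Dz].
  exact: (differentiableD (H2_holo hH Dz) (H2_holo gH Dz)).
rewrite !cmodM !exprMn !cmod_rC !ger0_norm ?sqrtr_ge0// !sqr_sqrtr//.
exact: cmod_sqD.
Qed.

Lemma H2B h g : H2 D h -> H2 D g -> H2 D (fun z => h z - g z).
Proof.
move=> hH gH; have := H2D hH (H2Z (-1) gH).
by congr (H2 D); apply/funext => z; rewrite mulN1r.
Qed.

Lemma H2_cst c : H2 D (fun=> c).
Proof. by apply: (@H2_bounded _ (cmod c)) => // z _; exact: differentiable_cst. Qed.

Lemma H2_sum (I : Type) (s : seq I) (F : I -> Cn R n -> Cx R) :
  (forall i, H2 D (F i)) -> H2 D (fun z => \sum_(i <- s) F i z).
Proof.
move=> FH; elim: s => [|i s IH].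
  by have := H2_cst 0; congr (H2 D); apply/funext => z; rewrite big_nil.
have := H2D (FH i) IH; congr (H2 D); apply/funext => z; by rewrite big_cons.
Qed.

Definition cintegrable (a : Cn R n -> Cx R) :=
  mu.-integrable D' (EFin \o (fun t => complex.Re (a (vec t)))) /\
  mu.-integrable D' (EFin \o (fun t => complex.Im (a (vec t)))).

Lemma inner_integrable h g : H2 D h -> H2 D g -> cintegrable (fun z => h z * (g z)^* ).
Proof.
move=> hH gH; have [hh gh] := (H2_holo hH, H2_holo gH).
have [mh mh'] := (measurable_Re oD hh, measurable_Im oD hh).
have [mg mg'] := (measurable_Re oD gh, measurable_Im oD gh).
have dom := sq_integrableD hH gH.
split; apply: (le_integrable mD _ _ dom).
- apply/measurable_EFinP; under eq_fun do rewrite cReM cRe_conj cIm_conj mulrN opprK.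
  by apply: measurable_funD; apply: measurable_funM.
- move=> t _ /=; rewrite lee_fin [leRHS]ger0_norm ?addr_ge0 ?sqr_ge0//.
  by have := Re_le_sq (h (vec t)) (g (vec t))^*; rewrite cmod_conj.
- apply/measurable_EFinP; under eq_fun do rewrite cImM cRe_conj cIm_conj mulrN.
  by apply: measurable_funD; [apply: measurableT_comp => //|]; apply: measurable_funM.
- move=> t _ /=; rewrite lee_fin [leRHS]ger0_norm ?addr_ge0 ?sqr_ge0//.
  by have := Im_le_sq (h (vec t)) (g (vec t))^*; rewrite cmod_conj.
Qed.

Lemma cintegralD (a b : Cn R n -> Cx R) : cintegrable a -> cintegrable b ->
  cintegral D (fun z => a z + b z) = cintegral D a + cintegral D b.
Proof.
move=> [ra ia] [rb ib]; apply: eqCx.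
  rewrite cReD -[RHS](RintegralD mD ra rb); apply: eq_Rintegral => t _; exact: cReD.
rewrite cImD -[RHS](RintegralD mD ia ib); apply: eq_Rintegral => t _; exact: cImD.
Qed.

Lemma cintegralZ c (a : Cn R n -> Cx R) : cintegrable a ->
  cintegral D (fun z => c * a z) = c * cintegral D a.
Proof.
move=> [ra ia]; have zi k (b : T -> R) : mu.-integrable D' (EFin \o b) ->
    mu.-integrable D' (EFin \o (fun t => k * b t)) := @integrableZl _ _ _ _ _ mD k _.
have lin k l : \int[mu]_(t in D') (k * complex.Re (a (vec t)) + l * complex.Im (a (vec t))) =
    k * complex.Re (cintegral D a) + l * complex.Im (cintegral D a).
  rewrite (RintegralD mD (zi k _ ra) (zi l _ ia)); congr (_ + _); exact: RintegralZl.
apply: eqCx.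
  rewrite cReM -mulNr -lin; apply: eq_Rintegral => t _.
  by rewrite cReM mulNr.
rewrite cImM addrC -lin; apply: eq_Rintegral => t _.
by rewrite cImM addrC.
Qed.

Lemma cintegral_conj (a : Cn R n -> Cx R) : cintegrable a ->
  cintegral D (fun z => (a z)^* ) = (cintegral D a)^*.
Proof.
move=> [ra ia]; apply: eqCx.
  by rewrite cRe_conj; apply: eq_Rintegral => t _; exact: cRe_conj.
rewrite cIm_conj -mulN1r -[RHS](RintegralZl (-1) mD ia); apply: eq_Rintegral => t _.
by rewrite mulN1r; exact: cIm_conj.
Qed.

Lemma eq_cintegral (a b : Cn R n -> Cx R) : (forall z, D z -> a z = b z) ->
  cintegral D a = cintegral D b.
Proof.
by move=> ab; apply: eqCx; apply: eq_Rintegral => t; rewrite inE => Dt; rewrite ab.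
Qed.

Lemma eq_inner h h' g g' : (forall z, D z -> h z = h' z) -> (forall z, D z -> g z = g' z) ->
  << h, g >> = << h', g' >>.
Proof. by move=> hh gg; apply: eq_cintegral => z Dz; rewrite hh// gg. Qed.

Lemma inner_conj h g : H2 D h -> H2 D g -> << g, h >> = << h, g >>^*.
Proof.
move=> hH gH; rewrite -(cintegral_conj (inner_integrable hH gH)).
by apply: eq_cintegral => z _; rewrite rmorphM /= conjCK mulrC.
Qed.

Lemma innerDl h g k : H2 D h -> H2 D g -> H2 D k ->
  << fun z => h z + g z, k >> = << h, k >> + << g, k >>.
Proof.
move=> hH gH kH; rewrite -(cintegralD (inner_integrable hH kH) (inner_integrable gH kH)).
by apply: eq_cintegral => z _; rewrite mulrDl.
Qed.

Lemma innerZl c h k : H2 D h -> H2 D k -> << fun z => c * h z, k >> = c * << h, k >>.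
Proof.
move=> hH kH; rewrite -(cintegralZ _ (inner_integrable hH kH)).
by apply: eq_cintegral => z _; rewrite mulrA.
Qed.

Lemma innerBl h g k : H2 D h -> H2 D g -> H2 D k ->
  << fun z => h z - g z, k >> = << h, k >> - << g, k >>.
Proof.
move=> hH gH kH; rewrite -mulN1r -(innerZl _ gH kH) -(innerDl hH (H2Z (-1) gH) kH).
by apply: eq_inner => z _; [rewrite mulN1r|].
Qed.

Lemma innerDr h g k : H2 D h -> H2 D g -> H2 D k ->
  << k, fun z => h z + g z >> = << k, h >> + << k, g >>.
Proof.
move=> hH gH kH; rewrite (inner_conj _ kH); last exact: H2D.
by rewrite innerDl// rmorphD /= -!inner_conj.
Qed.

Lemma innerZr c h k : H2 D h -> H2 D k -> << k, fun z => c * h z >> = c^* * << k, h >>.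
Proof.
move=> hH kH; rewrite (inner_conj _ kH); last exact: H2Z.
by rewrite innerZl// rmorphM /= -inner_conj.
Qed.

Lemma innerBr h g k : H2 D h -> H2 D g -> H2 D k ->
  << k, fun z => h z - g z >> = << k, h >> - << k, g >>.
Proof.
move=> hH gH kH; rewrite (inner_conj _ kH); last exact: H2B.
by rewrite innerBl// rmorphB /= -!inner_conj.
Qed.

Lemma inner_suml (I : Type) (s : seq I) (F : I -> Cn R n -> Cx R) k :
  (forall i, H2 D (F i)) -> H2 D k ->
  << fun z => \sum_(i <- s) F i z, k >> = \sum_(i <- s) << F i, k >>.
Proof.
move=> FH kH; elim: s => [|i s IH].
  rewrite big_nil; transitivity (0 * << fun=> 0, k >>); last by rewrite mul0r.
  rewrite -(innerZl 0 (H2_cst 0) kH).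
  by apply: eq_inner => z _; [rewrite big_nil mul0r|].
rewrite big_cons -IH -(innerDl (FH i) (H2_sum s FH) kH).
by apply: eq_inner => z _; [exact: big_cons|].
Qed.

Lemma inner_self h : << h, h >> = rC (fine (sqint h)).
Proof.
apply: eqCx => /=.
  rewrite /sqint -/(Rintegral mu D' (fun t => cmod (h (vec t)) ^+ 2)).
  apply: eq_Rintegral => t _; rewrite sqr_cmod cReM cRe_conj cIm_conj mulrN opprK.
  by rewrite !expr2.
transitivity (\int[mu]_(t in D') (0 * 0 : R)); last first.
  by rewrite mul0r /Rintegral integral0.
apply: eq_Rintegral => t _; rewrite cImM cRe_conj cIm_conj mulrN; ring.
Qed.

(** If [h a] were nonzero, the squared modulus would exceed half its value at [a] on a dyadic cube
    around [a], which has positive measure. *)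
Lemma sqint_eq0 h : H2 D h -> sqint h = 0 -> forall z, D z -> h z = 0.
Proof.
move=> hH h0 a Da; apply: contrapT => /eqP; rewrite -cmod_eq0 => ha.
have a0 : 0 < cmod (h a) ^+ 2 by rewrite exprn_gt0// lt_neqAle eq_sym ha cmod_ge0.
have e0 : 0 < cmod (h a) ^+ 2 / 2 by rewrite divr_gt0.
have [r r0 hr] := sq_continuous (H2_holo hH Da) e0.
have [l1 hl1] := dyadic_in_nbhs oD Da.
have r4 : 0 < r / 4 by rewrite divr_gt0.
have [l2 hl2] := pow2_small r4; pose l := maxn l1 l2.
pose v := dyadic_index l (tov a); have av : dyadic l v (tov a) by exact/dyadicP.
have QD : dyadic l v `<=` D' by move=> t; exact: hl1 (leq_maxl _ _) v t av.
have : (\int[mu]_(t in dyadic l v) (cst (cmod (h a) ^+ 2 / 2)%:E) t <= sqint h)%E.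
  apply: (@le_trans _ _ (\int[mu]_(t in dyadic l v) (cmod (h (vec t)) ^+ 2)%:E)%E).
    apply: ge0_le_integral => //.
    - exact: measurable_dyadic.
    - by move=> t _; rewrite lee_fin ltW.
    - exact: (measurable_funS mD QD (measurable_sq oD (H2_holo hH))).
    - move=> t Qt; have := lt_of_quarter r0 (hl2 l (leq_maxr _ _)) (dyadic_nrm av Qt).
      move=> /hr; rewrite [a + _]addrC subrK lee_fin ler_norml => /andP[+ _].
      by move=> /half_slack; rewrite addrC lerD2r.
  apply: ge0_subset_integral => //.
  - exact: measurable_dyadic.
  - exact: measurable_sq (H2_holo hH).
  - by move=> t _; rewrite lee_fin sqr_ge0.
rewrite h0 integral_cst; last exact: measurable_dyadic.
rewrite [X in (_ * X <= _)%E](_ : _ = ((2 ^- l) ^+ (n + n))%:E); last exact: measure_dyadic.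
rewrite -EFinM lee_fin leNgt => /negP; apply.
by rewrite mulr_gt0// exprn_gt0// invr_gt0 exprn_gt0.
Qed.

Lemma inner_self_eq0 h : H2 D h -> << h, h >> = 0 -> forall z, D z -> h z = 0.
Proof.
move=> hH; rewrite inner_self => /(congr1 (@complex.Re R)) /= h0.
apply: sqint_eq0 => //; have [_ hf] := (H2P h).1 hH.
rewrite -[sqint h]fineK ?h0// ge0_fin_numE//.
by apply: integral_ge0 => t _; rewrite lee_fin sqr_ge0.
Qed.

End bergman.

(** * The unitary operator of an automorphism *)

Section isometry.
Context {R : realType} {n' : nat}.
Local Notation n := n'.+1.
Local Notation vec := (@vec_of_tuple R n).
Context (D : set (Cn R n)) (oD : open D)
  (Dfin : (lebesgue_Cn R n (vec @^-1` D) < +oo)%E).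
Implicit Types (h g p : Cn R n -> Cx R) (f F : Cn R n -> Cn R n).
Local Notation "<< h , g >>" := (L2_inner D h g).

Definition biholomorphic f F := [/\ holomorphic D f, holomorphic D F,
  (forall z, D z -> D (f z)), (forall z, D z -> D (F z)) &
  (forall z, D z -> F (f z) = z) /\ (forall z, D z -> f (F z) = z)].

Lemma biholomorphic_sym f F : biholomorphic f F -> biholomorphic F f.
Proof. by move=> [? ? ? ? [? ?]]. Qed.

Lemma transportK f F h z : biholomorphic f F -> D z ->
  transport F (transport f h) z = h z.
Proof.
move=> [fh Fh fD FD [fK FK]] Dz; rewrite /transport FK// mulrA -det_mulmx.
by rewrite (jac_inverse oD Fh fh FD FK Dz) det1 mul1r.
Qed.

Lemma sqint_transport_le f F h : biholomorphic f F -> holomorphic D h ->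
  (sqint D h <= sqint D (transport f h))%E.
Proof.
move=> [fh Fh fD FD [fK FK]] hh.
exact: (change_of_variables_le oD fh Fh fD FD fK FK hh Dfin).
Qed.

Lemma eq_sqint h g : (forall z, D z -> h z = g z) -> sqint D h = sqint D g.
Proof. by move=> hg; apply: eq_integral => t; rewrite inE => Dt; rewrite hg. Qed.

(** The second inequality is the first one for [F] and the function [transport f h], which [F]
    transports back to [h]. *)
Lemma sqint_transport f F h : biholomorphic f F -> holomorphic D h ->
  sqint D (transport f h) = sqint D h.
Proof.
move=> fF hh; apply/eqP; rewrite eq_le (sqint_transport_le fF hh) andbT.
have [fh _ fD _ _] := fF.
have := sqint_transport_le (biholomorphic_sym fF) (transport_holomorphic oD fh fD hh).
have E := eq_sqint (fun z Dz => @transportK f F h z fF Dz).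
by rewrite E.
Qed.

Lemma transport_H2 f F h : biholomorphic f F -> H2 D h -> H2 D (transport f h).
Proof.
move=> fF /(H2P oD)[hh hf]; apply/(H2P oD); have [fh _ fD _ _] := fF.
split; first exact: (transport_holomorphic oD fh fD hh).
rewrite (sqint_transport fF hh); exact: hf.
Qed.

(** Polarisation: the equality of norms is used for [h + c g] with [c = 1] and [c = Ic], which
    determines both inner products. *)
Lemma inner_transport f F h g : biholomorphic f F -> H2 D h -> H2 D g ->
  << transport f h, transport f g >> = << h, g >>.
Proof.
move=> fF hH gH.
have WH := transport_H2 fF.
have N k : H2 D k -> << transport f k, transport f k >> = << k, k >>.
  by move=> kH; rewrite !inner_self (sqint_transport fF (H2_holo kH)).
have EX c h1 g1 : H2 D h1 -> H2 D g1 ->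
    << fun z => h1 z + c * g1 z, fun z => h1 z + c * g1 z >> =
    << h1, h1 >> + c^* * << h1, g1 >> + (c * << g1, h1 >> + c * (c^* * << g1, g1 >>)).
  move=> h1H g1H; have cg1 := H2Z oD c g1H; have hg := H2D oD h1H cg1.
  by rewrite (innerDl oD h1H cg1 hg) (innerZl oD c g1H hg)
     !(innerDr oD h1H cg1)// !(innerZr oD c g1H)// mulrDr.
have EW c : c^* * << transport f h, transport f g >> + c * << transport f g, transport f h >> =
    c^* * << h, g >> + c * << g, h >>.
  have kH := H2D oD hH (H2Z oD c gH); have := N _ kH.
  rewrite EX// (_ : L2_inner _ _ _ = << fun z => transport f h z + c * transport f g z,
     fun z => transport f h z + c * transport f g z >>); last first.
    by apply: eq_inner => z _; rewrite /transport mulrDr mulrCA.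
  rewrite EX; [|exact: WH|exact: WH]; rewrite (N h hH) (N g gH) !addrA.
  by move=> /addIr; rewrite -!addrA => /addrI.
have E1 := EW 1; have E2 := EW Ic; rewrite rmorph1 !mul1r in E1.
have cI : Ic^* = - Ic :> Cx R.
  by apply: eqCx; rewrite ?cRe_conj ?cIm_conj ?cReN ?cImN //= oppr0.
rewrite cI !mulNr in E2.
set A := << transport f h, _ >> in E1 E2 *; set B := << transport f g, _ >> in E1 E2.
set a := << h, _ >> in E1 E2 *; set b := << g, _ >> in E1 E2.
have I0 : Ic != 0 :> Cx R by rewrite -cmod_eq0 cmod_Ic oner_eq0.
have E3 : B - A = b - a.
  by apply: (mulfI I0); rewrite !mulrBr addrC E2 addrC.
have : 2 * A = 2 * a.
  have -> : 2 * A = (A + B) - (B - A) by ring.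
  by rewrite E1 E3; ring.
by apply: mulfI; rewrite pnatr_eq0.
Qed.

(** The orthogonal complement of M_k in H^2. *)
Definition orth k p := H2 D p /\ forall h, H2 D h -> ord h k -> << h, p >> = 0.

Lemma orthZ k c p : orth k p -> orth k (fun z => c * p z).
Proof.
move=> [pH op]; split=> [|h hH hk]; first exact: H2Z.
by rewrite (innerZr oD c pH hH) op// mulr0.
Qed.

Lemma orthB k p q : orth k p -> orth k q -> orth k (fun z => p z - q z).
Proof.
move=> [pH op] [qH oq]; split=> [|h hH hk]; first exact: H2B.
by rewrite (innerBr oD pH qH hH) op// oq// subr0.
Qed.

Lemma eq_orth k p q : H2 D q -> (forall z, D z -> p z = q z) -> orth k p -> orth k q.
Proof.
move=> qH pq [_ op]; split=> // h hH hk; rewrite -(op h hH hk).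
apply: eq_inner => z Dz; [reflexivity|exact/esym/pq].
Qed.

Lemma orth_ord_eq0 k p : orth k p -> ord p k -> forall z, D z -> p z = 0.
Proof. by move=> [pH op] pk; apply: (inner_self_eq0 oD pH); exact: op. Qed.

(** By unitarity, the inner product of [h] with [transport f p] is that of [transport F h] with [p],
    and [F] fixes 0, so [transport F h] remains in M_k. *)
Lemma orth_transport f F k p : biholomorphic f F -> D 0 -> f 0 = 0 -> orth k p ->
  orth k (transport f p).
Proof.
move=> fF D0 f0 [pH op]; have Ff := biholomorphic_sym fF.
have [fh Fh fD FD [fK FK]] := fF.
split=> [|h hH hk]; first exact: transport_H2 fF pH.
have FH := transport_H2 Ff hH.
rewrite -(op _ FH).
  rewrite -(inner_transport fF FH pH); apply: eq_inner => z Dz; last reflexivity.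
  exact/esym/(transportK _ Ff Dz).
have F0 : F 0 = 0 by rewrite -{1}f0 fK.
apply: (ordM0 (ord_comp (Fh _ D0) F0 hk)).
exact: (det_jac_holomorphic oD Fh D0).
Qed.

End isometry.

(** * Averages over the circle action *)

Section roots_of_unity.
Context {R : realType}.
Implicit Types (t : R).

Lemma cisND s t : cisN (s + t) = cisN s * cisN t :> Cx R.
Proof.
apply: eqCx; rewrite ?cReM ?cImM /= ?cosD ?sinD; last by ring.
by rewrite mulrNN.
Qed.

Lemma cisN_pow (k : nat) t : cisN (k%:R * t) = cisN t ^+ k :> Cx R.
Proof.
elim: k => [|k IH]; first by rewrite mul0r cisN0.
by rewrite -natr1 mulrDl mul1r cisND IH exprSr.
Qed.

Definition wroot (N : nat) : Cx R := cisN (2 * pi / N%:R).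

Lemma wroot_pow N k : wroot N ^+ k = cisN (2 * pi * k%:R / N%:R).
Proof. by rewrite -cisN_pow; congr cisN; rewrite mulrA [k%:R * _]mulrC. Qed.

Lemma wrootN N : (0 < N)%N -> wroot N ^+ N = 1.
Proof. by move=> N0; rewrite wroot_pow mulfK ?cisN2pi// pnatr_eq0 -lt0n. Qed.

Lemma wroot_neq1 N d : (0 < d < N)%N -> wroot N ^+ d != 1.
Proof.
move=> /andP[d0 dN]; rewrite wroot_pow; apply/eqP => /(congr1 (@complex.Re R)) /=.
have N0 : (0 : R) < N%:R by rewrite ltr0n (leq_trans _ dN).
have pi0 := pi_gt0 R.
pose y : R := pi * (d%:R / N%:R).
have y0 : 0 < y < pi.
  have q1 : d%:R / N%:R < 1 :> R by rewrite ltr_pdivrMr// mul1r ltr_nat.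
  have q0 : 0 < d%:R / N%:R :> R by rewrite divr_gt0// ltr0n.
  by rewrite mulr_gt0//= -[X in _ < X]mulr1 ltr_pM2l.
have -> : 2 * pi * d%:R / N%:R = y + y by rewrite /y; field; exact: lt0r_neq0.
rewrite cosD => E; have := sin_gt0_pi y0 => sy.
have := cos2Dsin2 y; rewrite !expr2 => E2.
have : 0 < sin y * sin y by rewrite mulr_gt0.
lra.
Qed.

Lemma wroot_neq0 N : wroot N != 0.
Proof. by rewrite -cmod_eq0 cmod_cisN oner_eq0. Qed.

(** A geometric sum whose ratio is the root of unity to the power M - K. This ratio is not 1,
    because M - K is nonzero and smaller than N in absolute value. *)
Lemma wroot_sum (N M K : nat) : (M != K)%N -> (M + K < N)%N ->
  \sum_(j < N) (wroot N ^+ j) ^- K * (wroot N ^+ j) ^+ M = 0.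
Proof.
move=> MK MKN; pose x := wroot N ^- K * wroot N ^+ M.
have w0 := wroot_neq0 N; have N0 : (0 < N)%N by exact: leq_ltn_trans MKN.
have -> : \sum_(j < N) (wroot N ^+ j) ^- K * (wroot N ^+ j) ^+ M = \sum_(j < N) x ^+ j.
  by apply: eq_bigr => j _; rewrite exprMn exprVn -!exprM ![(_ * j)%N]mulnC.
have xN : x ^+ N = 1.
  by rewrite exprMn exprVn -!exprM ![(_ * N)%N]mulnC !exprM wrootN// !expr1n invr1 mulr1.
have x1 : x - 1 != 0.
  rewrite subr_eq0 /x; apply/eqP => /(congr1 (fun y => wroot N ^+ K * y)).
  rewrite mulrA divff ?expf_neq0// mul1r mulr1.
  have [lt|lt|E] := ltngtP M K; last by rewrite E eqxx in MK.
    rewrite -(subnKC (ltnW lt)) exprD -{1}[wroot N ^+ M]mulr1 => /(mulfI (expf_neq0 _ w0)).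
    move/esym/eqP; apply/negP/wroot_neq1; lia.
  rewrite -(subnKC (ltnW lt)) exprD -{2}[wroot N ^+ K]mulr1 => /(mulfI (expf_neq0 _ w0)).
  move/eqP; apply/negP/wroot_neq1; lia.
by apply: (mulfI x1); rewrite -subrX1 xN subrr mulr0.
Qed.

End roots_of_unity.

Lemma differentiable_mulmx (R : realType) (n : nat) (A : 'M[Cx R]_n) (z : Cn R n) :
  differentiable (fun w : Cn R n => w *m A) z.
Proof.
have lin : linear (fun w : Cn R n => w *m A) by move=> k v w; rewrite mulmxDl scalemxAl.
pose HL := GRing.isLinear.Build _ _ _ _ _ lin.
pose Lf : {linear Cn R n -> Cn R n} := HB.pack (fun w : Cn R n => w *m A) HL.
apply: (@linear_differentiable _ _ _ Lf).
apply: bounded_linear_continuous; apply/linear_boundedP.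
have K0 : 0 <= mx_abs A by apply: sumr_ge0 => j _; exact: sumr_ge0.
near=> M => v; rewrite !nrmE.
have KM : rC (mx_abs A) <= M.
  by near: M; apply: nbhs_pinfty_ge; apply: ger0_real; rewrite ler0c.
apply: le_trans (_ : rC (mx_abs A) * rC (nrm v) <= _); last first.
  by rewrite ler_wpM2r// ler0c nrm_ge0.
by rewrite -rCM lecR mulrC; exact: nrm_mulmx.
Unshelve. all: by end_near. Qed.

Section weighted_action.
Context {R : realType} {n : nat} (m : 'I_n -> nat).
Implicit Types (z v : Cn R n) (l : Cx R) (h : Cn R n -> Cx R) (q : mpoly n (Cx R)).

Definition wact l z : Cn R n := \row_i (l ^+ m i * z 0 i).

Lemma wactD l z v : wact l (z + v) = wact l z + wact l v.
Proof. by apply/rowP => i; rewrite !mxE mulrDr. Qed.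

Lemma wactM l k z : wact l (wact k z) = wact (l * k) z.
Proof. by apply/rowP => i; rewrite !mxE mulrA exprMn. Qed.

Lemma wact1 z : wact 1 z = z.
Proof. by apply/rowP => i; rewrite !mxE expr1n mul1r. Qed.

Lemma wact0 l : wact l 0 = 0.
Proof. by apply/rowP => i; rewrite !mxE mulr0. Qed.

Lemma wactE l z : wact l z = z *m diag_mx (\row_i l ^+ m i).
Proof. by apply/rowP => i; rewrite mul_mx_diag !mxE mulrC. Qed.

Lemma weighted_rotationE t z : weighted_rotation m (- t) z = wact (cisN t) z.
Proof.
apply/rowP => i; rewrite !mxE -cisN_pow; congr (_ * _).
by rewrite /cisN mulrN cosN sinN.
Qed.

Lemma nrm_wact l z : cmod l = 1 -> nrm (wact l z) = nrm z.
Proof.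
move=> l1; have le k w : cmod k = 1 -> nrm (wact k w) <= nrm w.
  move=> k1; apply: nrm_le (nrm_ge0 _) _ => i.
  by rewrite mxE cmodM cmodX k1 expr1n mul1r coord_le_nrm.
have l0 : l != 0 by rewrite -cmod_eq0 l1 oner_eq0.
apply/eqP; rewrite eq_le le//=; have := le l^-1 (wact l z).
by rewrite wactM mulVf// wact1; apply; rewrite cmodV l1 invr1.
Qed.

Lemma differentiable_wact l z : differentiable (wact l : Cn R n -> Cn R n) z.
Proof.
have -> : wact l = fun w => w *m diag_mx (\row_i l ^+ m i).
  by apply/funext => w; exact: wactE.
exact: differentiable_mulmx.
Qed.

Lemma monom_wact (al : multinom n) l z : monom al (wact l z) = l ^+ mdot m al * monom al z.
Proof.
rewrite /monom /mdot -prodrXr -big_split; apply: eq_bigr => i _ /=.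
by rewrite mxE exprMn exprM.
Qed.

End weighted_action.

Lemma double_prod_le (R : realDomainType) (x y : R) : 2 * (x * y) <= x ^+ 2 + y ^+ 2.
Proof.
rewrite -subr_ge0; have := sqr_ge0 (x - y).
by have -> : (x - y) ^+ 2 = x ^+ 2 + y ^+ 2 - 2 * (x * y) by ring.
Qed.

(** Cauchy-Schwarz against the constant vector 1. *)
Lemma sqr_sum_le (R : realFieldType) N (x : 'I_N -> R) : (\sum_j x j) ^+ 2 <= N%:R * \sum_j x j ^+ 2.
Proof.
elim: N x => [|N IH] x; first by rewrite !big_ord0 mul0r expr2 mul0r.
rewrite !big_ord_recr /=; set S := \sum_j _; set Q := \sum_j x _ ^+ 2; set y := x ord_max.
have h1 : S ^+ 2 <= N%:R * Q := IH _.
have h2 : 2 * (S * y) <= Q + N%:R * y ^+ 2.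
  have -> : 2 * (S * y) = \sum_(j < N) 2 * (x (widen_ord (leqnSn N) j) * y).
    by rewrite /S mulr_suml mulr_sumr.
  have -> : N%:R * y ^+ 2 = \sum_(j < N) y ^+ 2 by rewrite sumr_const card_ord mulr_natl.
  rewrite -big_split; apply: ler_sum => j _ /=.
  exact: double_prod_le.
have -> : (S + y) ^+ 2 = S ^+ 2 + 2 * (S * y) + y ^+ 2 by ring.
have -> : N.+1%:R * (Q + y ^+ 2) = N%:R * Q + (Q + N%:R * y ^+ 2) + y ^+ 2.
  by rewrite -natr1; ring.
by rewrite lerD2r; exact: lerD.
Qed.

Lemma quarter_half (R : realFieldType) (r : R) : 0 < r -> r / 4 + r / 2 < r.
Proof. by move=> ?; lra. Qed.

Section averages.
Context {R : realType} {n' : nat}.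
Local Notation n := n'.+1.
Local Notation T := ((n + n).-tuple (measurableTypeR R)).
Local Notation mu := (lebesgue_Cn R n).
Local Notation vec := (@vec_of_tuple R n).
Context (m : 'I_n -> nat) (D : set (Cn R n)) (oD : open D)
  (Dfin : (mu (vec @^-1` D) < +oo)%E) (cD : connected D) (D0 : D 0)
  (circ : quasi_circular m D).
Implicit Types (h g p : Cn R n -> Cx R) (z v w : Cn R n) (l : Cx R) (t : R) (N K : nat).
Local Notation "<< h , g >>" := (L2_inner D h g).
Local Notation rot l := (wact m l).

Let mD : measurable (vec @^-1` D) := open_measurable_Cn oD.

Lemma D_rot t z : D z -> D (rot (cisN t) z).
Proof. by rewrite -weighted_rotationE; exact: circ. Qed.

Lemma biholomorphic_rot t : biholomorphic D (rot (cisN t)) (rot (cisN (- t))).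
Proof.
have K s z : D z -> rot (cisN (- s)) (rot (cisN s) z) = z.
  by rewrite wactM -cisND addNr cisN0 wact1.
have H s : holomorphic D (rot (cisN s)) by move=> z _; exact: differentiable_wact.
split; [exact: H|exact: H|exact: D_rot|exact: D_rot|split; [exact: K|]].
by move=> z Dz; rewrite -{2}(K (- t) z Dz) opprK.
Qed.

Lemma jac_wact l z : jac (rot l) z = diag_mx (\row_i l ^+ m i).
Proof.
apply/matrixP => i j; rewrite mxE.
have -> : (fun w => rot l w 0 j) = fun w => (w *m diag_mx (\row_i l ^+ m i)) 0 j.
  by apply/funext => w; rewrite wactE.
exact: (mdiff_partialE (mdiff_mulmx _ z j)).
Qed.

Lemma transport_rot t h z : transport (rot (cisN t)) h z =
  (\prod_i cisN t ^+ m i) * h (rot (cisN t) z).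
Proof. by rewrite /transport jac_wact det_diag; congr (_ * _); apply: eq_bigr => i _; rewrite mxE. Qed.

Lemma cmod_prod_cisN t : cmod (\prod_i cisN t ^+ m i : Cx R) = 1.
Proof.
elim/big_rec: _ => [|i x _ E]; first exact: (cmod_nat 1).
by rewrite cmodM cmodX cmod_cisN expr1n mul1r.
Qed.

Lemma conj_unit l : cmod l = 1 -> l^* = l^-1.
Proof.
move=> l1; have l0 : l != 0 by rewrite -cmod_eq0 l1 oner_eq0.
by apply: (mulfI l0); rewrite divff// -normCK cmodE l1 expr1n.
Qed.

Lemma H2_rot t h : H2 D h -> H2 D (fun z => h (rot (cisN t) z)).
Proof.
move=> hH; have := transport_H2 oD Dfin (biholomorphic_rot t) hH.
move=> /(H2Z oD (\prod_i cisN t ^+ m i)^-1); congr (H2 D _); apply/funext => z.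
by rewrite transport_rot mulKf// -cmod_eq0 cmod_prod_cisN oner_eq0.
Qed.

Lemma inner_rot t h g : H2 D h -> H2 D g ->
  << fun z => h (rot (cisN t) z), fun z => g (rot (cisN t) z) >> = << h, g >>.
Proof.
move=> hH gH; rewrite -(inner_transport oD Dfin (biholomorphic_rot t) hH gH).
apply: eq_cintegral => z _; rewrite !transport_rot rmorphM /= (conj_unit (cmod_prod_cisN t)).
by rewrite mulrACA divff ?mul1r// -cmod_eq0 cmod_prod_cisN oner_eq0.
Qed.

Lemma sqint_rot t h : H2 D h -> sqint D (fun z => h (rot (cisN t) z)) = sqint D h.
Proof.
move=> hH; rewrite -(sqint_transport oD Dfin (biholomorphic_rot t) (H2_holo hH)).
by apply: eq_integral => s _; rewrite transport_rot cmodM cmod_prod_cisN mul1r.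
Qed.

(** A discrete projection onto weight [K]: applied to a polynomial whose weights M satisfy M + K <
    N, it keeps exactly the terms of weight K. For [N = 0] it is 0. *)
Definition avg K N h z := N%:R^-1 *
  \sum_(j < N) (wroot N ^+ j) ^- K * h (rot (wroot N ^+ j) z).

Lemma wroot_cisN N j : wroot N ^+ j = cisN (2 * pi * j%:R / N%:R) :> Cx R.
Proof. exact: wroot_pow. Qed.

Lemma cmod_wroot N j : cmod (wroot N ^+ j : Cx R) = 1.
Proof. by rewrite cmodX cmod_cisN expr1n. Qed.

Lemma H2_wroot N (j : nat) h : H2 D h -> H2 D (fun z => h (rot (wroot N ^+ j) z)).
Proof. by rewrite wroot_cisN; exact: H2_rot. Qed.

Lemma avg_H2 K N h : H2 D h -> H2 D (avg K N h).
Proof.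
by move=> hH; apply: (H2Z oD); apply: (H2_sum oD Dfin) => j; apply: (H2Z oD); exact: H2_wroot.
Qed.

(** Rotations are unitary and [p] has weight [K], so each of the [N] terms contributes exactly the
    inner product of [h] and [p]. *)
Lemma avg_inner K N h p : (0 < N)%N -> (forall l z, p (rot l z) = l ^+ K * p z) ->
  H2 D h -> H2 D p -> << avg K N h, p >> = << h, p >>.
Proof.
move=> N0 hp hH pH.
have sH (j : 'I_N) : H2 D (fun z => (wroot N ^+ j) ^- K * h (rot (wroot N ^+ j) z)).
  by apply: (H2Z oD); exact: H2_wroot.
rewrite (innerZl oD _ (H2_sum oD Dfin _ sH) pH) (inner_suml oD Dfin _ sH pH).
rewrite (eq_bigr (fun=> << h, p >>)) => [|j _].
  by rewrite sumr_const card_ord -[<< h, p >> *+ N]mulr_natl mulKf// pnatr_eq0 -lt0n.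
rewrite (innerZl oD _ (H2_wroot N j hH) pH).
have l0 : wroot N ^+ j != 0 :> Cx R by rewrite -cmod_eq0 cmod_wroot oner_eq0.
rewrite -[RHS](inner_rot (2 * pi * j%:R / N%:R) hH pH) -wroot_cisN.
have lK : cmod ((wroot N ^+ j) ^+ K : Cx R) = 1 by rewrite cmodX cmod_wroot expr1n.
rewrite -conj_unit// -(innerZr oD _ pH (H2_wroot N j hH)).
by apply: eq_cintegral => z _; rewrite hp.
Qed.

Lemma avg_sqint K N h : (0 < N)%N -> H2 D h -> (sqint D (avg K N h) <= sqint D h)%E.
Proof.
move=> N0 hH; have Nr : (0 : R) < N%:R by rewrite ltr0n.
pose G (j : 'I_N) (y : T) : \bar R := (N%:R^-1 * cmod (h (rot (wroot N ^+ j) (vec y))) ^+ 2)%:E.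
have G0 j y : (0 <= G j y)%E by rewrite lee_fin mulr_ge0 ?invr_ge0 ?sqr_ge0.
have mS j : measurable_fun (vec @^-1` D) (fun y => (cmod (h (rot (wroot N ^+ j) (vec y))) ^+ 2)%:E).
  exact: (measurable_sq oD (H2_holo (H2_wroot N j hH))).
have mG (j : 'I_N) : measurable_fun (vec @^-1` D) (G j).
  apply/measurable_EFinP; apply: measurable_funM; first exact: measurable_cst.
  by apply/measurable_EFinP; exact: mS.
apply: (@le_trans _ _ (\int[mu]_(y in vec @^-1` D) (\sum_(j < N) G j y))%E).
  apply: ge0_le_integral => //.
  - by move=> y _; rewrite lee_fin sqr_ge0.
  - exact: (measurable_sq oD (H2_holo (avg_H2 K N hH))).
  - exact: emeasurable_sum.
  - move=> y _; rewrite /G sumEFin lee_fin -mulr_sumr /avg cmodM cmodV cmod_nat exprMn.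
    apply: (@le_trans _ _ (N%:R^-1 ^+ 2 *
        (\sum_(j < N) cmod (h (rot (wroot N ^+ j) (vec y)))) ^+ 2)).
      rewrite ler_wpM2l ?sqr_ge0// lerXn2r ?nnegrE ?cmod_ge0 ?sumr_ge0//.
      apply: le_trans (cmod_sum _ _ _) _; apply: ler_sum => j _.
      by rewrite cmodM cmodV cmodX cmod_wroot expr1n invr1 mul1r.
    apply: le_trans (ler_wpM2l (sqr_ge0 _) (sqr_sum_le _)) _.
    by rewrite expr2 -mulrA mulKf// lt0r_neq0.
rewrite ge0_integral_sum//.
rewrite (eq_bigr (fun=> (N%:R^-1)%:E * sqint D h)%E) => [|j _]; last first.
  rewrite /G; under eq_integral do rewrite EFinM.
  rewrite ge0_integralZl_EFin ?invr_ge0//; last by move=> y _; rewrite lee_fin sqr_ge0.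
  by congr (_ * _)%E; have := sqint_rot (2 * pi * j%:R / N%:R) hH; rewrite -wroot_cisN.
rewrite -ge0_sume_distrl => [|j _]; last by rewrite lee_fin invr_ge0.
by rewrite sumEFin sumr_const card_ord -[_ *+ N]mulr_natl divff ?mul1e// lt0r_neq0.
Qed.

Lemma avg_peval K N (q : mpoly n (Cx R)) z : (forall al, mdot m al = K -> mcoeff al q = 0) ->
  (forall al, al \in msupp q -> (mdot m al + K < N)%N) -> avg K N (peval q) z = 0.
Proof.
move=> qK qN; rewrite /avg (eq_bigr (fun j : 'I_N => \sum_(al <- msupp q)
   mcoeff al q * monom al z * ((wroot N ^+ j) ^- K * (wroot N ^+ j) ^+ mdot m al))) => [|j _].
  rewrite exchange_big /= big_seq big1 ?mulr0// => al alq.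
  rewrite -mulr_sumr; have [E|neq] := eqVneq (mdot m al) K; first by rewrite qK// !mul0r.
  by rewrite wroot_sum ?mulr0// qN.
rewrite pevalE mulr_sumr; apply: eq_bigr => al _; rewrite monom_wact; ring.
Qed.

Lemma ord_sub h g k : ord (fun z => h z - g z) k -> (forall z, g z = 0) -> ord h k.
Proof. by move=> hg g0; apply: (@eq_ord _ _ _ _ _ 1) hg => // v _; rewrite g0 subr0. Qed.

(** For [N] large, averaging kills the Taylor polynomial of order [k], which has no term of weight
    [K]; the average of the rest still has order [k]. *)
Lemma avg_ord K h k : holomorphic D h ->
  (forall al, mdot m al = K -> multi_partial al h 0 = 0) ->
  exists N0, forall N, (N0 <= N)%N -> ord (avg K N h) k.
Proof.
move=> hh hK; pose q := taylor_poly k h.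
exists (\max_(al <- msupp q) (mdot m al + K)).+1 => N NN.
have aq z : avg K N (peval q) z = 0.
  apply: avg_peval => al alK; first by rewrite mcoeff_taylor_poly hK// mul0r if_same.
  by apply: leq_ltn_trans NN; rewrite (bigD1_seq al) ?msupp_uniq//= leq_maxl.
apply: (ord_sub _ aq); have hq := ord_taylor_poly k oD D0 hh.
have := @ordZ _ _ _ k N%:R^-1 (@ord_sum R n _ (index_enum 'I_N) (fun (j : 'I_N) z =>
   (wroot N ^+ j) ^- K * (h (rot (wroot N ^+ j) z) - peval q (rot (wroot N ^+ j) z))) k _).
move=> H; apply: (@eq_ord _ _ _ _ _ 1 ltr01 _ (H _)) => [v _|j].
  rewrite /avg -mulrBr -sumrB; congr (_ * _); apply: eq_bigr => j _; exact: mulrBr.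
apply: ordZ; apply: (ord_comp (f := rot (wroot N ^+ j)) _ _ hq); first exact: differentiable_wact.
exact: wact0.
Qed.

Lemma cisN_continuous_pow k t (e : R) : 0 < e -> exists2 r : R, 0 < r &
  forall s, `|s| < r -> cmod (cisN (t + s) ^+ k - cisN t ^+ k) <= e.
Proof. exact: ccts_cisNX. Qed.

Lemma rot_continuous z t (e : R) : 0 < e -> exists2 r : R, 0 < r &
  forall s, `|s| < r -> nrm (rot (cisN (t + s)) z - rot (cisN t) z) <= e.
Proof.
move=> e0; have e1 : 0 < e / (nrm z + 1) by rewrite divr_gt0// ltr_wpDl// nrm_ge0.
pose P (i : 'I_n) (j : nat) := forall s : R, `|s| < 2 ^- j ->
  cmod (cisN (t + s) ^+ m i - cisN t ^+ m i) <= e / (nrm z + 1).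
have [i|N hN] := @fin_eventually n P.
  have [r r0 hr] := cisN_continuous_pow (m i) t e1.
  have [N hN] := pow2_small r0; exists N => j Nj s sj.
  by apply: hr; apply: lt_le_trans sj (hN _ Nj).
exists (2 ^- N); first by rewrite invr_gt0 exprn_gt0.
move=> s sN; apply: nrm_le => [|i]; first exact: ltW.
rewrite !mxE -mulrBl cmodM mulrC; apply: le_trans (ler_succ_div (nrm_ge0 z) (ltW e0)).
by apply: ler_pM => //; [exact: coord_le_nrm|exact: (hN N (leqnn _) i)].
Qed.

(** Compactness of the interval of angles turns the local bounds at the points of the orbit into a
    uniform one. *)
Lemma orbit_bounded h z : holomorphic D h -> D z -> exists d M : R, [/\ 0 < d, 0 <= M &
  forall t v, 0 <= t <= 2 * pi -> nrm v < d -> cmod (h (rot (cisN t) (z + v))) <= M].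
Proof.
(* One integer [k] encodes both the radius and the bound, so that [P] weakens as [k] grows and fits
   the covering property with the filter [\oo]. *)
move=> hh Dz; pose P (k : nat) (t : R) := forall v, nrm v < 2 ^- k ->
  cmod (h (rot (cisN t) (z + v))) <= k%:R.
have cK := (compact_near_coveringP _).1 (@segment_compact R 0 (2 * pi)).
have [|N _ hN] := cK nat \oo P _.
  move=> t _; have Dt := D_rot t Dz.
  have [r r0 hr] := differentiable_locally_bounded (hh _ Dt).
  have r2 : 0 < r / 2 by rewrite divr_gt0.
  have r4 : 0 < r / 4 by rewrite divr_gt0.
  have [d d0 hd] := rot_continuous z t r4.
  have [N1 hN1] := pow2_small r2.
  pose N2 := Num.bound (cmod (h (rot (cisN t) z)) + 1).
  exists ([set s | `|t - s| < d], [set k | (maxn N1 N2 <= k)%N]).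
    split; last by exists (maxn N1 N2).
    by apply/nbhs_ballP; exists d.
  move=> [s k] [/= sd]; rewrite geq_max => /andP[k1 k2] v vk.
  have B0 : 0 <= cmod (h (rot (cisN t) z)) + 1 by rewrite addr_ge0.
  apply: (@le_trans _ _ (cmod (h (rot (cisN t) z)) + 1)); last first.
    by apply: le_trans (ltW (archi_boundP B0)) _; rewrite ler_nat.
  have E : rot (cisN s) (z + v) = rot (cisN t) z +
      ((rot (cisN (t + (s - t))) z - rot (cisN t) z) + rot (cisN s) v).
    have gen (a b c : Cn R n) : b + c = a + ((b - a) + c) by rewrite addrA subrKC.
    rewrite (subrKC t s) wactD; exact: gen.
  rewrite E; apply: hr; apply: le_lt_trans (nrmD _ _) _.
  rewrite nrm_wact ?cmod_cisN//.
  have h1 : nrm (rot (cisN (t + (s - t))) z - rot (cisN t) z) <= r / 4.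
    by apply: hd; rewrite distrC.
  have h2 : nrm v < r / 2 by apply: lt_le_trans vk (hN1 _ k1).
  by apply: le_lt_trans (quarter_half r0); exact: lerD h1 (ltW h2).
exists (2 ^- N), N%:R; split=> //.
by move=> t v tI vN; apply: (hN N) => //=.
Qed.

Lemma avg_bounded K h z : holomorphic D h -> D z -> exists d M : R, 0 < d /\
  forall N v, nrm v < d -> cmod (avg K N h (z + v)) <= M.
Proof.
move=> hh Dz; have [d [M [d0 M0 hM]]] := orbit_bounded hh Dz.
exists d, M; split=> // N v vd; rewrite /avg.
have [->|N0] := posnP N; first by rewrite big_ord0 mulr0 cmod0.
have Nr : (0 : R) < N%:R by rewrite ltr0n.
rewrite cmodM cmodV cmod_nat ler_pdivrMl//.
apply: le_trans (cmod_sum _ _ _) _.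
apply: (@le_trans _ _ (\sum_(j < N) M)); last by rewrite sumr_const card_ord mulr_natl.
apply: ler_sum => j _; rewrite cmodM cmodV cmodX cmod_wroot expr1n invr1 mul1r wroot_cisN.
apply: hM => //; have pi0 := pi_gt0 R; apply/andP; split.
  by rewrite !mulr_ge0 ?invr_ge0// ltW.
rewrite ler_pdivrMr// ler_wpM2l ?mulr_ge0 ?(ltW pi0)// ler_nat; exact: ltnW.
Qed.

(** The averages are locally bounded uniformly in [N]. Near 0 they vanish to an order that tends to
    infinity, so [ord_decay] gives uniform convergence there, and [vitali] extends it to [D]. *)
Lemma avg_cvg0 K h z (e : R) : holomorphic D h ->
  (forall al, mdot m al = K -> multi_partial al h 0 = 0) -> D z -> 0 < e ->
  exists N0, forall N, (N0 <= N)%N -> cmod (avg K N h z) <= e.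
Proof.
move=> hh hK Dz e0; have H2D' : forall N, holomorphic D (avg K N h).
  move=> N; apply: holomorphicM; first by move=> w _; exact: differentiable_cst.
  apply: holomorphic_sum => j; apply: holomorphicM; first by move=> w _; exact: differentiable_cst.
  move=> w Dw; apply: (@differentiable_comp _ _ _ _ (rot (wroot N ^+ j)) h w).
    exact: differentiable_wact.
  by apply: hh; rewrite wroot_cisN; exact: D_rot.
apply: (vitali oD cD D0 H2D' _ _ Dz e0) => [w Dw|]; first exact: avg_bounded.
have [d [M [d0 hM]]] := avg_bounded K hh D0.
have [r1 r10 hr1] := (openCnP D).1 oD 0 D0.
pose r := Num.min r1 d / 2; have r0 : 0 < r by rewrite divr_gt0// lt_min r10.
have r2E : 2 * r = Num.min r1 d by rewrite /r mulrC divfK.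
have M0 : 0 <= M.
  by apply: le_trans (hM 0%N 0 _); [exact: cmod_ge0|rewrite nrm0].
exists (r / 2) => [|e' e'0]; first by rewrite divr_gt0.
have [k hk] := geometric_small M0 e'0.
have [N0 hN] := avg_ord k.+1 hh hK; exists N0 => N NN v vr.
apply: le_trans hk; apply: (ord_decay r0) (hN N NN) vr => w; rewrite r2E lt_min => /andP[w1 w2].
  by apply: H2D'; rewrite -[w]add0r; exact: hr1.
by rewrite -[w]add0r; exact: hM.
Qed.

End averages.

Lemma le_min_sq (R : realFieldType) (x A : R) : 0 <= x -> 0 < A ->
  x <= Num.min x A + A^-1 * x ^+ 2.
Proof.
move=> x0 A0; have q0 : 0 <= A^-1 * x ^+ 2 by rewrite mulr_ge0 ?sqr_ge0// invr_ge0 ltW.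
have [xA|Ax] := leP x A; first by rewrite lerDl.
apply: ler_wpDl; first exact: ltW.
by rewrite ler_pdivlMl// expr2 ler_wpM2r// ltW.
Qed.

(** * Orthogonality between different weights *)

Section weight_orthogonality.
Context {R : realType} {n' : nat}.
Local Notation n := n'.+1.
Local Notation T := ((n + n).-tuple (measurableTypeR R)).
Local Notation mu := (lebesgue_Cn R n).
Local Notation vec := (@vec_of_tuple R n).
Context (m : 'I_n -> nat) (D : set (Cn R n)) (oD : open D)
  (Dfin : (mu (vec @^-1` D) < +oo)%E) (cD : connected D) (D0 : D 0)
  (circ : quasi_circular m D).
Implicit Types (h g p : Cn R n -> Cx R) (z : Cn R n) (N K : nat) (A B : R).
Local Notation "<< h , g >>" := (L2_inner D h g).
Local Notation D' := (vec @^-1` D).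

Let mD : measurable D' := open_measurable_Cn oD.

Lemma measurable_cmod g : holomorphic D g ->
  measurable_fun D' (fun t => (cmod (g (vec t)))%:E).
Proof.
move=> gh; apply/measurable_EFinP.
apply: (@measurable_fun_Cn _ _ _ (fun z => cmod (g z))) => // z Dz e e0.
have [r r0 hr] := continuous_coord_real (gh z Dz) e0; exists r => // v /hr.
apply: le_trans; rewrite ler_norml lerNl opprB {1}cmod_distC.
by apply/andP; split; exact: cmod_sub.
Qed.

Let min_part A g : \bar R := (\int[mu]_(t in D') (Num.min (cmod (g (vec t))) A)%:E)%E.

Lemma measurable_min_part A g : holomorphic D g ->
  measurable_fun D' (fun t => (Num.min (cmod (g (vec t))) A)%:E).
Proof.
move=> gh; rewrite (_ : (fun _ => _) =
    fun t => Order.min (cmod (g (vec t)))%:E (cst A%:E t)).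
  exact: (measurable_mine (measurable_cmod gh) (measurable_cst _)).
by apply/funext => t; rewrite EFin_min.
Qed.

(** Truncation at height [A], the excess being controlled by the square. For averages, the first
    term tends to 0 with [N] and the second is uniformly small for large [A]. *)
Lemma int_cmod_le A g : 0 < A -> H2 D g ->
  (\int[mu]_(t in D') (cmod (g (vec t)))%:E <= min_part A g + (A^-1)%:E * sqint D g)%E.
Proof.
move=> A0 gH; have gh := H2_holo gH; have Ai : 0 <= A^-1 by rewrite invr_ge0 ltW.
have m1 := measurable_min_part A gh; have m2 := measurable_sq oD gh.
have m3 : measurable_fun D' (fun t => (A^-1)%:E * (cmod (g (vec t)) ^+ 2)%:E)%E.
  exact: measurable_funeM.
rewrite -ge0_integralZl_EFin//; last by move=> t _; rewrite lee_fin sqr_ge0.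
rewrite -ge0_integralD//; last 2 first.
- by move=> t _; rewrite lee_fin le_min cmod_ge0 ltW.
- by move=> t _; rewrite -EFinM lee_fin mulr_ge0// sqr_ge0.
apply: ge0_le_integral => //.
- by move=> t _; rewrite lee_fin cmod_ge0.
- exact: measurable_cmod.
- exact: emeasurable_funD.
- by move=> t _; rewrite -EFinM -EFinD lee_fin; apply: le_min_sq.
Qed.

Lemma abs_Rintegral_le (a : T -> R) (b : T -> R) : mu.-integrable D' (EFin \o a) ->
  measurable_fun D' (EFin \o b) ->
  (forall t, D' t -> `|a t| <= b t) ->
  (`|\int[mu]_(t in D') a t|%:E <= \int[mu]_(t in D') (b t)%:E)%E.
Proof.
move=> ia mb ab; have /integrableP[ma _] := ia.
have -> : `|\int[mu]_(t in D') a t|%:E = (`|\int[mu]_(t in D') (EFin \o a) t|)%E.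
  by rewrite -[in RHS](fineK (integrable_fin_num mD ia)).
apply: le_trans (le_abse_integral mu mD ma) _; apply: ge0_le_integral => //.
- exact: measurableT_comp.
Qed.

Lemma cmod_inner_le g p B : H2 D g -> H2 D p -> 0 <= B ->
  (forall z, D z -> cmod (p z) <= B) ->
  ((cmod << g, p >>)%:E <= (2 * B)%:E * \int[mu]_(t in D') (cmod (g (vec t)))%:E)%E.
Proof.
move=> gH pH B0 pB; have [i1 i2] := inner_integrable oD gH pH.
have mg := measurable_cmod (H2_holo gH).
have mb : measurable_fun D' (EFin \o (fun t => B * cmod (g (vec t)))).
  exact: (measurable_funeM B%:E mg).
have bd t : D' t -> cmod (g (vec t) * (p (vec t))^* ) <= B * cmod (g (vec t)).
  by move=> Dt; rewrite cmodM cmod_conj mulrC ler_wpM2r// pB.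
have h1 := abs_Rintegral_le i1 mb (fun t Dt => le_trans (ler_Re_cmod _) (bd t Dt)).
have h2 := abs_Rintegral_le i2 mb (fun t Dt => le_trans (ler_Im_cmod _) (bd t Dt)).
have E : (\int[mu]_(t in D') (B * cmod (g (vec t)))%:E =
    B%:E * \int[mu]_(t in D') (cmod (g (vec t)))%:E)%E.
  under eq_integral do rewrite EFinM.
  by rewrite ge0_integralZl_EFin// => t _; rewrite lee_fin cmod_ge0.
rewrite E in h1 h2; apply: (@le_trans _ _ (`|complex.Re << g, p >>|%:E + `|complex.Im << g, p >>|%:E)%E).
  by rewrite -EFinD lee_fin; exact: cmod_le_ReIm.
rewrite (_ : 2 * B = B + B); last by ring.
rewrite EFinD ge0_muleDl ?lee_fin//; exact: leeD h1 h2.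
Qed.

(** Dominated convergence: the truncated averages tend to 0 pointwise and are bounded by the
    constant [A], integrable on a set of finite measure. *)
Lemma avg_min_part_small K h A (d : R) : H2 D h ->
  (forall al, mdot m al = K -> multi_partial al h 0 = 0) -> 0 < A -> 0 < d ->
  exists2 N, (0 < N)%N & (min_part A (avg m K N h) < d%:E)%E.
Proof.
move=> hH hK A0 d0; pose f_ N (t : T) := (Num.min (cmod (avg m K N h (vec t))) A)%:E.
have aH N : H2 D (avg m K N h) := avg_H2 oD Dfin circ K N hH.
have mf N : measurable_fun D' (f_ N) := measurable_min_part A (H2_holo (aH N)).
have f0 t : D' t -> f_ ^~ t @ \oo --> 0%E.
  move=> Dt; apply/fine_cvgP; split; first exact: nearW.
  apply/cvgr0Pnorm_le => e e0.
  have [N0 hN] := avg_cvg0 oD cD D0 circ (H2_holo hH) hK Dt e0.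
  exists N0 => // N /= /hN aN; rewrite ger0_norm ?le_min ?cmod_ge0 ?(ltW A0)//.
  by rewrite ge_min aN.
have iA : mu.-integrable D' (cst A%:E).
  apply/integrableP; split; first exact: measurable_cst.
  rewrite (eq_integral (cst A%:E)) => [|t _]; last by rewrite gee0_abs// lee_fin ltW.
  by rewrite integral_cst// lte_mul_pinfty// lee_fin ltW.
have fA t N : D' t -> (`|f_ N t| <= cst A%:E t)%E.
  move=> _; rewrite gee0_abs ?lee_fin ?le_min ?cmod_ge0 ?(ltW A0)//.
  by rewrite ge_min lexx orbT.
have [_ _] := dominated_convergence mD mf (measurable_cst 0%E : measurable_fun D' (cst 0%E))
  (aeW mu f0) iA (aeW mu (fun t N Dt => fA t N Dt)).
rewrite integral0 => H.
have nb : nbhs 0%E [set x : \bar R | (x < d%:E)%E].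
  by apply: open_nbhs_nbhs; split; [exact: open_ereal_lt_ereal|rewrite /= lte_fin].
have [N0 _ hN] := H _ nb; exists N0.+1 => //.
exact: (hN N0.+1 (leqnSn _)).
Qed.

Lemma orthogonal_weight K (q : mpoly n (Cx R)) h B :
  (forall al, mcoeff al q != 0 -> mdot m al = K) -> H2 D (peval q) -> 0 <= B ->
  (forall z, D z -> cmod (peval q z) <= B) -> H2 D h ->
  (forall al, mdot m al = K -> multi_partial al h 0 = 0) -> << h, peval q >> = 0.
Proof.
move=> qK qH B0 qB hH hK; apply/eqP; rewrite -cmod_eq0 eq_le cmod_ge0 andbT.
have hom l z : peval q (wact m l z) = l ^+ K * peval q z.
  rewrite !pevalE mulr_sumr big_seq [RHS]big_seq; apply: eq_bigr => al.
  by rewrite mcoeff_msupp monom_wact => /qK ->; ring.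
apply/ler_addgt0Pr => e e0; rewrite add0r.
have [_ hf] := (H2P oD h).1 hH.
have s0 : (0 <= sqint D h)%E by apply: integral_ge0 => t _; rewrite lee_fin sqr_ge0.
pose S := fine (sqint D h); have S0 : 0 <= S by exact: fine_ge0.
have SE : sqint D h = S%:E by rewrite /S fineK// ge0_fin_numE.
have e2 : 0 < e / 2 by rewrite divr_gt0.
have B2 : 0 <= 2 * B by rewrite mulr_ge0.
have BS : 0 <= 2 * B * S by rewrite mulr_ge0.
(* Large enough for the excess over [A] to contribute at most [e / 2], whatever [N]; only then is
   [N] chosen for the truncated part. *)
pose A := (2 * B * S + 1) / (e / 2).
have A0 : 0 < A by rewrite divr_gt0// ltr_wpDl.
have A1 : 2 * B * (A^-1 * S) <= e / 2.
  have := ler_succ_div BS (ltW e2); rewrite /A invf_div.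
  by rewrite [leLHS](_ : _ = 2 * B * (e / 2 / (2 * B * S + 1) * S))//; ring.
have d0 : 0 < e / 2 / (2 * B + 1) by rewrite divr_gt0// ltr_wpDl.
have [N N0 hN] := avg_min_part_small hH hK A0 d0.
have aH := avg_H2 oD Dfin circ K N hH.
rewrite -lee_fin -(avg_inner oD Dfin circ N0 hom hH qH).
apply: le_trans (cmod_inner_le aH qH B0 qB) _.
apply: (@le_trans _ _ ((2 * B)%:E * (((e / 2 / (2 * B + 1)) + A^-1 * S)%:E))%E).
  apply: lee_wpmul2l; first by rewrite lee_fin.
  apply: le_trans (int_cmod_le A0 aH) _; rewrite EFinD; apply: leeD; first exact: ltW.
  rewrite EFinM -SE; apply: lee_wpmul2l; first by rewrite lee_fin invr_ge0 ltW.
  exact: (avg_sqint oD Dfin circ K N0 hH).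
rewrite -EFinM lee_fin mulrDr [leRHS](splitr e); apply: lerD A1.
exact: ler_succ_div B2 (ltW e2).
Qed.

End weight_orthogonality.

(** * Extremal degrees, bounded domains and multi-indices of a given weight *)

Section extremal_elements.
Implicit Types (A : set nat) (k : nat).

Lemma set_minP A k : A k -> A (set_min A) /\ forall j, A j -> (set_min A <= j)%N.
Proof.
move=> Ak; have exA : exists j, `[< A j >] by exists k; apply/asboolP.
apply: (@xgetPex _ 0%N [set l | A l /\ forall j, A j -> (l <= j)%N]).
have [l /asboolP Al lmin] := ex_minnP exA.
by exists l; split=> // j Aj; apply: lmin; apply/asboolP.
Qed.

(** The bound [b] ensures that a greatest element exists; on an unbounded set [set_max] is its
    default 0. *)
Lemma le_set_max A b : (forall j, A j -> (j <= b)%N) -> forall j, A j -> (j <= set_max A)%N.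
Proof.
move=> Ab k Ak; have exA : exists j, `[< A j >] by exists k; apply/asboolP.
suff [_] : A (set_max A) /\ forall j, A j -> (j <= set_max A)%N by apply.
apply: (@xgetPex _ 0%N [set l | A l /\ forall j, A j -> (j <= l)%N]).
have bA j : `[< A j >] -> (j <= b)%N by move=> /asboolP/Ab.
have [l /asboolP Al lmax] := ex_maxnP exA bA.
by exists l; split=> // j Aj; apply: lmax; apply/asboolP.
Qed.

End extremal_elements.

Section bounded_domains.
Context {R : realType} {n : nat}.
Implicit Types (D : set (Cn R n)) (q : mpoly n (Cx R)).

Lemma bounded_nrm D : bounded_set D -> exists2 M : R, 0 <= M & forall z, D z -> nrm z <= M.
Proof.
move=> [M [Mr HM]]; have MM : M < M + 1 by rewrite ltrDl.
have H := HM _ MM; exists `|complex.Re (M + 1)|; first exact: normr_ge0.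
move=> z /H; rewrite /= nrmE lecE => /andP[_] /le_trans; apply; exact: ler_norm.
Qed.

Lemma bounded_measure D : open D -> bounded_set D ->
  (lebesgue_Cn R n (@vec_of_tuple R n @^-1` D) < +oo)%E.
Proof.
move=> oD /bounded_nrm[M M0 DM]; have M1 : 0 <= M + 1 by rewrite addr_ge0.
apply: (@le_lt_trans _ _ (lam (Cube (M + 1)))); last by rewrite lam_Cube// ltry.
apply: lam_le; [exact: open_measurable_Cn|exact: meas_Cube|].
by move=> z /DM zM; apply: nrm_lt_Cube; rewrite ltr_pwDr.
Qed.

Lemma bounded_peval D q : bounded_set D -> exists2 B : R, 0 <= B &
  forall z, D z -> cmod (peval q z) <= B.
Proof.
move=> /bounded_nrm[M M0 DM].
exists (\sum_(al <- msupp q) cmod (mcoeff al q) * M ^+ mdeg al).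
  by apply: sumr_ge0 => al _; rewrite mulr_ge0 ?exprn_ge0 ?cmod_ge0.
move=> z /DM zM; rewrite pevalE; apply: le_trans (cmod_sum _ _ _) _.
apply: ler_sum => al _; rewrite cmodM ler_wpM2l ?cmod_ge0// /monom mdegE -prodrXr.
elim/big_ind2 : _ => [|x a y b xa yb|i _]; first by rewrite (cmod_nat 1).
  by rewrite cmodM; apply: ler_pM => //; exact: cmod_ge0.
rewrite cmodX lerXn2r ?nnegrE ?cmod_ge0//; exact: le_trans (coord_le_nrm _ _) zM.
Qed.

Lemma peval_H2 D q : open D -> bounded_set D -> H2 D (peval q).
Proof.
move=> oD bD; have [B _ qB] := bounded_peval q bD.
exact: (H2_bounded oD (bounded_measure oD bD) (@peval_holomorphic R n D q) qB).
Qed.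

End bounded_domains.

Section weighted_multinomials.
Context {R : realType} {n : nat} (m : 'I_n -> nat) (m_gt0 : forall i, (0 < m i)%N) (K : nat).
Implicit Types al : multinom n.

Lemma mdeg_le_mdot al : (mdeg al <= mdot m al)%N.
Proof. by rewrite mdegE; apply: leq_sum => i _; exact: leq_pmull. Qed.

(** Positive weights bound the degree by [K], so the type contains every multi-index of weight [K]
    ([wexp_surj]). *)
Definition wmonom : finType := {al : bmultinom n K.+1 | mdot m al == K}.

Definition wexp (i : 'I_#|{: wmonom}|) : multinom n := val (val (enum_val i)).

Lemma wexp_mdot i : mdot m (wexp i) = K.
Proof. exact/eqP/(valP (enum_val i)). Qed.

Lemma wexp_inj : injective wexp.
Proof. by move=> i j /val_inj/val_inj/enum_val_inj. Qed.

Lemma wexp_surj al : mdot m al = K -> exists i, wexp i = al.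
Proof.
move=> alK; have alb : (mdeg al < K.+1)%N by rewrite ltnS -alK mdeg_le_mdot.
have alP : mdot m (BMultinom alb) == K by apply/eqP.
by exists (enum_rank (exist _ (BMultinom alb) alP : wmonom)); rewrite /wexp enum_rankK.
Qed.

Definition wpoly (a : 'I_#|{: wmonom}| -> Cx R) : mpoly n (Cx R) :=
  \sum_i a i *: mpolyX (Cx R) (wexp i).

Lemma mcoeff_wpoly a i : mcoeff (wexp i) (wpoly a) = a i.
Proof.
rewrite raddf_sum (bigD1 i)//= mcoeffZ mcoeffX eqxx mulr1 big1 ?addr0// => j ji.
by rewrite mcoeffZ mcoeffX (inj_eq wexp_inj) (negbTE ji) mulr0.
Qed.

Lemma wpoly_weight a al : mcoeff al (wpoly a) != 0 -> mdot m al = K.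
Proof.
apply: contra_neqP => alK; rewrite raddf_sum big1// => j _ /=.
rewrite mcoeffZ mcoeffX; case: eqP => [E|_]; last by rewrite mulr0.
by case: alK; rewrite -E wexp_mdot.
Qed.

Lemma peval_wpoly a z : peval (wpoly a) z = \sum_i a i * peval (mpolyX (Cx R) (wexp i)) z.
Proof. by rewrite peval_sum; apply: eq_bigr => i _; rewrite pevalZ. Qed.

End weighted_multinomials.

(** * The kernel polynomials *)

Section kernel.
Context {R : realType} {n' : nat}.
Local Notation n := n'.+1.
Context (m : 'I_n -> nat) (D : set (Cn R n)) (m_gt0 : forall i, (0 < m i)%N)
  (oD : open D) (cD : connected D) (bD : bounded_set D) (D0 : D 0)
  (circ : quasi_circular m D).
Implicit Types (h p : Cn R n -> Cx R) (q : mpoly n (Cx R)) (al be : multinom n).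
Local Notation "<< h , g >>" := (L2_inner D h g).

Let Dfin := bounded_measure oD bD.
Let qH q : H2 D (peval q) := peval_H2 q oD bD.

Lemma inner_weight K q h : (forall al, mcoeff al q != 0 -> mdot m al = K) -> H2 D h ->
  (forall al, mdot m al = K -> multi_partial al h 0 = 0) -> << h, peval q >> = 0.
Proof.
move=> qK hH hK; have [B B0 qB] := bounded_peval q bD.
exact: (orthogonal_weight oD Dfin cD D0 circ qK (qH q) B0 qB hH hK).
Qed.

Lemma mcoeff_eq0 q : (forall z, D z -> peval q z = 0) -> forall al, mcoeff al q = 0.
Proof.
move=> q0 al; apply: (mulfI (mfact_neq0 al)); rewrite mulr0 -multi_partial_peval0.
have E : {in D, peval q =1 peval (0 : mpoly n (Cx R))}.
  by move=> z; rewrite inE => Dz; rewrite q0//; exact/esym/meval0.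
rewrite (eq_multi_partial al oD E); last by rewrite inE.
by rewrite multi_partial_peval0 mcoeff0 mulr0.
Qed.

Section gram.
Variable K : nat.
Let e := @wexp n m K.
Let X i : Cn R n -> Cx R := peval (mpolyX (Cx R) (e i)).

Definition gram := \matrix_(i, j) << X i, X j >>.

Lemma inner_wpoly (a : 'I_#|{: wmonom m K}| -> Cx R) p : H2 D p ->
  << peval (wpoly a), p >> = \sum_i a i * << X i, p >>.
Proof.
move=> pH; rewrite (eq_inner (h' := fun z => \sum_i a i * X i z) (g' := p))//; last first.
  by move=> z _; exact: peval_wpoly.
have aH i : H2 D (fun z => a i * X i z) by apply: (H2Z oD); exact: qH.
rewrite (inner_suml oD Dfin _ aH pH); apply: eq_bigr => i _.
exact: (innerZl oD _ (qH _) pH).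
Qed.

(** A row in the left kernel gives the coefficients of a polynomial orthogonal to all monomials of
    weight [K], hence to itself; it vanishes on [D], and so do its coefficients. *)
Lemma gram_unit : gram \in unitmx.
Proof.
rewrite -row_free_unit -kermx_eq0; apply/eqP/row_matrixP => k; rewrite row0.
set u := row k _; have uG : u *m gram = 0 by rewrite /u -row_mul mulmx_ker row0.
pose q := wpoly (fun i => u 0 i).
have qX j : << peval q, X j >> = 0.
  have uj : (u *m gram) 0 j = 0 by rewrite uG mxE.
  transitivity ((u *m gram) 0 j); last exact: uj.
  rewrite (inner_wpoly _ (qH _)) [RHS]mxE; apply: eq_bigr => i _.
  by congr (_ * _); rewrite /gram mxE.
have qq : << peval q, peval q >> = 0.
  rewrite (inner_wpoly _ (qH _)) big1// => j _.
  by rewrite (inner_conj oD (qH q) (qH _)) qX conjC0 mulr0.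
apply/rowP => j; rewrite [RHS]mxE; have := mcoeff_eq0 (inner_self_eq0 oD (qH q) qq) (e j).
by rewrite mcoeff_wpoly.
Qed.

End gram.

(** By [inner_weight], pairing with a polynomial of weight [K] only sees the part of [h] of weight
    [K]. It is therefore enough to prescribe the inner products with the monomials of that
    weight. *)
Lemma kernel_exists al : exists q, (forall be, mcoeff be q != 0 -> mdot m be = mdot m al) /\
  represents_derivative D al (peval q).
Proof.
set K := mdot m al; have [a alE] := wexp_surj m_gt0 (erefl K).
pose r : 'cV[Cx R]_#|{: wmonom m K}| := \col_i (mfact al *+ (i == a)).
(* The coefficients are conjugated because the inner product is conjugate-linear in its second
   entry. *)
pose c := invmx (gram K) *m r; pose q := wpoly (fun j => (c j 0)^* ).
have qK be : mcoeff be q != 0 -> mdot m be = K by exact: wpoly_weight.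
have Xq i : << peval (mpolyX (Cx R) (wexp i)), peval q >> = mfact al *+ (i == a).
  rewrite (inner_conj oD (qH q) (qH _)) (inner_wpoly _ (qH _)) rmorph_sum /=.
  have : gram K *m c = r by rewrite mulKVmx// gram_unit.
  move=> /(congr1 (fun M : 'cV_ _ => M i 0)); rewrite [RHS]mxE => <-.
  rewrite [RHS]mxE; apply: eq_bigr => j _.
  by rewrite rmorphM /= conjCK mulrC -(inner_conj oD (qH _) (qH _)) [in RHS]mxE.
exists q; split=> //; split=> [|h hH]; first exact: qH.
pose t (i : 'I_#|{: wmonom m K}|) := multi_partial (wexp i) h 0 / mfact (wexp i).
have hh := H2_holo hH.
have tE : << h, peval q >> = << peval (wpoly t), peval q >>.
  apply/eqP; rewrite -subr_eq0 -(innerBl oD hH (qH _) (qH q)); apply/eqP.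
  apply: (inner_weight qK); first exact: (H2B oD hH (qH _)).
  move=> be beK; rewrite (multi_partialB be oD hh (@peval_holomorphic R n D _)); last by rewrite inE.
  have [i <-] := wexp_surj m_gt0 beK.
  by rewrite multi_partial_peval0 mcoeff_wpoly mulrC divfK ?subrr// mfact_neq0.
rewrite tE (inner_wpoly _ (qH _)) (bigD1 a)//= big1 => [|i ia]; last first.
  by rewrite Xq (negbTE ia) mulr0n mulr0.
by rewrite Xq eqxx mulr1n addr0 /t alE divfK// mfact_neq0.
Qed.

Lemma represents_unique al p p' : represents_derivative D al p ->
  represents_derivative D al p' -> forall z, D z -> p z = p' z.
Proof.
move=> [pH hp] [p'H hp'] z Dz; apply/eqP; rewrite -subr_eq0; apply/eqP.
have dH := H2B oD pH p'H.
apply: (inner_self_eq0 oD dH) => //.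
by rewrite (innerBr oD pH p'H dH) hp// hp'// subrr.
Qed.

Lemma kernel_funP al : represents_derivative D al (kernel_fun D al).
Proof.
have [q [_ hq]] := kernel_exists al.
by apply: (@xgetPex _ _ [set p | represents_derivative D al p]); exists (peval q).
Qed.

Lemma kernel_polyP al :
  (forall be, mcoeff be (kernel_poly m D al) != 0 -> mdot m be = mdot m al) /\
  (forall z, D z -> kernel_fun D al z = peval (kernel_poly m D al) z).
Proof.
apply: (@xgetPex _ _ [set q : mpoly n (Cx R) |
    (forall beta, mcoeff beta q != 0 -> mdot m beta = mdot m al) /\
    (forall z, D z -> kernel_fun D al z = peval q z)]).
have [q [qK hq]] := kernel_exists al; exists q; split=> // z Dz.
exact: represents_unique (kernel_funP al) hq z Dz.
Qed.

Lemma inner_kernel al h : H2 D h -> << h, peval (kernel_poly m D al) >> = multi_partial al h 0.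
Proof.
move=> hH; have [_ <-//] := kernel_funP al.
by apply: eq_inner => z Dz //; rewrite (kernel_polyP al).2.
Qed.

(** Pairing with the monomial of exponent [al] gives [mfact al], which is nonzero. Hence d(al) is a
    true minimum and not the default of [set_min]. *)
Lemma kernel_poly_neq0 al : exists be, mcoeff be (kernel_poly m D al) != 0.
Proof.
apply: contrapT => H; have q0 : kernel_poly m D al = 0.
  by apply/mpolyP => be; rewrite mcoeff0; apply: contrapT => /eqP b0; apply: H; exists be.
have := inner_kernel al (qH (mpolyX (Cx R) al)).
rewrite q0 multi_partial_peval0 mcoeffX eqxx mulr1 (inner_conj oD (qH _) (qH _)).
suff -> : << peval (0 : mpoly n (Cx R)), peval (mpolyX (Cx R) al) >> = 0.
  by rewrite conjC0 => /esym/eqP; rewrite (negbTE (mfact_neq0 al)).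
rewrite -(mul0r (<< peval 0, peval (mpolyX (Cx R) al) >>)) -(innerZl oD _ (qH _) (qH _)).
by apply: eq_inner => z _ //; rewrite mul0r; exact: meval0.
Qed.

Lemma kernel_min_degreeP al :
  (exists2 be, mdot m be = mdot m al & mdeg be = kernel_min_degree m D al) /\
  forall be, mcoeff be (kernel_poly m D al) != 0 -> (kernel_min_degree m D al <= mdeg be)%N.
Proof.
have [be0 b0] := kernel_poly_neq0 al.
have [|[be bn bE] le] := @set_minP [set mdeg beta | beta in
   [set beta | mcoeff beta (kernel_poly m D al) != 0]] (mdeg be0).
  by exists be0.
split; first by exists be => //; exact: (kernel_polyP al).1 bn.
by move=> be1 b1; apply: le; exists be1.
Qed.

Lemma mdeg_le_resonance_order i al : mdot m al = m i -> (mdeg al <= resonance_order m i)%N.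
Proof.
move=> alm; apply: (@le_set_max _ (m i)); last by exists al.
by move=> _ [be /= <- <-]; exact: mdeg_le_mdot.
Qed.

(** The degrees in Q_k are bounded: an exponent [ga] of least degree in the kernel polynomial of
    [be] has the weight of [be] and degree at most [k], so the degree of [be] is at most k times the
    largest weight. *)
Lemma mdeg_le_quasi_resonance i al : Qset m D (resonance_order m i) al ->
  (mdeg al <= ith_quasi_resonance_order m D i)%N.
Proof.
move=> alQ; set k := resonance_order m i in alQ *.
apply: (@le_set_max _ ((\max_j m j) * k)%N); last by exists al.
move=> _ [be /negP beQ <-]; rewrite -leqNgt in beQ.
apply: leq_trans (mdeg_le_mdot m_gt0 be) _.
have [[ga <- gE] _] := kernel_min_degreeP be; rewrite -gE in beQ.
apply: leq_trans (leq_mul (leqnn _) beQ); rewrite mdegE /mdot big_distrr /=.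
by apply: leq_sum => j _; rewrite leq_mul2r leq_bigmax orbT.
Qed.

(** A function in M_k has vanishing derivatives at 0 in all degrees below [k], which here include
    all multi-indices of weight [K]. *)
Lemma orth_peval K k q : (forall al, mcoeff al q != 0 -> mdot m al = K) ->
  (forall al, mdot m al = K -> (mdeg al < k)%N) -> orth D k (peval q).
Proof.
move=> qK Kk; split=> [|h hH hk]; first exact: qH.
apply: (inner_weight qK hH) => al /Kk alk.
exact: ord_multi_partial oD D0 (H2_holo hH) alk hk.
Qed.

End kernel.

(** * Automorphisms fixing the origin *)

Section automorphisms.
Context {R : realType} {n' : nat}.
Local Notation n := n'.+1.
Context (m : 'I_n -> nat) (D : set (Cn R n)) (m_gt0 : forall i, (0 < m i)%N)
  (oD : open D) (cD : connected D) (bD : bounded_set D) (D0 : D 0)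
  (circ : quasi_circular m D).
Context (f F : Cn R n -> Cn R n) (fF : biholomorphic D f F) (f0 : f 0 = 0).
Local Notation "<< h , g >>" := (L2_inner D h g).

Let Dfin := bounded_measure oD bD.
Let qH q : H2 D (peval q) := peval_H2 q oD bD.
Let fh : holomorphic D f. Proof. by case: fF. Qed.
Let Fh : holomorphic D F. Proof. by case: fF. Qed.
Let fD z : D z -> D (f z). Proof. by case: fF => _ _ + _ _; apply. Qed.
Let fK z : D z -> F (f z) = z. Proof. by case: fF => _ _ _ _ [+ _]; apply. Qed.

Let u z := \det (jac f z).

Lemma jacobian_neq0 : u 0 != 0.
Proof.
have [uJ _] := mulmx1_unit (jac_inverse oD fh Fh fD fK D0).
by move: uJ; rewrite unitmxE unitfE.
Qed.

Lemma jacobian_constant z : D z -> u z = u 0.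
Proof.
have uh : holomorphic D u := det_jac_holomorphic oD fh.
have o1 : orth D 1 (peval (1 : mpoly n (Cx R))).
  apply: (orth_peval oD cD bD D0 circ (K := 0%N)) => al.
    rewrite mcoeff1 => a0; have [->|al0] := eqVneq al mnm0; last first.
      by move: a0; rewrite (negbTE al0) eqxx.
    by rewrite /mdot big1// => i _; rewrite mnm0E muln0.
  by move=> al0; rewrite ltnS -al0; exact: mdeg_le_mdot.
have E w : peval (1 : mpoly n (Cx R)) w = 1 by exact: meval1.
have o2 := orth_transport oD Dfin fF D0 f0 o1.
have o3 := orthB oD o2 (orthZ oD (u 0) o1).
have G w : transport f (peval 1) w - u 0 * peval 1 w = u w - u 0.
  have gen (a b x y : Cx R) : x = 1 -> y = 1 -> a * x - b * y = a - b.
    by move=> -> ->; rewrite !mulr1.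
  exact: (gen (u w) (u 0) _ _ (E (f w)) (E w)).
have o4 : ord (fun w => transport f (peval 1) w - u 0 * peval 1 w) 1.
  have -> : (fun w => transport f (peval 1) w - u 0 * peval 1 w) = fun w => u w - u 0.
    by apply/funext => w; exact: G.
  apply: ord_differentiable; last by rewrite subrr.
  by apply: differentiableB; [exact: (uh 0 D0)|exact: differentiable_cst].
move=> Dz; apply/eqP; rewrite -subr_eq0; apply/eqP; rewrite -G.
exact: (orth_ord_eq0 oD o3 o4 Dz).
Qed.

Lemma component_H2 i : H2 D (fun z => f z 0 i).
Proof.
have [M M0 DM] := bounded_nrm bD.
apply: (@H2_bounded _ _ D oD Dfin _ M) => z Dz.
  exact: differentiable_coordinate (fh Dz).
exact: le_trans (coord_le_nrm _ _) (DM _ (fD Dz)).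
Qed.

Lemma component_orth i : orth D (resonance_order m i).+1 (fun z => f z 0 i).
Proof.
have oX : orth D (resonance_order m i).+1 (peval (mpolyX (Cx R) (mnm1 i))).
  apply: (orth_peval oD cD bD D0 circ (K := m i)) => al; last first.
    by move=> alm; rewrite ltnS; exact: mdeg_le_resonance_order.
  rewrite mcoeffX; have [<- _|_] := eqVneq (mnm1 i) al; last by rewrite eqxx.
  rewrite /mdot (bigD1 i)//= big1 => [|j ji].
    by rewrite mnm1E eqxx muln1 addn0.
  by rewrite mnm1E eq_sym (negbTE ji) muln0.
(* The coordinate function is transported to [u] times the component of [f]; the Jacobian being a
   nonzero constant, it can be divided out. *)
apply: (eq_orth (component_H2 i) _ (orthZ oD (u 0)^-1 (orth_transport oD Dfin fF D0 f0 oX))).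
move=> z Dz; rewrite /transport -/(u z) (jacobian_constant Dz) mulKf ?jacobian_neq0//.
by rewrite /peval mevalXU.
Qed.

Lemma component_multi_partial i al : (ith_quasi_resonance_order m D i < mdeg al)%N ->
  multi_partial al (fun z => f z 0 i) 0 = 0.
Proof.
move=> alD; have kal : (resonance_order m i < kernel_min_degree m D al)%N.
  rewrite ltnNge; apply/negP => le; move: alD; rewrite ltnNge => /negP; apply.
  apply: (mdeg_le_quasi_resonance m_gt0 oD cD bD D0 circ).
  by rewrite /Qset /Pset /=; apply/negP; rewrite -leqNgt.
have fi := component_H2 i; have [_ fo] := component_orth i.
rewrite -(inner_kernel m_gt0 oD cD bD D0 circ al fi) (inner_conj oD (qH _) fi).
rewrite fo ?conjC0//; apply: ord_peval => be be0.
apply: leq_trans kal _.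
exact: (kernel_min_degreeP m_gt0 oD cD bD D0 circ al).2.
Qed.

Lemma component_polynomial i z : D z ->
  f z 0 i = peval (taylor_poly (ith_quasi_resonance_order m D i).+1 (fun z => f z 0 i)) z.
Proof.
move=> Dz; set k := (ith_quasi_resonance_order m D i).+1; set h := fun z => f z 0 i.
have hh : holomorphic D h := H2_holo (component_H2 i).
have qh : holomorphic D (fun w => h w - peval (taylor_poly k h) w).
  by move=> w Dw; apply: differentiableB; [exact: hh|exact: (@peval_holomorphic R n D)].
apply/eqP; rewrite -subr_eq0; apply/eqP.
apply: (identity_theorem oD cD D0 qh) Dz => l.
(* The Taylor polynomials of all orders beyond [k] coincide, their further coefficients being 0, so
   agreement to order [maxn l k] is available for each [l]. *)
apply: (ord_le (leq_maxl l k)).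
have <- : taylor_poly (maxn l k) h = taylor_poly k h.
  apply/mpolyP => al; rewrite !mcoeff_taylor_poly.
  have [alk|kal] := ltnP (mdeg al) k; first by rewrite (leq_trans alk (leq_maxr _ _)).
  by rewrite component_multi_partial// mul0r if_same.
exact: ord_taylor_poly oD D0 hh.
Qed.

End automorphisms.

Lemma pdegree_taylor_poly (R : realType) (n k : nat) (h : Cn R n -> Cx R) :
  (pdegree (taylor_poly k.+1 h) <= k)%N.
Proof.
have le : (msize (taylor_poly k.+1 h) <= k.+1)%N.
  rewrite msizeE; apply/bigmax_leqP_seq => al alq _.
  move: alq; rewrite mcoeff_msupp mcoeff_taylor_poly; case: ifP => //.
  by rewrite eqxx.
by rewrite /pdegree; case: (msize _) le.
Qed.

Theorem theorem1p1 (R : realType) (n : nat) (m : 'I_n -> nat)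
    (D : set (Cn R n)) (f : Cn R n -> Cn R n)
    (m_weight : normalized_weight m)
    (D_domain : domain D) (D_bounded : bounded_set D)
    (D_circular : quasi_circular m D) (D_origin : D 0)
    (f_aut : automorphism D f) (f_origin : f 0 = 0) :
  exists q : 'I_n -> mpoly.mpoly n (Cx R),
    [/\ forall z, D z -> forall i, f z 0 i = peval (q i) z,
        forall i, (pdegree (q i) <= quasi_resonance_order m D)%N &
        forall i, (pdegree (q i) <= ith_quasi_resonance_order m D i)%N].
Proof.
have [m_gt0 _ m_gcd] := m_weight; have [oD cD] := D_domain.
have [fh fD [F [Fh FD fK FK]]] := f_aut.
case: n m D f m_weight D_domain D_bounded D_circular D_origin f_aut f_origin
  m_gt0 m_gcd oD cD fh fD F Fh FD fK FK => [|n'].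
  (* In dimension 0 the empty gcd is 0, which contradicts the normalisation to 1. *)
  by move=> m ? ? ? ? ? ? ? ? ? ?; rewrite big_ord0.
move=> m D f _ _ bD circ D0 _ f0 m_gt0 _ oD cD fh fD F Fh FD fK FK.
have fF : biholomorphic D f F.
  split=> //.
  - by move=> z Dz; apply: fD; exists z.
  - by move=> z Dz; apply: FD; exists z.
exists (fun i => taylor_poly (ith_quasi_resonance_order m D i).+1 (fun z => f z 0 i)).
split=> [z Dz i|i|i].
- exact: (component_polynomial m_gt0 oD cD bD D0 circ fF f0).
- apply: leq_trans (pdegree_taylor_poly _ _) _.
  exact: (leq_bigmax_cond (F := ith_quasi_resonance_order m D)).
- exact: pdegree_taylor_poly.
Qed.
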